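(* Let $k$ and $n$ be positive integers. The equator map $u^*:B^n\to\mathbb{S}^n$, $u^*(x)=(x/|x|,0)$, belongs to $W^{k,2}(B^n,\mathbb{S}^n)$ if and only if $n\geq 2k+1$. Moreover, if $n\geq 2k+1$, then $u^*$ is an extrinsic (weakly) $k$-harmonic map.
   Context: $B^n\subset\mathbb{R}^n$ is the Euclidean unit ball and $\mathbb{S}^n\subset\mathbb{R}^{n+1}=\mathbb{R}^n\times\mathbb{R}$ the unit sphere. $W^{k,2}(B^n,\mathbb{S}^n)=\{u\in W^{k,2}(B^n,\mathbb{R}^{n+1}) : u(x)\in\mathbb{S}^n \text{ for a.e. } x\}$. The extrinsic $k$-energy is defined on $W^{k,2}(B^n,\mathbb{S}^n)$ by $E_k^{\rm ext}(u)=\int_{B^n}|\Delta^s u|^2\,dx$ if $k=2s$, and $E_k^{\rm ext}(u)=\int_{B^n}|\nabla\Delta^s u|^2\,dx$ if $k=2s+1$. Here $\Delta$ and $\nabla$ act componentwise, $\Delta f=f''$ on $\mathbb{R}$, $\Delta^0u=u$, and norms are Euclidean. A map $u\in W^{k,2}(B^n,\mathbb{S}^n)$ is extrinsic (weakly) $k$-harmonic if $\frac{d}{dt}E_k^{\rm ext}(u_t)\big|_{t=0}=0$ for all variations $u_t=\Pi(u+t\phi)$ with $\phi\in C_0^\infty(B^n,\mathbb{R}^{n+1})$, where $\Pi(y)=y/|y|$ is the nearest point projection onto $\mathbb{S}^n$. *)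

(* Defs.v *)
From HB Require Import structures.
From mathcomp Require Import all_boot all_order all_algebra.
From mathcomp Require Import all_classical all_reals all_analysis.
Set Implicit Arguments.
Unset Strict Implicit.
Unset Printing Implicit Defensive.
Import Order.TTheory GRing.Theory Num.Theory.
Import numFieldNormedType.Exports.
Local Open Scope classical_set_scope.
Local Open Scope ring_scope.

(* The product sigma-algebra on R^n, which is also the Borel sigma-algebra. *)
Section measurable_rV.
Context {R : realType} (n : nat).

Let coors : 'I_n -> 'rV[R]_n -> measurableTypeR R := fun i x => x ord0 i.

Let rV_set0 : g_sigma_preimage coors set0.
Proof. exact: sigma_algebra0. Qed.

Let rV_setC A : g_sigma_preimage coors A -> g_sigma_preimage coors (~` A).
Proof. exact: sigma_algebraC. Qed.

Let rV_bigcup (F : (set 'rV[R]_n)^nat) :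
  (forall i, g_sigma_preimage coors (F i)) ->
  g_sigma_preimage coors (\bigcup_i (F i)).
Proof. exact: sigma_algebra_bigcup. Qed.

HB.instance Definition _ := @isMeasurable.Build default_measure_display
  'rV[R]_n (g_sigma_preimage coors) rV_set0 rV_setC rV_bigcup.

Lemma measurable_coor (i : 'I_n) :
  measurable_fun [set: 'rV[R]_n]
    (fun x : 'rV[R]_n => (x ord0 i : measurableTypeR R)).
Proof.
move=> _ Y mY; rewrite setTI; apply: sub_sigma_algebra => /=.
rewrite -bigcup_seq/=; exists i => /=; first by rewrite mem_index_enum.
by exists Y => //; rewrite setTI.
Qed.

Lemma measurable_coorP d (T : measurableType d) (f : T -> 'rV[R]_n) :
  (forall i, measurable_fun [set: T]
     (fun x => (f x ord0 i : measurableTypeR R))) ->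
  measurable_fun [set: T] f.
Proof.
move=> mf _ Y mY; rewrite setTI.
pose S := [set A : set 'rV[R]_n | measurable (f @^-1` A)].
suff : S Y by [].
apply: mY; split.
  split; rewrite /S/=.
  - by rewrite preimage_set0.
  - by move=> A mA; rewrite setTD preimage_setC; exact: measurableC.
  - by move=> F mF; rewrite preimage_bigcup; exact: bigcup_measurable.
rewrite -bigcup_seq => A [/= i _ [B mB <-]].
rewrite /S/= setTI.
by have := mf i measurableT _ mB; rewrite setTI.
Qed.

End measurable_rV.

Section lebesgue_rV.
Context {R : realType}.

Definition rV_cons n (p : measurableTypeR R * 'rV[R]_n) : 'rV[R]_n.+1 :=
  row_mx (const_mx p.1 : 'rV[R]_1) p.2.

Definition rV_uncons n (x : 'rV[R]_n.+1) : measurableTypeR R * 'rV[R]_n :=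
  (x ord0 ord0, rsubmx (x : 'rV[R]_(1 + n))).

Lemma rV_consK n : cancel (@rV_cons n) (@rV_uncons n).
Proof.
move=> [a x]; rewrite /rV_uncons /rV_cons; congr pair; last first.
  by rewrite row_mxKr.
rewrite (_ : (ord0 : 'I_n.+1) = lshift n (ord0 : 'I_1)); last exact/val_inj.
by rewrite (row_mxEl (const_mx a : 'rV[R]_1)) mxE.
Qed.

Lemma measurable_rV_cons n : measurable_fun setT (@rV_cons n).
Proof.
apply: measurable_coorP => i.
have [j ij|j ij] := split_ordP (i : 'I_(1 + n)).
  rewrite (_ : (fun x => _) = fst)//; apply/funext => x.
  by rewrite /rV_cons ij (row_mxEl (const_mx _ : 'rV[R]_1)) mxE.
rewrite (_ : (fun x => _) = (fun x : 'rV[R]_n => x ord0 j) \o snd).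
  exact: (measurableT_comp (measurable_coor j) measurable_snd).
by apply/funext => x; rewrite /rV_cons ij (row_mxEr (const_mx _ : 'rV[R]_1)).
Qed.

Lemma measurable_rV_uncons n : measurable_fun setT (@rV_uncons n).
Proof.
apply/measurable_fun_pairP; split; first exact: measurable_coor.
apply: measurable_coorP => i /=.
rewrite (_ : (fun x => _) =
    (fun x : 'rV[R]_n.+1 => x ord0 (rshift 1 i : 'I_n.+1))).
  exact: measurable_coor.
by apply/funext => x; rewrite mxE.
Qed.

Section cons_measure.
Context n (mu : {sigma_finite_measure set 'rV[R]_n -> \bar R}).

Definition cons_measure : set 'rV[R]_n.+1 -> \bar R :=
  pushforward (lebesgue_measure \x mu)%E (@rV_cons n).

Let pf : {measure set 'rV[R]_n.+1 -> \bar R} :=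
  measure_function_pushforward__canonical__measure_function_Measure
    (lebesgue_measure \x mu)%E (@measurable_rV_cons n).

Let cons_measure0 : cons_measure set0 = 0%E.
Proof. exact: (@measure0 _ _ _ pf). Qed.

Let cons_measure_ge0 A : (0 <= cons_measure A)%E.
Proof. exact: (@measure_ge0 _ _ _ pf). Qed.

Let cons_measure_sigma_additive : semi_sigma_additive cons_measure.
Proof. exact: (@measure_semi_sigma_additive _ _ _ pf). Qed.

HB.instance Definition _ := isMeasure.Build _ _ _ cons_measure
  cons_measure0 cons_measure_ge0 cons_measure_sigma_additive.

Let cons_measure_sigma_finite : sigma_finite setT cons_measure.
Proof.
have /sigma_finiteP[F [TF ndF Foo]] := sigma_finiteT (@lebesgue_measure R).
have /sigma_finiteP[G [TG ndG Goo]] := sigma_finiteT mu.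
exists (fun i => @rV_uncons n @^-1` (F i `*` G i)) => [|i].
  apply/esym; rewrite -subTset => x _.
  have [i _ Fi] : (\bigcup_i F i) (rV_uncons x).1 by rewrite -TF.
  have [j _ Gj] : (\bigcup_i G i) (rV_uncons x).2 by rewrite -TG.
  exists (maxn i j) => //; split.
  - by move: Fi; exact/subsetPset/ndF/leq_maxl.
  - by move: Gj; exact/subsetPset/ndG/leq_maxr.
have [mF Fi] := Foo i; have [mG Gi] := Goo i.
have mFG : measurable (F i `*` G i) by exact: measurableX.
split; first by rewrite -[X in measurable X]setTI; exact: measurable_rV_uncons.
rewrite /cons_measure /pushforward -comp_preimage.
rewrite (_ : _ \o _ = id); last by apply/funext; exact: rV_consK.
by rewrite preimage_id product_measure1E// lte_mul_pinfty// ge0_fin_numE.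
Qed.

HB.instance Definition _ := Measure_isSigmaFinite.Build _ _ _ cons_measure
  cons_measure_sigma_finite.

End cons_measure.

Fixpoint lebesgue_rV n : {sigma_finite_measure set 'rV[R]_n -> \bar R} :=
  match n with
  | 0 => \d_(0 : 'rV[R]_0)
  | m.+1 => cons_measure (lebesgue_rV m)
  end.

End lebesgue_rV.

Section sobolev.
Context {R : realType}.

Definition enorm n (x : 'rV[R]_n) : R := Num.sqrt (\sum_i x ord0 i ^+ 2).

(* `|x| is the sup norm on 'rV[R]_n, so the Euclidean ball is not [ball 0 1]. *)
Definition eball n : set 'rV[R]_n := [set x | enorm x < 1].

Definition coord n m (u : 'rV[R]_n -> 'rV[R]_m) (j : 'I_m) : 'rV[R]_n -> R :=
  fun x => u x ord0 j.

(* [pderivs [:: i1; ...; ir] f] is the classical derivative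
   d_i1 (... (d_ir f)); words stand for multi-indices. *)
Definition pderivs n (s : seq 'I_n) (f : 'rV[R]_n -> R) : 'rV[R]_n -> R :=
  foldr (fun i g => 'D_(delta_mx ord0 i) g) f s.

Definition smooth n (f : 'rV[R]_n -> R) : Prop :=
  forall s : seq 'I_n, continuous (pderivs s f) /\
    forall (i : 'I_n) (x : 'rV[R]_n),
      derivable (pderivs s f) x (delta_mx ord0 i).

(* C_0^oo(B^n), each function being extended by 0 to R^n. *)
Definition test_fun n (phi : 'rV[R]_n -> R) : Prop :=
  [/\ smooth phi,
      compact (closure [set x | phi x != 0]) &
      closure [set x | phi x != 0] `<=` @eball n].

(* Borel representatives of the elements of L^2(B^n). *)
Definition L2_ball n (f : 'rV[R]_n -> R) : Prop :=
  measurable_fun (@eball n) f /\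
  (\int[lebesgue_rV n]_(x in @eball n) ((f x) ^+ 2)%:E < +oo)%E.

Definition weak_deriv n (s : seq 'I_n) (f g : 'rV[R]_n -> R) : Prop :=
  forall phi, test_fun phi ->
    \int[lebesgue_rV n]_(x in @eball n) (f x * pderivs s phi x) =
    (-1) ^+ size s * \int[lebesgue_rV n]_(x in @eball n) (g x * phi x).

Definition sobolev n m (k : nat) (u : 'rV[R]_n -> 'rV[R]_m) : Prop :=
  forall j : 'I_m, L2_ball (coord u j) /\
    forall s : seq 'I_n, (size s <= k)%N ->
      exists2 g, L2_ball g & weak_deriv s (coord u j) g.

(* W^{k,2}(B^n, S^n), with R^{n+1} = R^n x R encoded as 'rV[R]_(n + 1). *)
Definition sobolev_sphere n (k : nat) (u : 'rV[R]_n -> 'rV[R]_(n + 1)) : Prop :=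
  sobolev k u /\
  {ae lebesgue_rV n, forall x, eball x -> enorm (u x) = 1}.

(* The weak derivative d_i f, unique a.e. on B^n when it exists in L^2(B^n);
   a fixed representative is chosen, and 0 is the junk value otherwise. *)
Definition wpderiv n (i : 'I_n) (f : 'rV[R]_n -> R) : 'rV[R]_n -> R :=
  xget (fun=> 0) [set g | L2_ball g /\ weak_deriv [:: i] f g].

Definition wlaplacian n (f : 'rV[R]_n -> R) : 'rV[R]_n -> R :=
  fun x => \sum_(i < n) wpderiv i (wpderiv i f) x.

(* Meaningful for u in W^{k,2}: all the weak derivatives used then exist in
   L^2(B^n) and the value does not depend on the chosen representatives. *)
Definition ext_energy n m (k : nat) (u : 'rV[R]_n -> 'rV[R]_m) : R :=
  let v j := iter k./2 (@wlaplacian n) (coord u j) in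
  \int[lebesgue_rV n]_(x in @eball n)
    (if odd k then \sum_(j < m) \sum_(i < n) wpderiv i (v j) x ^+ 2
     else \sum_(j < m) v j x ^+ 2).

Definition sphere_proj m (y : 'rV[R]_m) : 'rV[R]_m := (enorm y)^-1 *: y.

Definition variation n m (u phi : 'rV[R]_n -> 'rV[R]_m) (t : R) :
    'rV[R]_n -> 'rV[R]_m :=
  fun x => sphere_proj (u x + t *: phi x).

(* Differentiating E_k(u_t) at t = 0 presupposes that u_t lies in the domain
   W^{k,2}(B^n, S^n) of E_k for all small t; this is required explicitly since
   [ext_energy] is a total function. *)
Definition ext_harmonic n (k : nat) (u : 'rV[R]_n -> 'rV[R]_(n + 1)) : Prop :=
  sobolev_sphere k u /\
  forall phi : 'rV[R]_n -> 'rV[R]_(n + 1),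
    (forall j, test_fun (coord phi j)) ->
    (\forall t \near (0 : R), sobolev_sphere k (variation u phi t)) /\
    is_derive (0 : R) (1 : R) (fun t => ext_energy k (variation u phi t)) 0.

(* At the origin the value is 0, since 0^-1 = 0. *)
Definition equator n (x : 'rV[R]_n) : 'rV[R]_(n + 1) :=
  row_mx ((enorm x)^-1 *: x) (0 : 'rV[R]_1).

End sobolev.

(* Main.v *)
(* Off the origin the equator map is homogeneous of degree 0, so its derivatives
   of order r are O(|x|^-r), which is square integrable on the ball iff 2r < n; one
   integrates by parts on the lines that miss the origin, so for 2k < n the classical
   derivatives are the weak ones. As Delta^k u = c |x|^(-2k) u, and
   |u + t w| = |u| = 1 gives 2t <u, w> = - t^2 |w|^2, the cross term in the energy
   of u_t = u + t w is O(t^2), hence so is E(u_t) - E(u).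
   Conversely, if n <= 2k, testing the weak derivative d_0^k u_0 with phi(x/eps)
   and letting eps -> 0 gives int u_0 d_0^k phi = 0 for all phi. If n >= 2, then
   d_0^k u_0 = 0 off the origin; by the decay of its derivatives u_0 is then constant
   on the lines parallel to the first axis, which is false. If n = 1, the same is
   done with the first derivative and a radially decreasing phi. *)
Require Import Defs.
From mathcomp Require Import all_boot all_order all_algebra.
From mathcomp Require Import all_classical all_reals all_analysis.
From mathcomp Require Import measurable_realfun ring lra zify.
Set Implicit Arguments.
Unset Strict Implicit.
Unset Printing Implicit Defensive.
Import Order.TTheory GRing.Theory Num.Theory.
Import numFieldNormedType.Exports.
Local Open Scope classical_set_scope.
Local Open Scope ring_scope.

(** * Lebesgue measure on row vectors *)

Section measure_rV.
Context {R : realType}.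

(** The obstacle is the origin: the functions are smooth only away from it, and test functions need
    not vanish there. The calculus therefore runs on the class [sym], where a singularity is
    measured by one integer: orders add under products, a derivative raises the order by one, and
    order below n means integrable on the ball. Green's formula has to hold with both factors
    singular at the origin, and the total order 2k < n is what removes any contribution of the
    origin. The correction [w = (u_t - u) / t] has order 0 with constants uniform in [t]; this
    uniformity makes the remainder O(t^2). The lines through the origin parallel to an axis form a
    null set of lines only if n >= 2. For n = 1 the component u_0 is the sign function, which is
    locally constant off the origin, so the contradiction must come from the jump itself. In the
    borderline case n = 2k the dilation argument has no power of eps to spare; the gain comes from
    the integral of g^2 over balls that shrink to the origin. *)

Lemma measurable_mxball n (x : 'rV[R]_n) (e : R) : measurable (ball x e).
Proof.
(* Matrix balls are empty for [e <= 0] by definition; without the case distinction the intersection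
   over the empty index set, for [n = 0], would be the whole space. *)
have -> : ball x e = if 0 < e then
    \bigcap_(i in [set: 'I_n]) ((fun y : 'rV[R]_n => y ord0 i) @^-1` (ball (x ord0 i) e))
    else set0.
  apply/seteqP; split=> y.
    by move=> [-> h] i _; apply: h.
  by case: ifPn => // e0 h; split=> // i j; rewrite ord1; exact: h.
case: ifPn => // e0.
apply: fin_bigcap_measurable; first exact: finite_finset.
move=> i _; rewrite -[X in measurable X]setTI; apply: (measurable_coor i) => //.
by rewrite ball_itv; exact: measurable_itv.
Qed.

(** The sigma-algebra is generated by the coordinates, so open sets are reached through a countable
    base: the balls with rational centres and radii 1/(m+1) contained in [U] cover it. *)
Lemma open_measurable_rV n (U : set 'rV[R]_n) : open U -> measurable U.
Proof.
move=> oU.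
pose V (p : 'rV[rat]_n * nat) : set 'rV[R]_n :=
  if asbool (ball (map_mx (@ratr R) p.1 : 'rV[R]_n) p.2.+1%:R^-1 `<=` U)
  then ball (map_mx (@ratr R) p.1 : 'rV[R]_n) p.2.+1%:R^-1 else set0.
have -> : U = \bigcup_p V p.
  apply/seteqP; split=> x; last first.
    by move=> [p _]; rewrite /V; case: asboolP => // pU /pU.
  move=> Ux; have /nbhs_ballP[e e0 xe] : nbhs x U by exact: open_nbhs_nbhs.
  have [m me] : exists m : nat, m.+1%:R^-1 < e / 2.
    have e20 : 0 < e / 2 by rewrite divr_gt0.
    have [m _ /(_ m) h] := near_infty_natSinv_lt (PosNum e20).
    by exists m; apply: h => /=.
  have /choice[q qx] : forall i, exists q : rat, ball (x ord0 i) m.+1%:R^-1 (ratr q : R).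
    move=> i; have [q] := @rat_in_itvoo R (x ord0 i - m.+1%:R^-1) (x ord0 i + m.+1%:R^-1)
      ltac:(by rewrite ltrD2l gtrN// invr_gt0).
    by rewrite in_itv/= => /andP[q1 q2]; exists q; rewrite /ball/= ltr_distlC q1 q2.
  pose y : 'rV[rat]_n := \row_i q i.
  have m0 : 0 < m.+1%:R^-1 :> R by rewrite invr_gt0.
  have yx : ball (map_mx (@ratr R) y : 'rV[R]_n) m.+1%:R^-1 x.
    by split=> // i j; rewrite !mxE ord1; apply/ball_sym; exact: qx.
  exists (y, m) => //; rewrite /V/=; case: asboolP => // h; exfalso; apply: h => z yz.
  apply: xe; apply: (@le_ball _ _ _ (m.+1%:R^-1 + m.+1%:R^-1)).
    by rewrite (splitr e) lerD// ltW.
  by apply: ball_triangle yz; apply/ball_sym.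
apply: countable_bigcupT_measurable => // p.
by rewrite /V; case: asboolP => // _; exact: measurable_mxball.
Qed.

(** For fixed [y] this parametrizes the line over [y] parallel to the i-th axis by its i-th
    coordinate; [rV_cons] is the case of the first axis. *)
Definition rV_ins n (i : 'I_n.+1) (t : R) (y : 'rV[R]_n) : 'rV[R]_n.+1 :=
  \row_j oapp (fun k => y ord0 k) t (unlift i j).

Lemma rV_ins_coor n (i : 'I_n.+1) t (y : 'rV[R]_n) : rV_ins i t y ord0 i = t.
Proof. by rewrite mxE unlift_none. Qed.

Lemma rV_ins_lift n (i : 'I_n.+1) t (y : 'rV[R]_n) k :
  rV_ins i t y ord0 (lift i k) = y ord0 k.
Proof. by rewrite mxE liftK. Qed.

Lemma rV_cons0 n t (y : 'rV[R]_n) : rV_cons (t, y) ord0 ord0 = t.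
Proof. by have /(congr1 fst) := rV_consK (t, y). Qed.

Lemma rV_consS n t (y : 'rV[R]_n) k : rV_cons (t, y) ord0 (lift ord0 k) = y ord0 k.
Proof.
rewrite /rV_cons (_ : lift ord0 k = rshift 1 k); last exact/val_inj.
by rewrite (row_mxEr (const_mx _ : 'rV[R]_1)).
Qed.

Lemma rV_ins0 n t (y : 'rV[R]_n) : rV_ins ord0 t y = rV_cons (t, y).
Proof.
apply/rowP => j; case: (unliftP ord0 j) => [k|] ->.
  by rewrite rV_ins_lift rV_consS.
by rewrite rV_ins_coor rV_cons0.
Qed.

Lemma rV_insS n (i : 'I_n.+1) s t (y : 'rV[R]_n) :
  rV_ins (lift ord0 i) t (rV_cons (s, y)) = rV_cons (s, rV_ins i t y).
Proof.
apply/rowP => j; case: (unliftP (lift ord0 i) j) => [k|] ->; last first.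
  by rewrite rV_ins_coor rV_consS rV_ins_coor.
rewrite rV_ins_lift; case: (unliftP ord0 k) => [l|] ->.
  rewrite rV_consS (_ : lift (lift ord0 i) (lift ord0 l) = lift ord0 (lift i l)).
    by rewrite rV_consS rV_ins_lift.
  by apply/val_inj => /=; rewrite /bump/=; lia.
rewrite rV_cons0 (_ : lift (lift ord0 i) ord0 = ord0) ?rV_cons0//.
exact/val_inj.
Qed.

Lemma measurable_rV_ins n (i : 'I_n.+1) : measurable_fun setT
  (fun p : measurableTypeR R * 'rV[R]_n => rV_ins i p.1 p.2).
Proof.
apply: measurable_coorP => j; case: (unliftP i j) => [k|] ->.
  under eq_fun do rewrite rV_ins_lift.
  exact: (measurableT_comp (measurable_coor k) measurable_snd).
under eq_fun do rewrite rV_ins_coor.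
exact: measurable_fst.
Qed.

Lemma measurable_rV_insr n (i : 'I_n.+1) t :
  measurable_fun setT (rV_ins i t : 'rV[R]_n -> 'rV[R]_n.+1).
Proof.
apply: measurable_coorP => j; case: (unliftP i j) => [k|] ->.
  by under eq_fun do rewrite rV_ins_lift; exact: measurable_coor.
by under eq_fun do rewrite rV_ins_coor; exact: measurable_cst.
Qed.

Local Open Scope ereal_scope.

Lemma ge0_integral_rV_cons n (f : 'rV[R]_n.+1 -> \bar R) :
  measurable_fun setT f -> (forall x, 0 <= f x) ->
  \int[lebesgue_rV n.+1]_x f x =
  \int[lebesgue_measure]_t \int[lebesgue_rV n]_y f (rV_cons (t, y)).
Proof.
move=> mf f0.
rewrite [LHS](@ge0_integral_pushforward _ _ _ _ R _ (@measurable_rV_cons R n)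
  (lebesgue_measure \x lebesgue_rV n) setT f)//= preimage_setT.
rewrite fubini_tonelli1//.
exact: measurableT_comp (@measurable_rV_cons _ n).
Qed.

(** The measure is built by splitting off the first coordinate only. To bring another coordinate
    outside, induction brings it to the front of the remaining ones, and Tonelli then exchanges the
    two outermost real variables. *)
Lemma ge0_integral_rV_ins n (i : 'I_n.+1) (f : 'rV[R]_n.+1 -> \bar R) :
  measurable_fun setT f -> (forall x, 0 <= f x) ->
  \int[lebesgue_rV n.+1]_x f x =
  \int[lebesgue_measure]_t \int[lebesgue_rV n]_y f (rV_ins i t y).
Proof.
elim: n i f => [|n IH] i f mf f0.
  rewrite (ge0_integral_rV_cons mf f0) (ord1 i).
  by under [in RHS]eq_integral do under eq_integral do rewrite rV_ins0.
case: (unliftP ord0 i) => [j|] ->; last first.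
  rewrite (ge0_integral_rV_cons mf f0).
  by under [in RHS]eq_integral do under eq_integral do rewrite rV_ins0.
rewrite (ge0_integral_rV_cons mf f0).
under eq_integral.
  move=> s _; rewrite (IH j); last 2 first.
    apply: measurableT_comp => //.
    by apply: measurableT_comp (@measurable_rV_cons _ _) _; exact: pair1_measurable.
    by move=> x.
  over.
rewrite /=.
pose g (p : (measurableTypeR R * measurableTypeR R) * 'rV[R]_n) :=
  f (rV_cons (p.1.1, rV_ins j p.1.2 p.2)).
have mg : measurable_fun setT g.
  apply: measurableT_comp => //; apply: measurableT_comp (@measurable_rV_cons _ _) _.
  apply/measurable_fun_pairP; split => /=.
    exact: measurableT_comp measurable_fst measurable_fst.
  apply: (measurableT_comp (measurable_rV_ins j)
    (_ : measurable_fun setT (fun p : (measurableTypeR R * measurableTypeR R) * 'rV[R]_n => (p.1.2, p.2)))).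
  apply/measurable_fun_pairP; split => /=; last exact: measurable_snd.
  exact: measurableT_comp measurable_snd measurable_fst.
have mG := @measurable_fun_fubini_tonelli_F _ _ _ _ _ (lebesgue_rV n) g mg (fun x => f0 _).
have G0 x : 0 <= fubini_F (lebesgue_rV n) g x by apply: integral_ge0 => y _; exact: f0.
(* The exchange of the first coordinate [s] and the inserted coordinate [t]. *)
have := fubini_tonelli (m1 := lebesgue_measure) (m2 := lebesgue_measure) _ mG G0.
rewrite /fubini_F/g/= => ->.
apply: eq_integral => t _.
apply: eq_trans (esym (ge0_integral_rV_cons (measurableT_comp mf
  (measurable_rV_insr (lift ord0 j) t)) (fun y => f0 _))).
by under [in RHS]eq_integral do under eq_integral do rewrite /= rV_insS.
Qed.

Lemma lebesgue_rVS n (A : set 'rV[R]_n.+1) : lebesgue_rV n.+1 A =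
  (lebesgue_measure \x lebesgue_rV n) (@rV_cons R n @^-1` A).
Proof. by []. Qed.

Lemma measurable_rV_box n (J : set R) : measurable J ->
  measurable [set x : 'rV[R]_n | forall i, J (x ord0 i)].
Proof.
move=> mJ; have -> : [set x : 'rV[R]_n | forall i, J (x ord0 i)] =
    \bigcap_(i in [set: 'I_n]) ((fun x : 'rV[R]_n => x ord0 i) @^-1` J).
  by apply/seteqP; split=> x h i => [_|]; exact: h.
apply: fin_bigcap_measurable; first exact: finite_finset.
by move=> i _; rewrite -[X in measurable X]setTI; exact: measurable_coor.
Qed.

Lemma lebesgue_rV_box n (J : set R) : measurable J ->
  lebesgue_rV n [set x : 'rV[R]_n | forall i, J (x ord0 i)] =
  (lebesgue_measure (J : set (measurableTypeR R)) ^+ n)%E.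
Proof.
move=> mJ; elim: n => [|n IH].
  rewrite /= /dirac indicE mem_set//= => -[]//.
rewrite lebesgue_rVS (_ : _ @^-1` _ =
    J `*` [set x : 'rV[R]_n | forall i, J (x ord0 i)]); last first.
  apply/seteqP; split=> [[t y]/= h|[t y]/= [Jt h] i].
    split=> [|i]; first by have := h ord0; rewrite rV_cons0.
    by have := h (lift ord0 i); rewrite rV_consS.
  by case: (unliftP ord0 i) => [k|] ->; rewrite ?rV_cons0 ?rV_consS.
rewrite product_measure1E//; first by rewrite expeS IH.
exact: measurable_rV_box.
Qed.

Local Opaque lebesgue_rV.

Lemma measurable_rV_set1 n (a : 'rV[R]_n) : measurable [set a].
Proof.
rewrite -(setCK [set a]); apply: measurableC; apply: open_measurable_rV.
exact/closed_openC/accessible_closed_set1/hausdorff_accessible/norm_hausdorff.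
Qed.

Lemma lebesgue_rV_set0 n : lebesgue_rV n.+1 [set (0%R : 'rV[R]_n.+1)] = 0.
Proof.
rewrite (_ : [set _] = [set x : 'rV[R]_n.+1 | forall i, [set 0%R] (x ord0 i)]).
  by rewrite lebesgue_rV_box// lebesgue_measure_set1 expeS mul0e.
apply/seteqP; split=> x /= => [-> i|h]; first by rewrite mxE.
by apply/rowP => i; rewrite h mxE.
Qed.

(** Fubini, where the only exceptional line is the one over [y = 0]. It is negligible because [y]
    ranges over a space of dimension at least one; this is where dimension at least two enters. *)
Lemma integral_rV_ins_eq0 n (i : 'I_n.+2) (f : 'rV[R]_n.+2 -> \bar R) :
  (lebesgue_rV n.+2).-integrable setT f ->
  (forall y : 'rV[R]_n.+1, y != 0%R ->
     \int[lebesgue_measure]_t f (rV_ins i t y) = 0) ->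
  \int[lebesgue_rV n.+2]_x f x = 0.
Proof.
move=> fi f0; have mf := measurable_int _ fi.
pose m := pushforward (lebesgue_measure \x lebesgue_rV n.+1)
  (fun p : measurableTypeR R * 'rV[R]_n.+1 => rV_ins i p.1 p.2).
(* Tonelli applied to indicators identifies the measure with the image of the product measure under
   insertion, so that Fubini becomes available for integrands of any sign. *)
have mE A : measurable A -> lebesgue_rV n.+2 A = m A.
  move=> mA; rewrite /m /pushforward.
  have := @ge0_integral_rV_ins _ i (fun x => (\1_A x)%:E)
    ltac:(by apply/measurable_EFinP; exact: measurable_indic)
    ltac:(by move=> x; rewrite lee_fin).
  rewrite integral_indic; [|exact: measurableT|exact: mA].
  rewrite setIT => ->.
  have mA' : measurable ((fun p : measurableTypeR R * 'rV[R]_n.+1 =>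
      rV_ins i p.1 p.2) @^-1` A).
    by rewrite -[X in measurable X]setTI; exact: measurable_rV_ins.
  rewrite -[X in _ = _ X]setIT -integral_indic; [|exact: measurableT|exact: mA'].
  rewrite fubini_tonelli1.
  - by [].
  - by apply/measurable_EFinP; exact: measurable_indic.
  - by move=> x; rewrite lee_fin.
pose m' : {measure set 'rV[R]_n.+2 -> \bar R} :=
  measure_function_pushforward__canonical__measure_function_Measure
    (lebesgue_measure \x lebesgue_rV n.+1)%E (measurable_rV_ins i).
have mm' g : \int[lebesgue_rV n.+2]_x g x = \int[m']_x g x.
  by apply: eq_measure_integral => A mA _; exact: mE.
have gi : (lebesgue_measure \x lebesgue_rV n.+1).-integrable setT
    (fun p : measurableTypeR R * 'rV[R]_n.+1 => f (rV_ins i p.1 p.2)).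
  apply/integrableP; split; first exact: measurableT_comp mf (measurable_rV_ins i).
  have /integrableP[_] := fi; apply: le_lt_trans.
  rewrite mm' (@ge0_integral_pushforward _ _ _ _ R _ (measurable_rV_ins i)
    (lebesgue_measure \x lebesgue_rV n.+1) setT (abse \o f)).
  - exact: lexx.
  - exact: measurableT.
  - exact: measurableT_comp.
  - by move=> y _; exact: abse_ge0.
rewrite mm' (@integral_pushforward _ _ _ _ R _ (measurable_rV_ins i)
    (lebesgue_measure \x lebesgue_rV n.+1) setT f mf gi measurableT).
rewrite preimage_setT.
rewrite -(integral21_prod_meas1 gi).
rewrite (ae_eq_integral (cst 0) _ measurableT (measurable_fubini_G gi)).
- exact: integral0.
- exact: measurable_cst.
exists [set 0%R]; split; [exact: measurable_rV_set1|exact: lebesgue_rV_set0|].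
move=> y /= h; apply: contrapT => /eqP y0; apply: h => _; exact: f0.
Qed.

(** The image of Lebesgue measure under [x |-> c x], multiplied by [c], agrees with Lebesgue measure
    on half-open intervals, hence everywhere. *)
Lemma ge0_integral_scale1 (c : R) (f : measurableTypeR R -> \bar R) : (0 < c)%R ->
  measurable_fun setT f -> (forall x, 0 <= f x) ->
  \int[lebesgue_measure]_x f (c * x)%R =
  (c^-1)%:E * \int[lebesgue_measure]_x f x.
Proof.
move=> c0 mf f0.
have mc : measurable_fun setT (fun x : measurableTypeR R => (c * x)%R : measurableTypeR R).
  exact: measurable_funM.
pose m : {measure set (measurableTypeR R) -> \bar R} :=
  measure_function_pushforward__canonical__measure_function_Measure
    (@lebesgue_measure R) mc.
have c00 : (0 <= c)%R by exact: ltW.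
have mE A : measurable A -> lebesgue_measure A = mscale (NngNum c00) m A.
  apply: lebesgue_measure_unique => _ [[a b] _ <-].
  transitivity (c%:E * lebesgue_measure `](a / c)%R, (b / c)%R]%classic); last first.
    rewrite /mscale/=; congr (_ * lebesgue_measure _).
    by apply/seteqP; split=> x /=; rewrite !in_itv/= ltr_pdivrMr// ler_pdivlMr// mulrC.
  rewrite !lebesgue_measure_itv/= !lte_fin ltr_pM2r ?invr_gt0//.
  case: ifPn => _; last by rewrite mule0.
  rewrite -EFinM; congr (_%:E); field; exact: lt0r_neq0.
rewrite [X in _ * X](@eq_measure_integral _ _ _ _ (mscale (NngNum c00) m)); last first.
  by move=> A mA _; exact: mE.
rewrite ge0_integral_mscale//= (@ge0_integral_pushforward _ _ _ _ R _ mc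
  (@lebesgue_measure R) setT f)//.
by rewrite muleA -EFinM mulVf ?mul1e ?preimage_setT// lt0r_neq0.
Qed.

Lemma ge0_integral_rV_scale n (c : R) (f : 'rV[R]_n -> \bar R) : (0 < c)%R ->
  measurable_fun setT f -> (forall x, 0 <= f x) ->
  \int[lebesgue_rV n]_x f (c *: x)%R =
  (c ^- n)%:E * \int[lebesgue_rV n]_x f x.
Proof.
move=> c0; have mc m : measurable_fun setT (fun x : 'rV[R]_m => (c *: x)%R).
  apply: measurable_coorP => i.
  under eq_fun do rewrite mxE.
  by apply: measurable_funM => //; exact: measurable_coor.
elim: n f => [|n IH] f mf f0.
  rewrite expr0 invr1 mul1e; apply: eq_integral => x _.
  by congr f; apply/rowP => -[].
rewrite (ge0_integral_rV_cons mf f0).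
rewrite (ge0_integral_rV_cons (measurableT_comp mf (mc _)) (fun x => f0 _)).
have mF : measurable_fun setT (fun t => \int[lebesgue_rV n]_y f (rV_cons (t, y))).
  apply: (@measurable_fun_fubini_tonelli_F _ _ (measurableTypeR R) 'rV[R]_n R
    (lebesgue_rV n) (fun p => f (rV_cons p))) => //.
  exact: measurableT_comp (@measurable_rV_cons _ n).
transitivity (\int[lebesgue_measure]_t ((c ^- n)%:E *
   \int[lebesgue_rV n]_y f (rV_cons ((c * t)%R, y)))).
  apply: eq_integral => t _.
  rewrite -(IH (fun y => f (rV_cons ((c * t)%R, y)))); last 2 first.
  - apply: measurableT_comp mf _; apply: measurableT_comp (@measurable_rV_cons _ n) _.
    exact: pair1_measurable.
  - by move=> x; exact: f0.
  apply: eq_integral => y _ /=; congr f.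
  by apply/rowP => i; rewrite mxE; case: (unliftP ord0 i) => [k|] ->;
    rewrite ?rV_cons0 ?rV_consS// mxE.
rewrite ge0_integralZl; last first.
- by rewrite lee_fin invr_ge0 exprn_ge0// ltW.
- by move=> t _; exact: integral_ge0.
- apply: (measurableT_comp mF); exact: measurable_funM.
- exact: measurableT.
rewrite (@ge0_integral_scale1 c (fun t => \int[lebesgue_rV n]_y f (rV_cons (t, y))))//.
  by rewrite muleA -EFinM exprS invfM mulrC.
by move=> t; exact: integral_ge0.
Qed.

End measure_rV.

(** * The Euclidean norm and the integrability of its negative powers *)

Section enorm.
Context {R : realType}.
Local Opaque lebesgue_rV.

Lemma enorm_ge0 n (x : 'rV[R]_n) : 0 <= enorm x.
Proof. exact: sqrtr_ge0. Qed.

Lemma enorm_sqr n (x : 'rV[R]_n) : enorm x ^+ 2 = \sum_i x ord0 i ^+ 2.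
Proof. by rewrite sqr_sqrtr// sumr_ge0// => i _; exact: sqr_ge0. Qed.

Lemma enorm_eq0 n (x : 'rV[R]_n) : (enorm x == 0) = (x == 0).
Proof.
apply/idP/eqP => [|->]; last first.
  by rewrite -sqrf_eq0 enorm_sqr big1// => i _; rewrite mxE expr0n.
rewrite -sqrf_eq0 enorm_sqr psumr_eq0; last by move=> i _; exact: sqr_ge0.
move=> /allP h; apply/rowP => i; rewrite mxE.
by have := h i (mem_index_enum _); rewrite /= sqrf_eq0 => /eqP.
Qed.

Lemma enorm_gt0 n (x : 'rV[R]_n) : (0 < enorm x) = (x != 0).
Proof. by rewrite lt_neqAle enorm_ge0 andbT eq_sym enorm_eq0. Qed.

Lemma ler_coor_enorm n (x : 'rV[R]_n) i : `|x ord0 i| <= enorm x.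
Proof.
rewrite -(@ler_pXn2r _ 2)// ?nnegrE ?enorm_ge0// enorm_sqr real_normK ?num_real//.
by rewrite (bigD1 i)//= lerDl sumr_ge0// => j _; exact: sqr_ge0.
Qed.

Lemma enormZ n (c : R) (x : 'rV[R]_n) : enorm (c *: x) = `|c| * enorm x.
Proof.
apply/eqP; rewrite -(@eqrXn2 _ 2)// ?enorm_ge0 ?mulr_ge0 ?enorm_ge0//; apply/eqP.
rewrite exprMn !enorm_sqr real_normK ?num_real// mulr_sumr.
by apply: eq_bigr => i _; rewrite mxE exprMn.
Qed.

Lemma continuous_enorm n : continuous (@enorm R n).
Proof.
move=> x; apply: (@continuous_comp _ _ _ (fun x : 'rV[R]_n => \sum_i x ord0 i ^+ 2) Num.sqrt).
  apply: (@cvg_big _ _ _ _ _ add_continuous _ (nbhs x)) => i _.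
  apply: (@continuous_comp _ _ _ (fun x : 'rV[R]_n => x ord0 i) (fun t : R => t ^+ 2)).
    exact: coord_continuous.
  exact: exprn_continuous.
exact: sqrt_continuous.
Qed.

Lemma open_eball n : open (@eball R n).
Proof.
apply: (@open_comp _ _ (@enorm R n) [set t | t < 1]) => [x _|].
  exact: continuous_enorm.
exact: open_lt.
Qed.

Lemma measurable_eball n : measurable (@eball R n).
Proof. by apply: open_measurable_rV; exact: open_eball. Qed.

Lemma open_neq0 n : open [set x : 'rV[R]_n | x != 0].
Proof.
rewrite (_ : [set x | _] = ~` [set 0]).
  exact/closed_openC/accessible_closed_set1/hausdorff_accessible/norm_hausdorff.
by apply/seteqP; split=> x /= /eqP.
Qed.

Lemma continuous_off0_measurable n (f : 'rV[R]_n -> R) :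
  (forall x, x != 0 -> {for x, continuous f}) -> measurable_fun setT f.
Proof.
move=> cf; rewrite (_ : setT = [set~ 0] `|` [set 0]); last by rewrite setUC setUCr.
have m0 : measurable [set (0 : 'rV[R]_n)] by exact: measurable_rV_set1.
apply/(measurable_funU _ (measurableC m0) m0); split; last first.
  apply: (eq_measurable_fun (cst (f 0))); last exact: measurable_cst.
  by move=> x; rewrite inE/= => ->.
apply: (measurability _ (RGenOpens.measurableE R)).
move=> _ [_ [a [b ->] <-]]; apply: open_measurable_rV.
rewrite (_ : ~` [set 0] = [set x : 'rV[R]_n | x != 0]); last first.
  by apply/seteqP; split=> x /= /eqP.
rewrite openE => x [/= x0 fx].
apply: filterI; first by apply: open_nbhs_nbhs; split; [exact: open_neq0|].
by apply: (cf x x0); apply: open_nbhs_nbhs; split=> //; exact: interval_open.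
Qed.

(** A dyadic majorant replaces polar coordinates. On the cube [B j] of half-side 2^-j the term [f j]
    is 2^((j+1)d), so its integral is 2^(d+n) 2^(-j(n-d)), at most 2^(d+n) 2^-j because d < n, and
    the series converges. *)
Lemma integral_enormN_lty n d : (d < n)%N ->
  (\int[lebesgue_rV n]_(x in @eball R n) ((enorm x)^-1 ^+ d)%:E < +oo)%E.
Proof.
move=> dn.
pose J j : set R := ball (0 : R) (2 ^- j).
pose B j := [set x : 'rV[R]_n | forall i, J j (x ord0 i)].
have mJ j : measurable (J j) by rewrite /J ball_itv; exact: measurable_itv.
have mB j : measurable (B j) by exact: measurable_rV_box.
pose f j (x : 'rV[R]_n) : \bar R := ((2 ^+ j.+1) ^+ d * \1_(B j) x)%:E.
have f0 j x : (0 <= f j x)%E by rewrite lee_fin mulr_ge0// !exprn_ge0.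
have mf j : measurable_fun setT (f j).
  by apply/measurable_EFinP; apply: measurable_funM => //; exact: measurable_indic.
have key x : @eball R n x -> (((enorm x)^-1 ^+ d)%:E <= \sum_(j <oo) f j x)%E.
  move=> x1; suff [j xj] : exists j, (((enorm x)^-1 ^+ d)%:E <= f j x)%E.
    apply: (le_trans xj); apply: (@le_trans _ _ (\sum_(0 <= i < j.+1) f i x)%E).
      rewrite big_nat_recr//= leeDr// sume_ge0// => i _; exact: f0.
    by apply: nneseries_lim_ge => i _ _; exact: f0.
  have [->|x0] := eqVneq x 0.
    (* At the origin [0^-1 = 0], so the left side is at most 1 and the first cube already dominates
       it. *)
    exists 0%N; rewrite /f lee_fin (_ : enorm (0 : 'rV[R]_n) = 0); last first.
      by apply/eqP; rewrite enorm_eq0.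
    rewrite invr0 indicE mem_set; last first.
      by move=> i; rewrite /J /= mxE; apply: ballxx; rewrite expr0 invr1.
    by rewrite mulr1 lerXn2r// ?nnegrE ?exprn_ge0.
  have ex0 : 0 < enorm x by rewrite enorm_gt0.
  have : exists j, 2 ^- j.+1 <= enorm x.
    exists (Num.bound (enorm x)^-1).
    rewrite invf_ple ?posrE// ?exprn_gt0//; apply/ltW/upper_nthrootP; exact: leqnSn.
  (* For the least j with 2^-(j+1) <= |x|, minimality gives |x| < 2^-j, so [x] lies in the j-th
     cube; for j = 0 this is |x| < 1. *)
  move=> ex; pose j := ex_minn ex; exists j; rewrite /j; case: ex_minnP => {}j jx jmin.
  rewrite /f lee_fin indicE mem_set ?mulr1.
    rewrite lerXn2r// ?nnegrE ?invr_ge0 ?enorm_ge0 ?exprn_ge0//.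
    by rewrite invf_ple ?posrE// exprn_gt0.
  move=> i; rewrite /J/= /ball/= sub0r normrN (le_lt_trans (ler_coor_enorm _ _))//.
  case: j jx jmin => [|j] jx jmin; first by rewrite expr0 invr1.
  by rewrite ltNge; apply/negP => /jmin; rewrite ltnn.
have mg : measurable_fun setT (fun x : 'rV[R]_n => ((enorm x)^-1 ^+ d)).
  apply: measurable_funX; apply: continuous_off0_measurable => x x0.
  apply: continuousV; first by rewrite enorm_eq0.
  exact: continuous_enorm.
apply: (@le_lt_trans _ _ (\int[lebesgue_rV n]_x (\sum_(j <oo) f j x))%E).
  apply: (@le_trans _ _ (\int[lebesgue_rV n]_(x in @eball R n) (\sum_(j <oo) f j x))%E).
    apply: ge0_le_integral => //.
    - exact: measurable_eball.
    - by move=> x _; rewrite lee_fin exprn_ge0// invr_ge0 enorm_ge0.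
    - by apply/measurable_EFinP; exact: measurable_funTS.
    - by apply: measurable_funTS; apply: ge0_emeasurable_sum.
  apply: ge0_subset_integral => //; first exact: measurable_eball.
  - by apply: ge0_emeasurable_sum.
  - by move=> x _; apply: nneseries_ge0 => j _ _; exact: f0.
rewrite integral_nneseries//.
pose c : R := 2 ^+ (d + n).
have fint j : (\int[lebesgue_rV n]_x f j x <= (2 * c / (2 ^ (j + 1))%:R)%:E)%E.
  rewrite /f; under eq_integral do rewrite EFinM.
  rewrite ge0_integralZl//; last by apply/measurable_EFinP; exact: measurable_indic.
  have -> : (\int[lebesgue_rV n]_x (\1_(B j) x)%:E)%E = ((2 ^- j *+ 2)%:E ^+ n)%E.
    rewrite integral_indic// setIT; apply: (eq_trans (lebesgue_rV_box _ (mJ j))).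
    by rewrite /J lebesgue_measure_ball// invr_ge0 exprn_ge0.
  rewrite -EFin_expe -EFinM lee_fin /c addn1 natrX.
  rewrite -[2 ^- j *+ 2]mulr_natl exprMn exprVn -!exprM mulrA.
  rewrite ler_pdivrMr ?exprn_gt0// mulrAC ler_pdivlMr ?exprn_gt0//.
  rewrite -exprS -!exprD ler_weXn2l// ?ler1n//.
  move: dn => /(leq_mul (leqnn j)); nia.
apply: (@le_lt_trans _ _ (2 * c / 2 ^+ 0)%:E); last exact: ltry.
have /cvg_lim <- // := @cvg_geometric_eseries_half R (2 * c) 0.
rewrite /eseries/=.
by apply: lee_nneseries => [j _ _|j _]; [exact: integral_ge0|exact: fint].
Qed.
End enorm.

(** * Functions smooth off the origin with homogeneous bounds *)

(** Only derivability of [f] in the direction [v] is known, so the chain rule is applied to the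
    restriction of [f] to the line through [x]. *)
Lemma is_derive_line (R : realType) (V : normedModType R) (h : R -> R) (f : V -> R) x v dh :
  derivable f x v -> is_derive (f x) 1 h dh ->
  is_derive x v (fun y => h (f y)) (dh * 'D_v f x).
Proof.
move=> df hh.
have d1 : derivable (fun r : R => f (r *: v + x)) 0 1 by exact: (derivable1P f x v).1.
have E : 'D_v f x = 'D_1 (fun r : R => f (r *: v + x)) 0.
  rewrite /derive; set g1 := fun r => r^-1 *: _; set g2 := fun r => r^-1 *: _.
  suff -> : g1 = g2 by [].
  by apply/funext => r; rewrite /g1 /g2 /= addr0 scale0r add0r [_%:A]mulr1.
have E' : 'D_v (fun y => h (f y)) x = 'D_1 (fun r : R => h (f (r *: v + x))) 0.
  rewrite /derive; set g1 := fun r => r^-1 *: _; set g2 := fun r => r^-1 *: _.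
  suff -> : g1 = g2 by [].
  by apply/funext => r; rewrite /g1 /g2 /= addr0 scale0r add0r [_%:A]mulr1.
have hh' : is_derive (f (0 *: v + x)) 1 h dh by rewrite scale0r add0r.
have d1' : derivable h (f (0 *: v + x)) 1 by case: hh'.
have d2 : derivable (h \o (fun r : R => f (r *: v + x))) 0 1.
  by apply/derivable1_diffP; apply: differentiable_comp; exact/derivable1_diffP.
apply: DeriveDef; first exact: (derivable1P _ x v).2.
have := derive1_comp d1 d1'; rewrite !derive1E => dc.
by rewrite E' E; apply: (eq_trans dc); congr (_ * _); case: hh' => _ <-.
Qed.

Section reg.
Context {R : realType} {n : nat} {T : Type}.
Implicit Types (f g : T -> 'rV[R]_n -> R) (N : nat) (d e : int).
Variables (U : set 'rV[R]_n) (bd : int -> (T -> 'rV[R]_n -> R) -> Prop).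
Hypothesis oU : open U.
Hypothesis bd_ext : forall d f g,
  (forall t x, U x -> f t x = g t x) -> bd d f -> bd d g.
Hypothesis bdD : forall d f g, bd d f -> bd d g -> bd d (fun t x => f t x + g t x).
Hypothesis bdM : forall d e f g,
  bd d f -> bd e g -> bd (d + e) (fun t x => f t x * g t x).
Hypothesis bd0 : forall d, bd d (fun _ _ => 0).
Hypothesis bdC : forall c : R, bd 0 (fun _ _ => c).

Local Notation ei i := (delta_mx ord0 i : 'rV[R]_n).

(** The calculus is developed for an abstract open set and an abstract graded bound, and is
    instantiated twice: by [sym] (punctured space, powers of the norm) and by [regs] (whole space,
    no bound). Continuity is demanded at every order since derivability along the axes does not
    imply it. The parameter in [T] allows bounds uniform over a family. *)
Fixpoint reg N d f : Prop :=
  [/\ forall t x, U x -> {for x, continuous (f t)}, bd d f &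
      if N is N'.+1 then forall i, (forall t x, U x -> derivable (f t) x (ei i)) /\
        reg N' (d + 1) (fun t => 'D_(ei i) (f t)) else True].

Lemma reg_continuous N d f t x : reg N d f -> U x -> {for x, continuous (f t)}.
Proof. by case: N => [|N] [+ _ _]; apply. Qed.

Lemma reg_bd N d f : reg N d f -> bd d f.
Proof. by case: N => [|N] []. Qed.

Lemma reg_derivable N d f i t x : reg N.+1 d f -> U x -> derivable (f t) x (ei i).
Proof. by move=> [_ _ /(_ i)[h _]]; exact: h. Qed.

Lemma reg_derive N d f i : reg N.+1 d f -> reg N (d + 1) (fun t => 'D_(ei i) (f t)).
Proof. by move=> [_ _ /(_ i)[_]]. Qed.

Lemma near_in (x : 'rV[R]_n) : U x -> \forall y \near x, U y.
Proof. by move=> Ux; apply: open_nbhs_nbhs. Qed.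

Lemma near_eq_in (V : Type) (f g : 'rV[R]_n -> V) x : (forall y, U y -> f y = g y) ->
  U x -> \forall y \near x, f y = g y.
Proof. by move=> fg Ux; apply: filterS (near_in Ux) => y; exact: fg. Qed.

Let continuous_ext f g : (forall t x, U x -> f t x = g t x) ->
  (forall t x, U x -> {for x, continuous (f t)}) ->
  forall t x, U x -> {for x, continuous (g t)}.
Proof.
move=> fg cf t x Ux; rewrite /prop_for /continuous_at -(fg _ _ Ux).
have := cf t x Ux; apply: cvg_trans; apply: (@near_eq_cvg _ _ (nbhs x)).
exact: (near_eq_in (fg t)).
Qed.

Lemma reg_ext N d f g : (forall t x, U x -> f t x = g t x) ->
  reg N d f -> reg N d g.
Proof.
elim: N d f g => [|N IH] d f g fg [cf bf df].
  by split=> //; [exact: continuous_ext fg cf|exact: bd_ext bf].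
split; [exact: continuous_ext fg cf|exact: bd_ext bf|].
move=> i; have [dfi rfi] := df i; split.
  move=> t x Ux; by apply: near_eq_derivable (dfi t x Ux); exact: (near_eq_in (fg t)).
apply: IH rfi => t x Ux; apply: near_eq_derive.
exact: (near_eq_in (fg t)).
Qed.

Lemma regW N d f : reg N.+1 d f -> reg N d f.
Proof.
elim: N d f => [|N IH] d f; first by case.
move=> [cf bf df]; split=> // i; have [dfi rfi] := df i; split=> //.
exact: IH.
Qed.

Lemma reg_leq N M d f : (M <= N)%N -> reg N d f -> reg M d f.
Proof.
move=> /subnK <-; elim: (N - M)%N => [//|k IH]; rewrite addSn.
by move/regW.
Qed.

Lemma reg0 N d : reg N d (fun _ _ => 0).
Proof.
elim: N d => [|N IH] d; (split; [by move=> t x _; exact: cst_continuous|exact: bd0|]) => //.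
move=> i; split; first by move=> t x _; exact: derivable_cst.
by apply: reg_ext (IH _) => t x _; rewrite derive_cst.
Qed.

Lemma reg_tcst N (c : T -> R) : bd 0 (fun t _ => c t) -> reg N 0 (fun t _ => c t).
Proof.
case: N => [|N] bc; (split; [by move=> t x _; exact: cst_continuous|exact: bc|]) => //.
move=> i; split; first by move=> t x _; exact: derivable_cst.
by apply: reg_ext (reg0 _ _) => t x _; rewrite derive_cst.
Qed.

Lemma reg_cst N (c : R) : reg N 0 (fun _ _ => c).
Proof. exact: reg_tcst. Qed.

Lemma regD N d f g : reg N d f -> reg N d g -> reg N d (fun t x => f t x + g t x).
Proof.
elim: N d f g => [|N IH] d f g [cf bf df] [cg bg dg];
  (split; [|exact: bdD|]) => //.
- by move=> t x Ux; apply: continuousD; [exact: cf|exact: cg].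
- by move=> t x Ux; apply: continuousD; [exact: cf|exact: cg].
move=> i; have [dfi rfi] := df i; have [dgi rgi] := dg i; split.
  by move=> t x Ux; apply: derivableD; [exact: dfi|exact: dgi].
apply: reg_ext (IH _ _ _ rfi rgi) => t x Ux.
by rewrite -deriveD; [|exact: dfi|exact: dgi].
Qed.

Lemma regM N d e f g : reg N d f -> reg N e g ->
  reg N (d + e) (fun t x => f t x * g t x).
Proof.
elim: N d e f g => [|N IH] d e f g [cf bf df] [cg bg dg];
  (split; [|exact: bdM|]) => //.
- by move=> t x Ux; apply: continuousM; [exact: cf|exact: cg].
- by move=> t x Ux; apply: continuousM; [exact: cf|exact: cg].
move=> i; have [dfi rfi] := df i; have [dgi rgi] := dg i; split.
  by move=> t x Ux; apply: derivableM; [exact: dfi|exact: dgi].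
have h1 : reg N (d + (e + 1)) (fun t x => f t x * 'D_(ei i) (g t) x).
  by apply: IH => //; exact: regW.
have h2 : reg N (e + (d + 1)) (fun t x => g t x * 'D_(ei i) (f t) x).
  by apply: IH => //; exact: regW.
rewrite addrCA addrA in h2; rewrite addrA in h1.
apply: reg_ext (regD h1 h2) => t x Ux.
by rewrite deriveM; [|exact: dfi|exact: dgi].
Qed.

Lemma regZ N d (c : R) f : reg N d f -> reg N d (fun t x => c * f t x).
Proof. by move=> rf; rewrite -[d]add0r; apply: regM => //; exact: reg_cst. Qed.

Lemma reg_sum N d (I : Type) (s : seq I) (F : I -> T -> 'rV[R]_n -> R) :
  (forall i, reg N d (F i)) -> reg N d (fun t x => \sum_(i <- s) F i t x).
Proof.
move=> rF; elim: s => [|i s IH].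
  by apply: reg_ext (reg0 _ _) => t x _; rewrite big_nil.
by apply: reg_ext (regD (rF i) IH) => t x _; rewrite big_cons.
Qed.

Lemma reg_comp (J : Type) (h : J -> R -> R) (s : J -> J) (k : J -> R) (D : set R) f N j :
  (forall j y, D y -> is_derive y 1 (h j) (k j * h (s j) y)) ->
  (forall j, bd 0 (fun t x => h j (f t x))) ->
  (forall t x, U x -> D (f t x)) ->
  reg N 0 f -> reg N 0 (fun t x => h j (f t x)).
Proof.
move=> dh bh fD; elim: N j f bh fD => [|N IH] j f bh fD [cf bf df].
  (split; [|exact: bh|]) => // t x Ux; apply: continuous_comp; first exact: cf.
  by apply/differentiable_continuous/derivable1_diffP; case: (dh j _ (fD t x Ux)).
split; [move=> t x Ux|exact: bh|move=> i].
  apply: continuous_comp; first exact: cf.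
  by apply/differentiable_continuous/derivable1_diffP; case: (dh j _ (fD t x Ux)).
have [dfi rfi] := df i; split=> [t x Ux|].
  by case: (is_derive_line (dfi t x Ux) (dh j _ (fD t x Ux))).
have rf : reg N 0 f by apply: regW; split.
apply: reg_ext (regZ (k j) (regM (IH (s j) f bh fD rf) rfi)) => t x Ux.
by case: (is_derive_line (dfi t x Ux) (dh j _ (fD t x Ux))) => _ ->; rewrite mulrA.
Qed.

End reg.

(** * Directional derivatives of the norm, and test functions *)

Section derivative_facts.
Context {R : realType} {n : nat}.
Local Notation ei i := (delta_mx ord0 i : 'rV[R]_n).

Lemma is_derive_coor (x v : 'rV[R]_n) j :
  is_derive x v (fun y : 'rV[R]_n => y ord0 j) (v ord0 j).
Proof.
have E h : h != 0 -> h^-1 *: (((h *: v + x) ord0 j) - x ord0 j) = v ord0 j.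
  by move=> h0; rewrite !mxE addrK /GRing.scale/= mulrA mulVf// mul1r.
have L : h^-1 *: (((h *: v + x) ord0 j) - x ord0 j) @[h --> (0:R)^'] --> v ord0 j.
  apply: (@cvg_trans _ ((fun _ : R => v ord0 j) @ (0:R)^')); last exact: cvg_cst.
  apply: near_eq_cvg; near=> h; rewrite E//.
  by near: h; exact: nbhs_dnbhs_neq.
apply: DeriveDef; first by apply/cvg_ex; exists (v ord0 j).
exact: cvg_lim L.
Unshelve. all: by end_near. Qed.

Lemma is_derive_enorm_sqr (x v : 'rV[R]_n) :
  is_derive x v (fun y : 'rV[R]_n => \sum_j y ord0 j ^+ 2) (2 * \sum_j x ord0 j * v ord0 j).
Proof.
rewrite (_ : (fun y => _) = \sum_j (fun y : 'rV[R]_n => y ord0 j) ^+ 2); last first.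
  by apply/funext => y; rewrite fct_sumE.
apply: is_derive_eq.
  apply: is_derive_sum => j; apply: is_deriveX; exact: is_derive_coor.
rewrite /= mulr_sumr; apply: eq_bigr => j _.
by rewrite expr1 /GRing.scale/= mulrA.
Qed.

Lemma is_derive_enormV (x : 'rV[R]_n) i : x != 0 ->
  is_derive x (ei i) (fun y => (enorm y)^-1) (- (x ord0 i * (enorm x)^-1 ^+ 3)).
Proof.
move=> x0; have ex0 : 0 < enorm x by rewrite enorm_gt0.
have [d1 d1E] := is_derive_enorm_sqr x (ei i).
have s0 : 0 < \sum_j x ord0 j ^+ 2 by rewrite -enorm_sqr exprn_gt0.
have [d2 d2E] := is_derive_line d1 (is_derive1_sqrt s0).
have e0 : enorm x != 0 by rewrite gt_eqF.
apply: DeriveDef; first exact: derivableV.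
rewrite deriveV// d2E d1E -/(enorm x).
rewrite (bigD1 i)//= big1 ?addr0; last first.
  by move=> j /negPf ji; rewrite mxE eqxx/= ji mulr0.
by rewrite mxE !eqxx mulr1 /GRing.scale/=; field.
Qed.

Lemma pderivs_rcons s i (f : 'rV[R]_n -> R) :
  pderivs (rcons s i) f = pderivs s ('D_(ei i) f).
Proof. by rewrite /pderivs foldr_rcons. Qed.

Lemma smooth_derive i (f : 'rV[R]_n -> R) : smooth f -> smooth ('D_(ei i) f).
Proof. by move=> sf s; rewrite -pderivs_rcons; exact: sf. Qed.

Lemma derive_supp (f : 'rV[R]_n -> R) v :
  closure [set x | 'D_v f x != 0] `<=` closure [set x | f x != 0].
Proof.
have /closure_id cE : closed (closure [set x | f x != 0]) by exact: closed_closure.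
rewrite [X in _ `<=` X]cE.
apply: closureS => x /= Df; apply: contrapT => xf; move/eqP: Df; apply.
have : \forall y \near x, f y = cst 0 y.
  have : \forall y \near x, (~` closure [set x | f x != 0]) y.
    by apply: open_nbhs_nbhs; split=> //; exact/closed_openC/closed_closure.
  apply: filterS => y h; apply/eqP/negPn/negP => fy; apply: h.
  exact: subset_closure.
by move=> /near_eq_derive ->; rewrite derive_cst.
Qed.

Lemma test_fun_derive i (f : 'rV[R]_n -> R) : test_fun f -> test_fun ('D_(ei i) f).
Proof.
move=> [sf cf bf]; split; first exact: smooth_derive.
- by apply: subclosed_compact cf _; [exact: closed_closure|exact: derive_supp].
- exact: subset_trans (@derive_supp _ _) bf.
Qed.

Lemma test_fun_pderivs s (f : 'rV[R]_n -> R) : test_fun f -> test_fun (pderivs s f).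
Proof. by move=> tf; elim: s => [//|i s IH]; exact: test_fun_derive. Qed.

Lemma test_fun_out (f : 'rV[R]_n -> R) x : test_fun f -> ~ eball x -> f x = 0.
Proof.
move=> [_ _ bf] x1; apply/eqP/negPn/negP => fx; apply: x1; apply: bf.
exact: subset_closure.
Qed.

Lemma test_fun_continuous (f : 'rV[R]_n -> R) : test_fun f -> continuous f.
Proof. by move=> [/(_ [::])[]]. Qed.

Lemma test_fun_bounded (f : 'rV[R]_n -> R) : test_fun f ->
  exists2 M, 0 <= M & forall x, `|f x| <= M.
Proof.
move=> tf; have [_ cK _] := tf; have cf := test_fun_continuous tf.
have [K0|/set0P K0] := eqVneq (closure [set x | f x != 0]) set0.
  exists 0 => // x; rewrite normr_le0; apply/negPn/negP => fx.
  by suff : closure [set x | f x != 0] x; [rewrite K0|exact: subset_closure].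
have [|c _ cM] := @EVT_max_rV R n (fun x => `|f x|) _ K0 cK.
  apply: continuous_subspaceT => x.
  exact: (continuous_comp (cf x) (@norm_continuous _ _ _)).
exists `|f c| => // x; have [xK|xK] := boolP (x \in closure [set x | f x != 0]).
  exact: cM.
rewrite (_ : f x = 0) ?normr0//; apply/eqP/negPn/negP => fx.
by move/negP: xK; apply; rewrite inE; exact: subset_closure.
Qed.

End derivative_facts.

Section sym.
Context {R : realType} {n : nat} {T : Type}.
Implicit Types (f g : T -> 'rV[R]_n -> R) (N : nat) (d e : int).
Local Notation ei i := (delta_mx ord0 i : 'rV[R]_n).
Local Notation U := [set x : 'rV[R]_n | x != 0].

(** The bound holds at all nonzero points: near the origin it measures the singularity, and at
    infinity it gives the decay exploited in [line_constant]. *)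
Definition enorm_bd d f := exists2 C, 0 <= C &
  forall t x, x != 0 -> `|f t x| <= C * enorm x ^ (- d).

Lemma enorm_bd_ext d f g :
  (forall t x, U x -> f t x = g t x) -> enorm_bd d f -> enorm_bd d g.
Proof. by move=> fg [C C0 fC]; exists C => // t x x0; rewrite -fg//; exact: fC. Qed.

Lemma enorm_bdD d f g : enorm_bd d f -> enorm_bd d g ->
  enorm_bd d (fun t x => f t x + g t x).
Proof.
move=> [C C0 fC] [D D0 gD]; exists (C + D); first exact: addr_ge0.
move=> t x x0; rewrite (le_trans (ler_normD _ _))// mulrDl lerD//; [exact: fC|exact: gD].
Qed.

Lemma enorm_bdM d e f g : enorm_bd d f -> enorm_bd e g ->
  enorm_bd (d + e) (fun t x => f t x * g t x).
Proof.
move=> [C C0 fC] [D D0 gD]; exists (C * D); first exact: mulr_ge0.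
move=> t x x0; rewrite normrM opprD expfzDr ?enorm_eq0// mulrACA.
by apply: ler_pM => //; [exact: fC|exact: gD].
Qed.

Lemma enorm_bd0 d : enorm_bd d (fun _ _ => 0).
Proof. by exists 0 => // t x x0; rewrite normr0 mul0r. Qed.

Lemma enorm_bd_cst (c : R) : enorm_bd 0 (fun _ _ => c).
Proof. by exists `|c| => // t x _; rewrite oppr0 expr0z mulr1. Qed.

(* The family [f t] is [N] times differentiable off the origin and, uniformly in
   [t], its derivatives of order j are O(|x|^(-d-j)) at all x != 0. *)
Definition sym N d f : Prop := reg U enorm_bd N d f.

Let oU : open U := @open_neq0 R n.

Lemma sym_ext N d f g : (forall t x, x != 0 -> f t x = g t x) ->
  sym N d f -> sym N d g.
Proof. by move=> fg; apply: reg_ext oU enorm_bd_ext _ _ _ _ fg. Qed.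

Lemma symW N M d f : (M <= N)%N -> sym N d f -> sym M d f.
Proof. exact: reg_leq. Qed.

Lemma sym_derive N d f i : sym N.+1 d f -> sym N (d + 1) (fun t => 'D_(ei i) (f t)).
Proof. exact: reg_derive. Qed.

Lemma sym_derivable N d f i t x : sym N.+1 d f -> x != 0 -> derivable (f t) x (ei i).
Proof. exact: reg_derivable. Qed.

Lemma sym_continuous N d f t x : sym N d f -> x != 0 -> {for x, continuous (f t)}.
Proof. exact: reg_continuous. Qed.

Lemma sym0 N d : sym N d (fun _ _ => 0).
Proof. exact: reg0 oU enorm_bd_ext enorm_bd0 _ _. Qed.

Lemma sym_cst N c : sym N 0 (fun _ _ => c).
Proof. exact: reg_cst oU enorm_bd_ext enorm_bd0 enorm_bd_cst _ _. Qed.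

Lemma sym_tcst N (c : T -> R) M : (forall t, `|c t| <= M) ->
  sym N 0 (fun t _ => c t).
Proof.
move=> cM; apply: (reg_tcst oU enorm_bd_ext enorm_bd0).
exists `|M| => // t x x0; rewrite oppr0 expr0z mulr1.
exact: le_trans (cM t) (ler_norm _).
Qed.

Lemma symD N d f g : sym N d f -> sym N d g -> sym N d (fun t x => f t x + g t x).
Proof. exact: regD oU enorm_bd_ext enorm_bdD _ _ _ _. Qed.

Lemma symM N d e f g : sym N d f -> sym N e g ->
  sym N (d + e) (fun t x => f t x * g t x).
Proof. exact: regM oU enorm_bd_ext enorm_bdD enorm_bdM _ _ _ _ _. Qed.

Lemma symZ N d (c : R) f : sym N d f -> sym N d (fun t x => c * f t x).
Proof. by move=> rf; rewrite -[d]add0r; apply: symM => //; exact: sym_cst. Qed.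

Lemma symN N d f : sym N d f -> sym N d (fun t x => - f t x).
Proof. by move/(symZ (-1)); apply: sym_ext => t x _; rewrite mulN1r. Qed.

Lemma symB N d f g : sym N d f -> sym N d g -> sym N d (fun t x => f t x - g t x).
Proof. by move=> rf rg; apply: symD => //; exact: symN. Qed.

Lemma sym_sum N d (I : Type) (s : seq I) (F : I -> T -> 'rV[R]_n -> R) :
  (forall i, sym N d (F i)) -> sym N d (fun t x => \sum_(i <- s) F i t x).
Proof. exact: reg_sum oU enorm_bd_ext enorm_bdD enorm_bd0 _ _ _ _ _. Qed.

Lemma sym_coor N j : sym N (-1) (fun _ x => x ord0 j).
Proof.
have b : enorm_bd (- 1) (fun (_ : T) (x : 'rV[R]_n) => x ord0 j).
  by exists 1 => // t x _; rewrite opprK expr1z mul1r ler_coor_enorm.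
case: N => [|N]; (split; [by move=> t x _; exact: coord_continuous|exact: b|]) => //.
move=> i; split; first by move=> t x _; case: (is_derive_coor x (ei i) j).
rewrite addNr; apply: sym_ext (sym_cst _ (ei i ord0 j)) => t x _.
by case: (is_derive_coor x (ei i) j).
Qed.

(** The derivative [- x_i |x|^-3] is a coordinate, of order -1, times three copies of the function
    itself, so the induction on [N] closes with order -1 + 3 = 2. *)
Lemma sym_enormV N : sym N 1 (fun _ x => (enorm x)^-1).
Proof.
have b : enorm_bd 1 (fun (_ : T) (x : 'rV[R]_n) => (enorm x)^-1).
  exists 1 => // t x _; rewrite mul1r exprN1 ger0_norm// invr_ge0.
  exact: enorm_ge0.
have c (t : T) (x : 'rV[R]_n) : x != 0 -> {for x, continuous (fun x => (enorm x)^-1)}.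
  by move=> x0; apply: continuousV; [rewrite enorm_eq0|exact: continuous_enorm].
elim: N => [|N IH]; split=> // i; split.
  by move=> t x x0; case: (is_derive_enormV i x0).
have := symN (symM (sym_coor N i) (symM IH (symM IH IH))).
apply: sym_ext => t x x0; case: (is_derive_enormV i x0) => _ ->.
by rewrite !exprS expr0 mulr1.
Qed.

(** The two-sided bound keeps every power of [f] bounded, whatever the sign of the exponent, and
    differentiation only shifts the exponent. The exponents 1/2, -1/2 and -1 serve to normalize the
    variations. *)
Lemma sym_powR N (a c C : R) f : 0 < c ->
  (forall t x, x != 0 -> c <= f t x <= C) ->
  sym N 0 f -> sym N 0 (fun t x => f t x `^ a).
Proof.
move=> c0 cfC.
apply: (@reg_comp _ _ _ _ _ oU enorm_bd_ext enorm_bdD enorm_bdM enorm_bd0 enorm_bd_cst R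
  (fun a y => y `^ a) (fun a => a - 1) id [set y | 0 < y]).
- move=> b; exists (c `^ b + C `^ b); first by rewrite addr_ge0// powR_ge0.
  move=> t x x0; have /andP[cf fC] := cfC t x x0.
  have f0 := lt_le_trans c0 cf.
  rewrite oppr0 expr0z mulr1 ger0_norm ?powR_ge0//.
  have [b0|b0] := leP 0 b.
    apply: ler_wpDl; first exact: powR_ge0.
    by apply: ge0_ler_powR; rewrite ?nnegrE// ltW// (lt_le_trans f0).
  apply: ler_wpDr; first exact: powR_ge0.
  rewrite -[b]opprK powRN [leRHS]powRN lef_pV2 ?posrE ?powR_gt0//.
  by apply: ge0_ler_powR; rewrite ?nnegrE ?oppr_ge0// ltW.
- by move=> t x x0 /=; have /andP[cf _] := cfC t x x0; exact: lt_le_trans cf.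
Qed.

End sym.

Arguments sym_continuous {R n T N d f} t {x} _ _.
Arguments sym_derivable {R n T N d f} i t {x} _ _.
Arguments sym_derive {R n T} N {d f} i _.

Lemma sym_at (R : realType) n (T T' : Type) (h : T' -> T) N d (f : T -> 'rV[R]_n -> R) :
  sym N d f -> sym N d (fun t => f (h t)).
Proof.
elim: N d f => [|N IH] d f [cf [C C0 bf] df].
  by split=> // [t x x0|]; [exact: cf|exists C => // t x; exact: bf].
split=> [t x x0||i]; [exact: cf|by exists C => // t x; exact: bf|].
by have [dfi rfi] := df i; split=> [t x x0|]; [exact: dfi|exact: IH rfi].
Qed.

(** A test function is bounded and vanishes outside the unit ball, where inside |x|^-d >= 1 if d >=
    0. A negative order forces decay at the origin, which vanishing near it provides. *)
Lemma test_fun_enorm_bd (R : realType) n (T : Type) (d : int) (f : 'rV[R]_n -> R) :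
  0 <= d \/ (exists2 r, 0 < r & forall x, enorm x < r -> f x = 0) ->
  test_fun f -> enorm_bd d (fun _ : T => f).
Proof.
move=> fd tf; have [M M0 fM] := test_fun_bounded tf.
case: d fd => d fd.
  exists M => // t x x0; have [x1|x1] := ltP (enorm x) 1; last first.
    rewrite (test_fun_out tf); last by apply/negP; rewrite -leNgt.
    by rewrite normr0 mulr_ge0// exprz_ge0// enorm_ge0.
  rewrite (le_trans (fM x))// ler_peMr// -exprz_inv -exprnP exprn_ege1//.
  by rewrite invf_ge1 ?enorm_gt0// ltW.
case: fd => [//|[r r0 fr]].
have rd : 0 < r ^+ d.+1 by rewrite exprn_gt0.
exists (M / r ^+ d.+1) => [|t x x0]; first by rewrite divr_ge0// ltW.
have ex : 0 <= enorm x ^ (- Negz d) by rewrite exprz_ge0// enorm_ge0.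
have [xr|xr] := ltP (enorm x) r.
  by rewrite fr// normr0 mulr_ge0// divr_ge0// ltW.
rewrite (le_trans (fM x))// mulrAC -mulrA ler_peMr//.
rewrite NegzE opprK -exprnP ler_pdivlMr// mul1r lerXn2r// nnegrE ?enorm_ge0//.
exact: ltW.
Qed.

Lemma test_fun_sym (R : realType) n (T : Type) N (d : int) (f : 'rV[R]_n -> R) :
  0 <= d \/ (exists2 r, 0 < r & forall x, enorm x < r -> f x = 0) ->
  test_fun f -> sym N d (fun _ : T => f).
Proof.
elim: N d f => [|N IH] d f fd tf; have b := test_fun_enorm_bd T fd tf.
  by split=> // t x _; exact: test_fun_continuous.
split=> // [t x _|i]; first exact: test_fun_continuous.
have [sf _ _] := tf; split=> [t x _|]; first by have [_ h] := sf [::]; exact: h.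
apply: IH; last exact: test_fun_derive.
case: fd => [d0|[r r0 fr]]; [by left; rewrite addr_ge0|right; exists r => // x xr].
suff /near_eq_derive -> : \forall y \near x, f y = cst 0 y by rewrite derive_cst.
suff : \forall y \near x, enorm y < r by apply: filterS => y; exact: fr.
apply: open_nbhs_nbhs; split=> //.
apply: (@open_comp _ _ (@enorm R n) [set t | t < r]) => [y _|]; last exact: open_lt.
exact: continuous_enorm.
Qed.

Lemma lebesgue_rV_0 (R : realType) n : (0 < n)%N ->
  lebesgue_rV n [set (0 : 'rV[R]_n)] = 0%E.
Proof. by case: n => // n _; exact: lebesgue_rV_set0. Qed.

(** * Weak derivatives of functions singular at the origin *)

Section sym_integral.
Context {R : realType} {n : nat}.
Local Notation ei i := (delta_mx ord0 i : 'rV[R]_n).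
Local Notation mu := (lebesgue_rV n : {measure set 'rV[R]_n -> \bar R}).
Local Notation B := (@eball R n).

Lemma sym_measurable T N d (f : T -> 'rV[R]_n -> R) t :
  sym N d f -> measurable_fun setT (f t).
Proof.
by move=> sf; apply: continuous_off0_measurable => x x0; exact: (sym_continuous t sf x0).
Qed.

Lemma enorm_exprz_le (d : int) (m : nat) (x : 'rV[R]_n) : x != 0 -> enorm x < 1 ->
  d <= m%:Z -> enorm x ^ (- d) <= (enorm x)^-1 ^+ m.
Proof.
move=> x0 x1 dm; rewrite -exprz_inv.
have e1 : 1 <= (enorm x)^-1 by rewrite invf_ge1 ?enorm_gt0// ltW.
have : (m%:Z = d + `|m%:Z - d|%N)%R by lia.
rewrite exprnP => ->; rewrite expfzDr ?invr_eq0 ?enorm_eq0//.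
by rewrite ler_peMr ?exprz_ge0 ?invr_ge0 ?enorm_ge0// -exprnP exprn_ege1.
Qed.

Lemma measurable_enormV m : measurable_fun setT (fun x : 'rV[R]_n => (enorm x)^-1 ^+ m).
Proof.
apply: measurable_funX; apply: continuous_off0_measurable => x x0.
apply: continuousV; first by rewrite enorm_eq0.
exact: continuous_enorm.
Qed.

Lemma integrable_enormV m : (m < n)%N ->
  mu.-integrable B (fun x => ((enorm x)^-1 ^+ m)%:E).
Proof.
move=> mn; apply/integrableP; split.
  by apply/measurable_EFinP; apply: measurable_funTS; exact: measurable_enormV.
have := @integral_enormN_lty R n m mn; apply: le_lt_trans.
rewrite le_eqVlt; apply/orP; left; apply/eqP; apply: eq_integral => x _.
by rewrite gee0_abs// lee_fin exprn_ge0// invr_ge0 enorm_ge0.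
Qed.

Lemma integrable_ball_cst c : (0 < n)%N -> mu.-integrable B (fun => c%:E).
Proof.
move=> n0; rewrite (_ : (fun=> _) = (fun x => c%:E * ((enorm x)^-1 ^+ 0)%:E)%E).
  by apply: integrableZl; [exact: measurable_eball|exact: integrable_enormV].
by apply/funext => x; rewrite expr0 mule1.
Qed.

Lemma enorm_bd_integrable T d (m : nat) (f : T -> 'rV[R]_n -> R) t :
  d <= m%:Z -> (m < n)%N -> measurable_fun setT (f t) ->
  enorm_bd d f -> mu.-integrable B (EFin \o f t).
Proof.
move=> dm mn mf [C C0 fC].
have n0 : (0 < n)%N by exact: leq_ltn_trans mn.
(* The order bound says nothing about the value at the origin; the added constant makes the
   domination hold at every point. *)
have i1 : mu.-integrable B (fun x => (C * (enorm x)^-1 ^+ m + `|f t 0|)%:E).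
  under eq_fun do rewrite EFinD EFinM.
  apply: integrableD; first exact: measurable_eball.
    by apply: integrableZl; [exact: measurable_eball|exact: integrable_enormV].
  exact: integrable_ball_cst.
apply: le_integrable i1 => //; first exact: measurable_eball.
  by apply/measurable_EFinP; exact: measurable_funTS.
move=> x x1; rewrite lee_fin; apply: le_trans (ler_norm _).
have [->|x0] := eqVneq x 0.
  by rewrite lerDr mulr_ge0// exprn_ge0// invr_ge0 enorm_ge0.
rewrite ler_wpDr// (le_trans (fC t x x0))// ler_wpM2l//.
exact: enorm_exprz_le.
Qed.

Lemma sym_integrable T N d (m : nat) (f : T -> 'rV[R]_n -> R) t :
  d <= m%:Z -> (m < n)%N -> sym N d f -> mu.-integrable B (EFin \o f t).
Proof.
move=> dm mn sf; apply: enorm_bd_integrable dm mn _ (reg_bd sf).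
exact: sym_measurable sf.
Qed.

(** The same majorant [C |x|^-m] serves all [t]; this is how the second-order term of the energy is
    bounded uniformly. *)
Lemma sym_Rintegral_bd T N d (m : nat) (f : T -> 'rV[R]_n -> R) :
  d <= m%:Z -> (m < n)%N -> sym N d f ->
  exists M, forall t, `|\int[mu]_(x in B) f t x| <= M.
Proof.
move=> dm mn sf; have [C C0 fC] := reg_bd sf.
have n0 : (0 < n)%N by exact: leq_ltn_trans mn.
have mB : measurable B by exact: measurable_eball.
exists (\int[mu]_(x in B) (C * (enorm x)^-1 ^+ m)) => t.
have fi := sym_integrable t dm mn sf.
have ei : mu.-integrable B (EFin \o (fun x => C * (enorm x)^-1 ^+ m)).
  rewrite (_ : _ \o _ = (fun x => C%:E * ((enorm x)^-1 ^+ m)%:E)%E)//.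
  by apply: integrableZl => //; exact: integrable_enormV.
rewrite (le_trans (le_normr_Rintegral mB fi))// fine_le//.
- by apply: integrable_fin_num => //; exact: integrable_norm fi.
- exact: integrable_fin_num.
apply: ae_ge0_le_integral => //.
- by apply: measurable_int; exact: integrable_norm fi.
- by move=> x _; rewrite lee_fin mulr_ge0// exprn_ge0// invr_ge0 enorm_ge0.
- exact: measurable_int ei.
exists [set 0]; split; [exact: measurable_rV_set1|exact: lebesgue_rV_0|].
move=> x /= h; apply: contrapT => /eqP x0; apply: h => x1.
rewrite lee_fin (le_trans (fC t x x0))// ler_wpM2l//.
exact: enorm_exprz_le.
Qed.

End sym_integral.

(** * Integration by parts with singular factors *)

Section integration_by_parts.
Context {R : realType} {p : nat}.
Local Notation n := p.+2.
Local Notation ei i := (delta_mx ord0 i : 'rV[R]_n).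
Local Notation mu := (lebesgue_rV n : {measure set 'rV[R]_n -> \bar R}).
Local Notation B := (@eball R n).

Lemma rV_insD i (h t : R) (y : 'rV[R]_p.+1) :
  rV_ins i (h + t) y = h *: ei i + rV_ins i t y.
Proof.
apply/rowP => j; rewrite !mxE eqxx/=; case: (unliftP i j) => [k|] ->.
  by rewrite ?liftK/= eq_sym (negPf (neq_lift _ _)) mulr0 add0r.
by rewrite ?unlift_none/= eqxx mulr1.
Qed.

Lemma is_derive_rV_ins (F : 'rV[R]_n -> R) i t (y : 'rV[R]_p.+1) :
  derivable F (rV_ins i t y) (ei i) ->
  is_derive t 1 (fun s : R => F (rV_ins i s y)) ('D_(ei i) F (rV_ins i t y)).
Proof.
move=> dF.
have E : (fun h : R => h^-1 *: (F (rV_ins i (h *: 1 + t) y) - F (rV_ins i t y))) =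
    (fun h : R => h^-1 *: (F (h *: ei i + rV_ins i t y) - F (rV_ins i t y))).
  by apply/funext => h; rewrite [_ *: 1]mulr1 rV_insD.
by apply: DeriveDef; rewrite /derivable /derive /= E.
Qed.

Lemma continuous_rV_ins i (y : 'rV[R]_p.+1) : continuous (fun t : R => rV_ins i t y).
Proof.
move=> t; apply/cvg_ballP => e e0; near=> s; split=> // a j.
rewrite (_ : a = ord0); last by apply/val_inj; case: a => -[].
case: (unliftP i j) => [k|] ->; first by rewrite !rV_ins_lift; exact: ballxx.
rewrite !rV_ins_coor; near: s; apply/nbhs_ballP; exists e.
Unshelve. all: by end_near. Qed.

Lemma rV_ins_neq0 i (t : R) (y : 'rV[R]_p.+1) : y != 0 -> rV_ins i t y != 0.
Proof.
apply: contra_neq => /rowP h; apply/rowP => k.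
by have := h (lift i k); rewrite rV_ins_lift !mxE.
Qed.

Lemma integral_line_derive0 (F G : R -> R) :
  (forall t : R, is_derive t 1 F (G t)) -> continuous G ->
  (forall t, 1 <= `|t| -> F t = 0) -> (forall t, 1 <= `|t| -> G t = 0) ->
  (\int[lebesgue_measure]_t (G t)%:E = 0)%E.
Proof.
move=> dF cG F0 G0.
have cF : continuous F.
  by move=> t; apply/differentiable_continuous/derivable1_diffP; case: (dF t).
rewrite (_ : (\int[_]_t _)%E = (\int[lebesgue_measure]_(t in `[(-1)%R, 1%R]) (G t)%:E)%E).
  rewrite (@continuous_FTC2 _ G F)//.
  - by rewrite !F0 ?normrN ?normr1// subee.
  - exact: continuous_subspaceT.
  - split=> [t _||]; first by case: (dF t).
      exact/cvg_at_right_filter/cF.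
    exact/cvg_at_left_filter/cF.
  - by move=> t _; rewrite derive1E; case: (dF t).
rewrite [RHS]integral_mkcond; apply: eq_integral => t _.
rewrite patchE; case: ifPn => //; rewrite notin_setE/= in_itv/= -ler_norml => /negP t1.
by rewrite G0// ltW// ltNge.
Qed.

(** On a line that misses the origin [F] is continuously differentiable, and it vanishes for |t| >=
    1 because such points lie outside the ball; the fundamental theorem of calculus gives 0 on each
    such line. *)
Lemma integral_derive_supp (K : set 'rV[R]_n) (F : 'rV[R]_n -> R) N (d : int) (m : nat) i :
  sym N.+1 d (fun _ : unit => F) -> d + 1 <= m%:Z -> (m < n)%N ->
  closed K -> K `<=` B -> (forall x, ~ K x -> F x = 0) ->
  \int[mu]_(x in B) 'D_(ei i) F x = 0.
Proof.
move=> sF dm mn cK KB F0.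
have sDF := sym_derive _ i sF.
have DF0 x : ~ K x -> 'D_(ei i) F x = 0.
  move=> Kx; suff /near_eq_derive -> : \forall y \near x, F y = cst 0 y.
    by rewrite derive_cst.
  suff : \forall y \near x, (~` K) y by apply: filterS => y; exact: F0.
  by apply: open_nbhs_nbhs; split=> //; exact: closed_openC.
have fi := sym_integrable tt dm mn sDF.
have patchE' : (EFin \o 'D_(ei i) F) \_ B = (EFin \o 'D_(ei i) F).
  apply/funext => x; rewrite patchE; case: ifPn => //; rewrite notin_setE => Bx.
  by rewrite /= DF0// => /KB.
rewrite /Rintegral integral_mkcond patchE' (integral_rV_ins_eq0 (i := i))//.
  have := (integrable_mkcond (EFin \o 'D_(ei i) F) (@measurable_eball R n)).1 fi.
  by rewrite patchE'.
move=> y y0 /=.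
have out t : 1 <= `|t| -> ~ K (rV_ins i t y).
  move=> t1 /KB; rewrite /eball/=; apply/negP; rewrite -leNgt.
  by apply: (le_trans t1); rewrite -{1}(rV_ins_coor i t y) ler_coor_enorm.
apply: (@integral_line_derive0 (fun t => F (rV_ins i t y))).
- move=> t; exact: (is_derive_rV_ins (sym_derivable i tt sF (rV_ins_neq0 i t y0))).
- move=> t; apply: (@continuous_comp _ _ _ (fun t : R => rV_ins i t y) ('D_(ei i) F)).
    exact: continuous_rV_ins.
  exact: (sym_continuous tt sDF (rV_ins_neq0 i t y0)).
- by move=> t /out /F0.
- by move=> t /out /DF0.
Qed.

(** Both factors may be singular at the origin: the total order [d + e + 1], below the dimension,
    makes the derivative of the product integrable, and no boundary term arises there. The product
    rule holds off the origin, hence a.e. *)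
Lemma integral_by_parts (K : set 'rV[R]_n) (F G : 'rV[R]_n -> R) N M (d e : int) (m : nat) i :
  sym N.+1 d (fun _ : unit => F) -> sym M.+1 e (fun _ : unit => G) ->
  d + e + 1 <= m%:Z -> (m < n)%N ->
  closed K -> K `<=` B -> (forall x, ~ K x -> G x = 0) ->
  \int[mu]_(x in B) (F x * 'D_(ei i) G x) =
  - \int[mu]_(x in B) ('D_(ei i) F x * G x).
Proof.
move=> sF sG dm mn cK KB G0.
have sF1 := symW (ltn0Sn N) sF; have sG1 := symW (ltn0Sn M) sG.
have H : \int[mu]_(x in B) 'D_(ei i) (fun x => F x * G x) x = 0.
  apply: (integral_derive_supp i (symM sF1 sG1) dm mn cK KB) => x /G0 ->.
  by rewrite mulr0.
have sFDG : sym 0 (d + e + 1) (fun _ : unit => fun x => F x * 'D_(ei i) G x).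
  by have := symM (symW (leq0n 1) sF1) (sym_derive 0 i sG1); rewrite addrA.
have sDFG : sym 0 (d + e + 1) (fun _ : unit => fun x => 'D_(ei i) F x * G x).
  by have := symM (sym_derive 0 i sF1) (symW (leq0n 1) sG1); rewrite addrAC.
have mB : measurable B := @measurable_eball R n.
apply/eqP; rewrite -addr_eq0 -(RintegralD mB (sym_integrable tt dm mn sFDG)
  (sym_integrable tt dm mn sDFG)).
rewrite -[X in _ == X]H /Rintegral; apply/eqP; congr fine.
apply: ae_eq_integral => //.
- apply/measurable_EFinP; apply: measurable_funTS.
  exact: (sym_measurable tt (symD sFDG sDFG)).
- apply/measurable_EFinP; apply: measurable_funTS.
  exact: (sym_measurable tt (sym_derive 0 i (symM sF1 sG1))).
exists [set 0]; split; [exact: measurable_rV_set1|exact: lebesgue_rV_0|].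
move=> x /= h; apply: contrapT => /eqP x0; apply: h => _; congr (_%:E).
rewrite deriveM; [|exact: (sym_derivable i tt sF x0)|exact: (sym_derivable i tt sG x0)].
by rewrite [X in _ = _ + X]mulrC.
Qed.

End integration_by_parts.

(** * Classical derivatives off the origin as weak derivatives *)

Section weak_derivatives.
Context {R : realType} {p : nat}.
Local Notation n := p.+2.
Local Notation ei i := (delta_mx ord0 i : 'rV[R]_n).
Local Notation mu := (lebesgue_rV n : {measure set 'rV[R]_n -> \bar R}).
Local Notation B := (@eball R n).

Lemma pderivs_rev_cons i s (f : 'rV[R]_n -> R) :
  pderivs (rev (i :: s)) f = pderivs (rev s) ('D_(ei i) f).
Proof. by rewrite rev_cons pderivs_rcons. Qed.

Lemma sym_pderivs T N d (s : seq 'I_n) (f : T -> 'rV[R]_n -> R) :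
  sym (N + size s) d f -> sym N (d + (size s)%:Z) (fun t => pderivs (rev s) (f t)).
Proof.
elim: s d f => [|i s IH] d f /=; first by rewrite addn0 addr0.
rewrite addnS => sf; have := IH _ _ (sym_derive _ i sf).
rewrite -addrA -[1 + _]PoszD add1n.
by under eq_fun do rewrite -pderivs_rev_cons.
Qed.

Lemma sym_L2_ball T N d (m : nat) (f : T -> 'rV[R]_n -> R) t :
  d + d <= m%:Z -> (m < n)%N -> sym N d f -> L2_ball (f t).
Proof.
move=> dm mn sf; split; first by apply: measurable_funTS; exact: sym_measurable sf.
have /integrableP[_] := sym_integrable t dm mn (symM sf sf); apply: le_lt_trans.
rewrite le_eqVlt; apply/orP; left; apply/eqP; apply: eq_integral => x _.
by rewrite /= -expr2 ger0_norm// sqr_ge0.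
Qed.

(** The outermost derivative of [phi] is the first to be moved onto [f], where it becomes the
    innermost one; hence the reversed word. *)
Lemma sym_weak_deriv N d (m : nat) (s : seq 'I_n) (f : 'rV[R]_n -> R) :
  sym (N + size s) d (fun _ : unit => f) -> d + (size s)%:Z <= m%:Z -> (m < n)%N ->
  weak_deriv s f (pderivs (rev s) f).
Proof.
elim: s d f => [|i s IH] d f sf dm mn phi tphi /=; first by rewrite expr0 mul1r.
rewrite /= addnS in sf.
have tsphi := test_fun_pderivs s tphi.
have dm' : d + 1 + (size s)%:Z <= m%:Z by rewrite -addrA -[1 + _]PoszD add1n.
rewrite -/(pderivs s phi) (@integral_by_parts _ _ (closure [set x | pderivs s phi x != 0])
  f (pderivs s phi) (N + size s) 0 d 0 m i sf).
- by rewrite (IH _ _ (sym_derive _ i sf) dm' mn _ tphi) pderivs_rev_cons exprS mulN1r mulNr.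
- by apply: test_fun_sym => //; left.
- by rewrite addr0 (le_trans _ dm')// lerDl.
- exact: mn.
- exact: closed_closure.
- by have [_ _] := tsphi.
- by move=> x h; apply/eqP/negPn/negP => fx; apply: h; exact: subset_closure.
Qed.

Lemma sym_sobolev q k (u : 'rV[R]_n -> 'rV[R]_q) : (2 * k < n)%N ->
  (forall j, sym k 0 (fun _ : unit => Defs.coord u j)) -> sobolev k u.
Proof.
move=> kn su j; split.
  by apply: (sym_L2_ball tt (m := 0) _ _ (su j)).
move=> s sk; exists (pderivs (rev s) (Defs.coord u j)).
  have := symW sk (su j); rewrite -[size s]add0n => /sym_pderivs; rewrite add0r => h.
  apply: (sym_L2_ball tt (m := 2 * k) _ _ h) => //; lia.
apply: (sym_weak_deriv (N := 0) (d := 0) (m := k)) => //; last by lia.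
exact: symW (su j).
Qed.

End weak_derivatives.

(** * Bump functions and the fundamental lemma *)

Section flat_function.
Context {R : realType}.
Implicit Types (P : {poly R}) (t : R).

(* The functions P(1/t) exp(-1/t) on t > 0, extended by 0, are stable under
   differentiation; the case P = 1 is the standard flat function. *)
Definition flat P t : R := if 0 < t then P.[t^-1] * expR (- t^-1) else 0.

(** Coefficientwise [s^i exp (-s) <= i!], from the Taylor lower bound of the exponential. *)
Lemma expR_poly_bounded P : exists C, forall s, 0 < s -> `|P.[s] * expR (- s)| <= C.
Proof.
exists (\sum_(i < size P) `|P`_i| * i`!%:R) => s s0.
rewrite horner_coef mulr_suml (le_trans (ler_norm_sum _ _ _))// ler_sum// => i _.
rewrite !normrM -mulrA ler_wpM2l//.
rewrite !ger0_norm ?exprn_ge0 ?expR_ge0 ?(ltW s0)// expRN ler_pdivrMr ?expR_gt0//.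
case: (i : nat) => [|j].
  by rewrite expr0 fact0 mul1r -expR0 ler_expR ltW.
rewrite -ler_pdivrMl ?ltr0n ?fact_gt0// mulrC (le_trans _ (expR_ge1Dxn j (ltW s0)))//.
by rewrite lerDr.
Qed.

Lemma is_derive_flat P t : is_derive t 1 (flat P) (flat ('X^2 * (P - P^`())) t).
Proof.
have [t0|t0|t0] := ltgtP 0 t.
- have E : \forall s \near t, P.[s^-1] * expR (- s^-1) = flat P s.
    have : \forall s \near t, 0 < s by exact: lt_nbhsr.
    by apply: filterS => s s0; rewrite /flat s0.
  apply: (near_eq_is_derive E).
  have tn0 : t != 0 by rewrite gt_eqF.
  have d1 : is_derive t 1 (fun s : R => s^-1) (- t ^- 2).
    have := @derivableV R R id t 1 tn0 (@derivable_id _ _ t 1).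
    move/derivableP => h; apply: is_derive_eq h _.
    by rewrite deriveV//= derive_id scaler1.
  have d2 : is_derive t 1 (fun s : R => P.[s^-1]) (P^`().[t^-1] * (- t ^- 2)).
    have [h1 h2] := d1; rewrite -h2.
    exact: (is_derive_line (h := horner P) h1).
  have d3 : is_derive t 1 (fun s : R => expR (- s^-1)) (expR (- t^-1) * (t ^- 2)).
    have d1' : is_derive t 1 (fun s : R => - s^-1) (t ^- 2).
      by rewrite -[t ^- 2]opprK; exact: is_deriveN.
    have [h1 h2] := d1'; rewrite -h2.
    exact: (is_derive_line (h := expR) h1).
  apply: (is_derive_eq (is_deriveM d2 d3)).
  rewrite /flat t0 !hornerE /GRing.scale/=; field.
  exact: tn0.
- have E : \forall s \near t, (cst 0 : R -> R) s = flat P s.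
    have : \forall s \near t, s < 0 by apply: open_nbhs_nbhs; split=> //; exact: open_lt.
    by apply: filterS => s s0; rewrite /flat ltNge (ltW s0).
  apply: (near_eq_is_derive E); rewrite /flat ltNge (ltW t0)/=.
  exact: is_derive_cst.
- have F0 Q : flat Q 0 = 0 by rewrite /flat ltxx.
  rewrite -t0 F0.
  (* The difference quotient at 0 divides by [h]; writing [h^-1 = h * h^-2] puts the factor ['X^2]
     on [P] and leaves [h] times a bounded quantity. *)
  have [C PC] := expR_poly_bounded ('X^2 * P).
  have L : h^-1 *: ((flat P \o shift 0) (h *: 1) - flat P 0) @[h --> (0:R)^'] --> (0 : R).
    rewrite F0; apply/cvgr0Pnorm_le => e e0.
    near=> h; rewrite /= subr0 addr0 [h%:A]mulr1 /flat.
    case: ifPn => h0; last by rewrite scaler0 normr0 ltW.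
    have -> : h^-1 *: (P.[h^-1] * expR (- h^-1)) = h * (('X^2 * P).[h^-1] * expR (- h^-1)).
      rewrite !hornerE /GRing.scale/=; field; exact: lt0r_neq0.
    rewrite normrM (le_trans (ler_wpM2l (normr_ge0 _) (PC _ _))) ?invr_gt0//.
    have : `|h| <= e / (`|C| + 1).
      near: h; apply: dnbhs0_le; rewrite divr_gt0// ltr_wpDl//.
    rewrite ler_pdivlMr ?ltr_wpDl// => he.
    rewrite (le_trans _ he)// ler_wpM2l// (le_trans (ler_norm _))// lerDl//.
  apply: DeriveDef; first by apply/cvg_ex; exists 0.
  exact: cvg_lim L.
Unshelve. all: by end_near. Qed.

Definition bump1 := flat 1.

Lemma bump1_ge0 t : 0 <= bump1 t.
Proof. by rewrite /bump1 /flat; case: ifPn => // _; rewrite hornerE mul1r expR_ge0. Qed.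

Lemma bump1_le1 t : bump1 t <= 1.
Proof.
rewrite /bump1 /flat; case: ifPn => // t0.
by rewrite hornerE mul1r -expR0 ler_expR oppr_le0 invr_ge0 ltW.
Qed.

Lemma bump1_eq0 t : t <= 0 -> bump1 t = 0.
Proof. by move=> t0; rewrite /bump1 /flat ltNge t0. Qed.

Lemma bump1_gt0 t : 0 < t -> 0 < bump1 t.
Proof. by move=> t0; rewrite /bump1 /flat t0 hornerE mul1r expR_gt0. Qed.

(** One limit covers the ball and the half-spaces: with [c] a function of [x], the limit is the
    indicator of the open set where [c > 0]. *)
Lemma cvg_bump1 (c b : R) : 0 <= b ->
  bump1 (m.+1%:R * c - b) @[m --> \oo] --> ((0 < c)%R%:R : R).
Proof.
move=> b0; have [c0|c0] := leP c 0.
  rewrite (_ : (fun m => _) = fun=> 0); first exact: cvg_cst.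
  apply/funext => m; apply: bump1_eq0.
  by rewrite subr_le0 (le_trans _ b0)// mulr_ge0_le0.
apply/cvgrPdist_le => e e0; near=> m.
have sm : e^-1 <= m.+1%:R * c - b.
  rewrite lerBrDr -ler_pdivrMr//.
  apply: (@le_trans _ _ m%:R); last by rewrite ler_nat.
  near: m; exact: nbhs_infty_ger.
have s0 : 0 < m.+1%:R * c - b by rewrite (lt_le_trans _ sm)// invr_gt0.
rewrite ger0_norm ?subr_ge0 ?bump1_le1//.
rewrite /bump1 /flat s0 hornerE mul1r lerBlDr -lerBlDl.
by rewrite (le_trans _ (expR_ge1Dx _))// lerD2l lerN2 invf_ple.
Unshelve. all: by end_near. Qed.

End flat_function.

Section smooth_reg.
Context {R : realType} {n : nat}.
Local Notation ei i := (delta_mx ord0 i : 'rV[R]_n).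

Let nobd : int -> (unit -> 'rV[R]_n -> R) -> Prop := fun _ _ => True.

(** The instance of [reg] on the whole space with a trivial bound, so that sums, products and
    compositions of smooth functions follow from the calculus above. *)
Definition regs (f : 'rV[R]_n -> R) := forall N, reg setT nobd N 0 (fun _ => f).

Let reg_d N d e f : reg setT nobd N d f -> reg setT nobd N e f.
Proof.
elim: N d e f => [|N IH] d e f [cf bf df]; split=> // i.
by have [dfi rfi] := df i; split=> //; exact: IH rfi.
Qed.

Lemma regs_smooth f : regs f -> smooth f.
Proof.
move=> rf s.
have {}rf N : reg setT nobd N 0 (fun _ => pderivs s f).
  elim/last_ind: s f rf => [//|s i IH] f rf.
  rewrite pderivs_rcons; apply: IH => M.
  by have [_ _ /(_ i)[_ h]] := rf M.+1; exact: reg_d h.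
split=> [x|i x]; first by have [h _ _] := rf 0%N; exact: (h tt x).
by have [_ _ /(_ i)[h _]] := rf 1%N; exact: (h tt x).
Qed.

Lemma smooth_regs f : smooth f -> regs f.
Proof.
move=> sf N; suff: forall d, reg setT nobd N d (fun=> f) by apply.
elim: N f sf => [|N IH] f sf d.
  by split=> // t x _; have [h _] := sf [::]; exact: h.
split=> // [t x _|i]; first by have [h _] := sf [::]; exact: h.
split; first by move=> t x _; have [_ h] := sf [::]; exact: h.
by apply: IH; exact: smooth_derive.
Qed.

Lemma regs_cst c : regs (fun _ => c).
Proof. by move=> N; apply: (reg_cst openT). Qed.

Lemma regs_coor j : regs (fun x => x ord0 j).
Proof.
case=> [|N]; (split; [by move=> t x _; exact: coord_continuous|by []|]) => //.
move=> i; split; first by move=> t x _; case: (is_derive_coor x (ei i) j).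
apply: (reg_d (d := 0)); apply: (reg_ext openT _ _ (regs_cst (ei i ord0 j) N)) => // t x _.
by case: (is_derive_coor x (ei i) j).
Qed.

Lemma regsM f g : regs f -> regs g -> regs (fun x => f x * g x).
Proof.
move=> rf rg N; have := regM openT (fun _ _ _ _ _ => I) (fun _ _ _ _ _ => I)
  (fun _ _ _ _ _ _ => I) (rf N) (rg N).
by rewrite addr0.
Qed.

Lemma regsD f g : regs f -> regs g -> regs (fun x => f x + g x).
Proof. by move=> rf rg N; exact: (regD openT (fun _ _ _ _ _ => I) (fun _ _ _ _ _ => I) (rf N) (rg N)). Qed.

Lemma regsZ c f : regs f -> regs (fun x => c * f x).
Proof. by move=> rf; apply: regsM => //; exact: regs_cst. Qed.

Lemma regs_sum (I : Type) (s : seq I) (F : I -> 'rV[R]_n -> R) :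
  (forall i, regs (F i)) -> regs (fun x => \sum_(i <- s) F i x).
Proof.
move=> rF; elim: s => [|i s IH].
  by under eq_fun do rewrite big_nil; exact: regs_cst.
by under eq_fun do rewrite big_cons; exact: regsD.
Qed.

Lemma regs_prod (I : Type) (s : seq I) (F : I -> 'rV[R]_n -> R) :
  (forall i, regs (F i)) -> regs (fun x => \prod_(i <- s) F i x).
Proof.
move=> rF; elim: s => [|i s IH].
  by under eq_fun do rewrite big_nil; exact: regs_cst.
by under eq_fun do rewrite big_cons; exact: regsM.
Qed.

Lemma regs_bump1 f : regs f -> regs (fun x => bump1 (f x)).
Proof.
move=> rf N; apply: (@reg_comp _ _ _ _ _ openT _ _ _ _ _ {poly R} (@flat R)
  (fun P => 'X^2 * (P - P^`())) (fun=> 1) setT (fun _ => f) N 1) => //.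
by move=> P y _; rewrite mul1r; exact: is_derive_flat.
Qed.

End smooth_reg.

Section test_functions.
Context {R : realType} {n : nat}.
Local Notation B := (@eball R n).

Lemma compact_in_eball (K : set 'rV[R]_n) : closed K -> K `<=` B -> compact K.
Proof.
move=> cK KB; apply: (subclosed_compact cK
  (@rV_compact R n (fun=> `[(-1)%R, 1%R]%classic) (fun=> @segment_compact R _ _))).
move=> x /KB /ltW x1 i /=; rewrite in_itv/= -ler_norml.
exact: le_trans (ler_coor_enorm x i) x1.
Qed.

Lemma test_fun_intro (K : set 'rV[R]_n) (f : 'rV[R]_n -> R) :
  smooth f -> closed K -> K `<=` B -> (forall x, ~ K x -> f x = 0) -> test_fun f.
Proof.
move=> sf cK KB f0.
have fK : closure [set x | f x != 0] `<=` K.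
  rewrite [X in _ `<=` X](closure_id _).1//; apply: closureS => x /= fx.
  by apply: contrapT => /f0 /eqP; apply/negP.
split=> //; last exact: subset_trans KB.
by apply: compact_in_eball; [exact: closed_closure|exact: subset_trans KB].
Qed.

(** The shift by 1 in the first factor confines the support to |x|^2 <= 1 - 1/(m+1), a closed subset
    of the open ball. The shift 0 in the other factors is kept so that [cvg_bump1] applies to all of
    them. *)
Definition cutoff (l : seq ('I_n * R)) (m : nat) (x : 'rV[R]_n) : R :=
  bump1 (m.+1%:R * (1 - \sum_j x ord0 j ^+ 2) - 1) *
  \prod_(q <- l) bump1 (m.+1%:R * (q.2 - x ord0 q.1) - 0).

Definition halfspaces (l : seq ('I_n * R)) : set 'rV[R]_n :=
  [set x | all (fun q => x ord0 q.1 < q.2) l].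

Lemma cutoff_test_fun l m : test_fun (cutoff l m).
Proof.
pose K := [set x : 'rV[R]_n | enorm x ^+ 2 <= 1 - m.+1%:R^-1].
have m0 : 0 < m.+1%:R^-1 :> R by rewrite invr_gt0.
apply: (@test_fun_intro K).
- apply: regs_smooth; apply: regsM.
    apply: regs_bump1; apply: regsD; last exact: regs_cst.
    apply: regsZ; apply: regsD; first exact: regs_cst.
    have := @regsZ R n (-1) _ (regs_sum (index_enum 'I_n) (fun j => regsM (@regs_coor R n j) (regs_coor j))).
    rewrite (_ : (fun x => -1 * _) = (fun x : 'rV[R]_n => - \sum_j x ord0 j ^+ 2))//.
    by apply/funext => x; rewrite mulN1r.
  apply: regs_prod => q; apply: regs_bump1; apply: regsD; last exact: regs_cst.
  apply: regsZ; apply: regsD; first exact: regs_cst.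
  have := @regsZ R n (-1) _ (regs_coor q.1).
  rewrite (_ : (fun x => -1 * _) = (fun x : 'rV[R]_n => - x ord0 q.1))//.
  by apply/funext => x; rewrite mulN1r.
- apply: (@preimage_closed _ _ (fun x : 'rV[R]_n => enorm x ^+ 2) [set t | t <= 1 - m.+1%:R^-1]).
    move=> x _; apply: (@continuous_comp _ _ _ (@enorm R n) (fun t : R => t ^+ 2)).
      exact: continuous_enorm.
    exact: exprn_continuous.
  exact: closed_le.
- move=> x; rewrite /K /eball /= => xK.
  rewrite -(@ltr_pXn2r _ 2)// ?nnegrE ?enorm_ge0// expr1n (le_lt_trans xK)//.
- move=> x /negP; rewrite -ltNge => xK.
  rewrite /cutoff bump1_eq0 ?mul0r// -enorm_sqr subr_le0.
  by rewrite -ler_pdivlMl// mulr1 lerBlDr -lerBlDl ltW.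
Qed.

Lemma cutoff_bounded l m x : 0 <= cutoff l m x <= 1.
Proof.
rewrite /cutoff; have p01 : 0 <= \prod_(q <- l) bump1 (m.+1%:R * (q.2 - x ord0 q.1) - 0) <= 1.
  rewrite prodr_ge0 => [|q _]; last exact: bump1_ge0.
  by rewrite prodr_ile1// => q _; rewrite bump1_ge0 bump1_le1.
have /andP[p0 p1] := p01.
by rewrite mulr_ge0 ?bump1_ge0// mulr_ile1 ?bump1_ge0 ?bump1_le1.
Qed.

Lemma cvg_cutoff l x : B x ->
  cutoff l m x @[m --> \oo] --> (\1_(halfspaces l) x : R).
Proof.
move=> x1; have -> : \1_(halfspaces l) x = 1 * \prod_(q <- l) ((0 < q.2 - x ord0 q.1)%R%:R : R).
  rewrite mul1r; elim: l => [|q l IH].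
    by rewrite big_nil indicE mem_set.
  rewrite big_cons -IH !indicE subr_gt0 -natrM mulnb; congr (nat_of_bool _)%:R.
  apply/idP/andP => [|[ql]]; rewrite !inE /halfspaces/=; first by move=> /andP[].
  by rewrite ql.
apply: cvgM.
  have := @cvg_bump1 R (1 - \sum_j x ord0 j ^+ 2) 1 ler01.
  rewrite subr_gt0 -enorm_sqr (_ : _ < 1)//.
  by rewrite expr_lt1 ?enorm_ge0.
elim: l => [|q l IH].
  under eq_fun do rewrite big_nil; rewrite big_nil; exact: cvg_cst.
under eq_fun do rewrite big_cons; rewrite big_cons; apply: cvgM => //.
exact: cvg_bump1.
Qed.

(** For the sigma-algebra on the right each coordinate is measurable, since a single half-space is a
    one-element list, and the coordinates generate the Borel sets. *)
Lemma measurable_halfspaces_gen A : measurable A ->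
  <<s [set halfspaces l | l in setT] >> A.
Proof.
pose G := [set halfspaces l | l in setT].
have mid : measurable_fun setT (id : g_sigma_algebraType G -> 'rV[R]_n).
  apply: measurable_coorP => i.
  apply: (measurability _ (RGenInftyO.measurableE R)).
  move=> _ [_ [a ->] <-]; rewrite setTI; apply: sub_sigma_algebra.
  exists [:: (i, a)] => //; apply/seteqP; split=> x /=; rewrite /halfspaces/= andbT in_itv//.
by move=> mA; have := mid measurableT A mA; rewrite setTI.
Qed.

End test_functions.

Section fundamental_lemma.
Context {R : realType} {n : nat}.
Local Notation mu := (lebesgue_rV n : {measure set 'rV[R]_n -> \bar R}).
Local Notation B := (@eball R n).

Lemma integral_lim_eq0 (D : set 'rV[R]_n) (f_ : nat -> 'rV[R]_n -> R) (f g : 'rV[R]_n -> R) :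
  measurable D -> (forall m, measurable_fun D (f_ m)) -> measurable_fun D f ->
  (forall x, D x -> f_ m x @[m --> \oo] --> f x) ->
  mu.-integrable D (EFin \o g) -> (forall m x, D x -> `|f_ m x| <= g x) ->
  (forall m, \int[mu]_(x in D) (f_ m x)%:E = 0)%E ->
  (\int[mu]_(x in D) (f x)%:E = 0)%E.
Proof.
move=> mD mf_ mf ff gi fg f0.
have mf_' m : measurable_fun D (fun x => (f_ m x)%:E).
  by apply/measurable_EFinP; exact: mf_.
have mf' : measurable_fun D (fun x => (f x)%:E) by apply/measurable_EFinP.
have ff' : {ae mu, forall x, D x -> (fun m => (f_ m x)%:E) @ \oo --> (f x)%:E}.
  by apply: aeW => x Dx; apply: cvg_EFin; [exact: nearW|exact: ff].
have fg' : {ae mu, forall x m, D x -> (`|(f_ m x)%:E| <= (EFin \o g) x)%E}.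
  by apply: aeW => x m Dx; rewrite lee_fin; exact: fg.
have [_ _] := dominated_convergence mD mf_' mf' ff' gi fg'.
rewrite (_ : [sequence _]_ _ = fun=> 0%E); last by apply/funext.
by move=> /cvg_lim <-//; rewrite lim_cst.
Qed.

(* The smooth cutoffs of finite intersections of half-spaces, a pi-system that
   generates the Borel sets, converge boundedly to their indicators. *)
Lemma fundamental_lemma (h : 'rV[R]_n -> R) :
  mu.-integrable B (EFin \o h) ->
  (forall phi, test_fun phi -> \int[mu]_(x in B) (h x * phi x) = 0) ->
  {ae mu, forall x, B x -> h x = 0}.
Proof.
move=> hi h0; have mB : measurable B := @measurable_eball R n.
have mh : measurable_fun B h by apply/measurable_EFinP; exact: measurable_int hi.
have nhi : mu.-integrable B (EFin \o (fun x => `|h x|)) by exact: integrable_norm hi.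
pose H : set (set 'rV[R]_n) := [set A | measurable A /\
  (\int[mu]_(x in B) (h x * \1_A x)%:E = 0)%E].
have mhA A : measurable A -> measurable_fun B (fun x => h x * \1_A x).
  by move=> mA; apply: measurable_funM => //; exact: measurable_indic.
have hA x (A : set 'rV[R]_n) : `|h x * \1_A x| <= `|h x|.
  by rewrite normrM ler_piMr// indicE; case: (_ \in _); rewrite ?normr1 ?normr0.
have ihA A : measurable A -> mu.-integrable B (fun x => (h x * \1_A x)%:E).
  move=> mA; apply: le_integrable nhi => //; first by apply/measurable_EFinP; exact: mhA.
  by move=> x _; rewrite /= lee_fin normr_id; exact: hA.
have GH : [set halfspaces l | l in setT] `<=` H.
  move=> _ [l _ <-].
  have mhl : measurable (halfspaces l : set 'rV[R]_n).
    elim: l => [|q l IH]; first by rewrite (_ : halfspaces [::] = setT)//; apply/seteqP; split.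
    rewrite (_ : halfspaces (q :: l) =
      ((fun x : 'rV[R]_n => x ord0 q.1) @^-1` [set t | t < q.2]) `&` halfspaces l); last first.
      by apply/seteqP; split=> x /=; rewrite /halfspaces/= => /andP.
    apply: measurableI => //; apply: open_measurable_rV.
    apply: open_comp => [x _|]; [exact: coord_continuous|exact: open_lt].
  split=> //; apply: (@integral_lim_eq0 B (fun m x => h x * cutoff l m x) _ (fun x => `|h x|)) => //.
  - move=> m; apply: measurable_funM => //; apply: measurable_funTS.
    apply: continuous_off0_measurable => x _.
    exact: (test_fun_continuous (cutoff_test_fun l m)).
  - exact: mhA.
  - by move=> x Bx; apply: cvgM; [exact: cvg_cst|exact: cvg_cutoff].
  - move=> m x _; rewrite normrM ler_piMr//; have /andP[c0 c1] := cutoff_bounded l m x.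
    by rewrite ger0_norm.
  - move=> m; rewrite -[LHS]fineK; first by congr EFin; exact: h0 (cutoff_test_fun l m).
    apply: integrable_fin_num => //; apply: le_integrable nhi => //.
      apply/measurable_EFinP; apply: measurable_funM => //; apply: measurable_funTS.
      apply: continuous_off0_measurable => x _.
      exact: (test_fun_continuous (cutoff_test_fun l m)).
    move=> x _; rewrite /= lee_fin normr_id normrM ler_piMr//.
    by have /andP[c0 c1] := cutoff_bounded l m x; rewrite ger0_norm.
have LH : lambda_system setT H.
  split => //.
  - by apply: GH; exists [::] => //; apply/seteqP; split.
  - move=> A C CA [mA A0] [mC C0]; split; first exact: measurableD.
    rewrite (_ : (fun x => _) = (fun x => (h x * \1_A x)%:E - (h x * \1_C x)%:E)%E); last first.
      apply/funext => x; rewrite -EFinB -mulrBr; congr (_ * _)%:E.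
      rewrite !indicE; case: (boolP (x \in C)) => xC.
        have xA : x \in A by move: xC; rewrite !inE; exact: CA.
        rewrite xA subrr memNset// => -[_]; by move: xC; rewrite inE.
      rewrite subr0; congr (nat_of_bool _)%:R; rewrite in_setD andb_idr//.
    by rewrite integralB_EFin ?A0 ?C0 ?sube0//; exact: ihA.
  - move=> F ndF HF; have mF : measurable (\bigcup_i F i).
      by apply: bigcupT_measurable => i; have [] := HF i.
    split=> //.
    apply: (@integral_lim_eq0 B (fun m x => h x * \1_(F m) x) _ (fun x => `|h x|)) => //.
    + by move=> m; apply: mhA; have [] := HF m.
    + exact: mhA.
    + move=> x Bx; apply: cvgM; first exact: cvg_cst.
      have [xF|xF] := pselect ((\bigcup_i F i) x); last first.
        rewrite indicE memNset//; under eq_fun.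
          by move=> m; rewrite indicE memNset; [over|move=> Fm; apply: xF; exists m].
        exact: cvg_cst.
      rewrite indicE mem_set//; have [i _ Fix] := xF.
      apply: cvg_near_cst; near=> m; rewrite indicE mem_set//.
      have /ndF/subsetPset : (i <= m)%N by near: m; exact: nbhs_infty_ge.
      exact.
    + by move=> m; have [] := HF m.
have HM A : measurable A -> H A.
  move=> mA; apply: (lambda_system_subset _ LH GH) => //; last exact: measurable_halfspaces_gen.
  move=> _ _ [l _ <-] [l' _ <-]; exists (l ++ l') => //.
  by apply/seteqP; split=> x; rewrite /halfspaces/= all_cat => /andP.
have := @integral_ae_eq _ _ R mu B mB (cst 0%E) (EFin \o h) hi (measurable_cst _).
case.
  move=> E EB mE; rewrite integral0.
  have [_ <-] := HM E mE.
  rewrite -{1}(setIidr EB) integral_mkcondr; apply: eq_integral => x _.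
  by rewrite patchE /= indicE; case: ifPn => _; rewrite ?mulr1 ?mulr0.
move=> N [mN N0 sN]; exists N; split=> // x /= h'; apply: sN => /= h''; apply: h' => Bx.
by have := h'' Bx; rewrite /= => -[].
Unshelve. all: by end_near. Qed.

End fundamental_lemma.

(** * Uniqueness of weak derivatives *)

Section weak_uniqueness.
Context {R : realType} {n : nat}.
Hypothesis n0 : (0 < n)%N.
Local Notation ei i := (delta_mx ord0 i : 'rV[R]_n).
Local Notation mu := (lebesgue_rV n : {measure set 'rV[R]_n -> \bar R}).
Local Notation B := (@eball R n).
Let mB : measurable B := @measurable_eball R n.

Lemma L2_ball_integrable f : L2_ball f -> mu.-integrable B (EFin \o f).
Proof.
move=> [mf f2].
have f2i : mu.-integrable B (EFin \o (fun x => f x ^+ 2)).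
  apply/integrableP; split.
    by apply/measurable_EFinP; exact: measurable_funX.
  move: f2; apply: le_lt_trans; rewrite le_eqVlt; apply/orP; left; apply/eqP.
  by apply: eq_integral => x _; rewrite /= ger0_norm ?sqr_ge0.
(* The majorant is [1 + f^2], the ball having finite measure. *)
have := integrableD mB (integrable_ball_cst (1 : R) n0) f2i.
apply: le_integrable => //; first exact/measurable_EFinP.
move=> x _; rewrite -EFinD !abse_EFin lee_fin.
rewrite [leRHS]ger0_norm ?addr_ge0 ?sqr_ge0//.
have := sqr_ge0 (`|f x| - 1); rewrite -(real_normK (num_real (f x))); nra.
Qed.

Lemma integrable_test f phi : mu.-integrable B (EFin \o f) -> test_fun phi ->
  mu.-integrable B (EFin \o (fun x => f x * phi x)).
Proof.
move=> fi tp; have [M M0 pM] := test_fun_bounded tp.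
have mf : measurable_fun B f by apply/measurable_EFinP; exact: measurable_int fi.
have := integrableZl mB M (integrable_norm fi).
apply: le_integrable => //.
  apply/measurable_EFinP; apply: measurable_funM => //; apply: measurable_funTS.
  by apply: continuous_off0_measurable => x _; exact: test_fun_continuous.
move=> x _; rewrite !abse_EFin lee_fin !normrM normr_id (ger0_norm M0) mulrC.
by rewrite ler_wpM2r.
Qed.

Lemma weak_deriv_unique s f g g' : L2_ball g -> L2_ball g' ->
  weak_deriv s f g -> weak_deriv s f g' -> {ae mu, forall x, B x -> g x = g' x}.
Proof.
move=> /L2_ball_integrable gi /L2_ball_integrable g'i wg wg'.
have hi : mu.-integrable B (EFin \o (fun x => g x - g' x)).
  exact: (integrableB mB gi g'i).
have := fundamental_lemma hi.
case.
  move=> phi tp; have := wg phi tp; rewrite (wg' phi tp) => /eqP.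
  rewrite -subr_eq0 -mulrBr mulf_eq0 signr_eq0/= subr_eq0 => /eqP E.
  transitivity (\int[mu]_(x in B) (g x * phi x - g' x * phi x)).
    by congr fine; apply: eq_integral => x _; rewrite mulrBl.
  by rewrite RintegralB//; [rewrite -E subrr|exact: integrable_test..].
move=> N [mN N0 sN]; exists N; split=> // x /= h; apply: sN => /= h'; apply: h => Bx.
by have /eqP := h' Bx; rewrite subr_eq0 => /eqP.
Qed.

Lemma ae_eq_Rintegral (f g : 'rV[R]_n -> R) : measurable_fun B f -> measurable_fun B g ->
  {ae mu, forall x, B x -> f x = g x} ->
  \int[mu]_(x in B) f x = \int[mu]_(x in B) g x.
Proof.
move=> mf mg fg; congr fine; apply: ae_eq_integral => //; try exact/measurable_EFinP.
by move: fg; apply: filterS => x h /h ->.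
Qed.

Lemma measurable_test phi : test_fun phi -> measurable_fun B (phi : 'rV[R]_n -> R).
Proof.
move=> tp; apply: measurable_funTS.
by apply: continuous_off0_measurable => x _; exact: test_fun_continuous.
Qed.

Lemma weak_deriv_ae s f f' g : measurable_fun B f -> measurable_fun B f' ->
  {ae mu, forall x, B x -> f x = f' x} -> weak_deriv s f' g -> weak_deriv s f g.
Proof.
move=> mf mf' ff' wf phi tp; rewrite -(wf phi tp).
have mp : measurable_fun B (pderivs s phi) by apply: measurable_test; exact: test_fun_pderivs.
apply: ae_eq_Rintegral; try exact: measurable_funM.
by move: ff'; apply: filterS => x h /h ->.
Qed.

End weak_uniqueness.

(** * The weak Laplacian and the energy in terms of classical derivatives *)

Section weak_laplacian.
Context {R : realType} {p : nat}.
Local Notation n := p.+2.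
Local Notation ei i := (delta_mx ord0 i : 'rV[R]_n).
Local Notation mu := (lebesgue_rV n : {measure set 'rV[R]_n -> \bar R}).
Local Notation B := (@eball R n).

(** Equality of [f] and [f'] is only a.e., because in an iteration [f] is itself a representative
    picked by [xget]. The classical derivative shows that the set of candidates is nonempty, and
    uniqueness compares it with the one picked. *)
Lemma wpderiv_sym N d (m : nat) i (f f' : 'rV[R]_n -> R) :
  measurable_fun B f -> {ae mu, forall x, B x -> f x = f' x} ->
  sym N.+1 d (fun _ : unit => f') -> d + 1 + (d + 1) <= m%:Z -> d + 1 <= m%:Z -> (m < n)%N ->
  measurable_fun B (wpderiv i f) /\
  {ae mu, forall x, B x -> wpderiv i f x = 'D_(ei i) f' x}.
Proof.
move=> mf ff' sf dm dm' mn.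
have sDf := sym_derive _ i sf.
have L2D : L2_ball ('D_(ei i) f') := sym_L2_ball tt dm mn sDf.
have wD : weak_deriv [:: i] f ('D_(ei i) f').
  apply: weak_deriv_ae ff' _ => //.
    by apply: measurable_funTS; exact: (sym_measurable tt sf).
  by apply: (@sym_weak_deriv R p 0 d m [:: i]) => //; exact: symW sf.
have [L2w ww] : [set g | L2_ball g /\ weak_deriv [:: i] f g] (wpderiv i f).
  by apply: xgetPex; exists ('D_(ei i) f').
split; first by case: L2w.
exact: weak_deriv_unique ww wD.
Qed.

Definition lap (f : 'rV[R]_n -> R) : 'rV[R]_n -> R :=
  fun x => \sum_i 'D_(ei i) ('D_(ei i) f) x.

Lemma sym_lap T N d (f : T -> 'rV[R]_n -> R) :
  sym N.+2 d f -> sym N (d + 2) (fun t => lap (f t)).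
Proof.
move=> sf; apply: sym_sum => i.
by have := sym_derive _ i (sym_derive _ i sf); rewrite -addrA.
Qed.

Lemma wlaplacian_sym N d (m : nat) (f f' : 'rV[R]_n -> R) :
  measurable_fun B f -> {ae mu, forall x, B x -> f x = f' x} ->
  sym N.+2 d (fun _ : unit => f') -> 0 <= d -> d + 2 + (d + 2) <= m%:Z -> (m < n)%N ->
  measurable_fun B (wlaplacian f) /\
  {ae mu, forall x, B x -> wlaplacian f x = lap f' x}.
Proof.
move=> mf ff' sf d0 dm mn.
have H i : measurable_fun B (wpderiv i (wpderiv i f)) /\
  {ae mu, forall x, B x -> wpderiv i (wpderiv i f) x = 'D_(ei i) ('D_(ei i) f') x}.
  have [||m1 a1] := @wpderiv_sym N.+1 d m i f f' mf ff' sf _ _ mn; try lia.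
  by apply: (@wpderiv_sym N (d + 1) m i _ _ m1 a1 (sym_derive _ i sf)) => //; lia.
split; first by apply: measurable_sum => i; have [] := H i.
have : {ae mu, forall x, forall i, B x -> wpderiv i (wpderiv i f) x = 'D_(ei i) ('D_(ei i) f') x}.
  by apply: filter_forall => i; have [] := H i.
by apply: filterS => x h Bx; apply: eq_bigr => i _; exact: h.
Qed.

Lemma iter_lap_sym T N l d (f : T -> 'rV[R]_n -> R) :
  sym (N + 2 * l) d f -> sym N (d + (2 * l)%:Z) (fun t => iter l lap (f t)).
Proof.
elim: l N d => [|l IH] N d; first by rewrite muln0 addn0 addr0.
move=> sf; have := IH N.+2 d; rewrite (_ : N.+2 + 2 * l = N + 2 * l.+1)%N; last by lia.
move=> /(_ sf) /sym_lap; rewrite (_ : d + (2 * l)%:Z + 2 = d + (2 * l.+1)%:Z)//; lia.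
Qed.

Lemma iter_wlaplacian_sym N l (m : nat) (f : 'rV[R]_n -> R) :
  sym (N + 2 * l) 0 (fun _ : unit => f) -> (2 * l + 2 * l <= m)%N -> (m < n)%N ->
  measurable_fun B (iter l (@wlaplacian R n) f) /\
  {ae mu, forall x, B x -> iter l (@wlaplacian R n) f x = iter l lap f x}.
Proof.
elim: l N => [|l IH] N sf lm mn.
  by split; [apply: measurable_funTS; exact: (sym_measurable tt sf)|exact: aeW].
have sf2 : sym (N.+2 + 2 * l) 0 (fun _ : unit => f).
  by rewrite (_ : N.+2 + 2 * l = N + 2 * l.+1)%N //; lia.
have [|m1 a1] := IH N.+2 sf2 _ mn; first by lia.
by apply: (@wlaplacian_sym N (0 + (2 * l)%:Z) m _ _ m1 a1 (iter_lap_sym sf2)) => //; lia.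
Qed.

Definition energy_density q (k : nat) (u : 'rV[R]_n -> 'rV[R]_q) (x : 'rV[R]_n) : R :=
  if odd k then \sum_(j < q) \sum_(i < n) 'D_(ei i) (iter k./2 lap (Defs.coord u j)) x ^+ 2
  else \sum_(j < q) iter k./2 lap (Defs.coord u j) x ^+ 2.

Lemma measurable_energy_density q k (u : 'rV[R]_n -> 'rV[R]_q) :
  (forall j, sym k 0 (fun _ : unit => Defs.coord u j)) ->
  measurable_fun B (energy_density k u).
Proof.
move=> su; rewrite /energy_density; apply: measurable_funTS.
have kE := odd_double_half k; rewrite -mul2n in kE.
case: (odd k) kE => kE.
  apply: measurable_sum => j; apply: measurable_sum => i; apply: measurable_funX.
  have suj : sym (1 + 2 * k./2) 0 (fun _ : unit => Defs.coord u j) by rewrite kE.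
  exact: (sym_measurable tt (sym_derive _ i (iter_lap_sym suj))).
apply: measurable_sum => j; apply: measurable_funX.
have suj : sym (0 + 2 * k./2) 0 (fun _ : unit => Defs.coord u j) by rewrite kE.
exact: (sym_measurable tt (iter_lap_sym suj)).
Qed.

(** Finitely many weak derivatives occur, so the null sets on which they differ from the classical
    ones have a null union. *)
Lemma ext_energy_sym q k (u : 'rV[R]_n -> 'rV[R]_q) : (2 * k < n)%N ->
  (forall j, sym k 0 (fun _ : unit => Defs.coord u j)) ->
  ext_energy k u = \int[mu]_(x in B) energy_density k u x.
Proof.
move=> kn su; rewrite /ext_energy /energy_density.
have kE := odd_double_half k; rewrite -mul2n in kE.
case: (boolP (odd k)) kE => ok /= kE.
- have H j i : measurable_fun B (wpderiv i (iter k./2 (@wlaplacian R n) (Defs.coord u j))) /\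
    {ae mu, forall x, B x -> wpderiv i (iter k./2 (@wlaplacian R n) (Defs.coord u j)) x =
      'D_(ei i) (iter k./2 lap (Defs.coord u j)) x}.
    have suj : sym (1 + 2 * k./2) 0 (fun _ : unit => Defs.coord u j) by rewrite kE.
    have [|m1 a1] := iter_wlaplacian_sym suj _ kn; first by lia.
    by apply: (@wpderiv_sym 0 (0 + (2 * k./2)%:Z) (2 * k) i _ _ m1 a1 (iter_lap_sym suj)) => //; lia.
  apply: ae_eq_Rintegral.
  + by apply: measurable_sum => j; apply: measurable_sum => i; apply: measurable_funX; have [] := H j i.
  + by have := measurable_energy_density su; rewrite /energy_density ok.
  have : {ae mu, forall x, forall j i, B x -> wpderiv i (iter k./2 (@wlaplacian R n) (Defs.coord u j)) x =
      'D_(ei i) (iter k./2 lap (Defs.coord u j)) x}.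
    by apply: filter_forall => j; apply: filter_forall => i; have [] := H j i.
  apply: filterS => x h Bx; apply: eq_bigr => j _; apply: eq_bigr => i _.
  by rewrite h.
- have H j : measurable_fun B (iter k./2 (@wlaplacian R n) (Defs.coord u j)) /\
    {ae mu, forall x, B x -> iter k./2 (@wlaplacian R n) (Defs.coord u j) x =
      iter k./2 lap (Defs.coord u j) x}.
    have suj : sym (0 + 2 * k./2) 0 (fun _ : unit => Defs.coord u j) by rewrite kE.
    by apply: (iter_wlaplacian_sym suj _ kn); lia.
  apply: ae_eq_Rintegral.
  + by apply: measurable_sum => j; apply: measurable_funX; have [] := H j.
  + by have := measurable_energy_density su; rewrite /energy_density (negPf ok).
  have : {ae mu, forall x, forall j, B x -> iter k./2 (@wlaplacian R n) (Defs.coord u j) x =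
      iter k./2 lap (Defs.coord u j) x}.
    by apply: filter_forall => j; have [] := H j.
  apply: filterS => x h Bx; apply: eq_bigr => j _.
  by rewrite h.
Qed.

End weak_laplacian.

(** * Green's formula and the energy of the variations *)

Section green.
Context {R : realType} {p : nat}.
Local Notation n := p.+2.
Local Notation ei i := (delta_mx ord0 i : 'rV[R]_n).
Local Notation mu := (lebesgue_rV n : {measure set 'rV[R]_n -> \bar R}).
Local Notation B := (@eball R n).
Implicit Types f g : 'rV[R]_n -> R.

Lemma derive_off0 f g i : (forall x, x != 0 -> f x = g x) ->
  forall x, x != 0 -> 'D_(ei i) f x = 'D_(ei i) g x.
Proof.
move=> fg x x0; apply: near_eq_derive.
exact: (near_eq_in (@open_neq0 R n) fg x0).
Qed.

Lemma lap_off0 f g : (forall x, x != 0 -> f x = g x) ->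
  forall x, x != 0 -> lap f x = lap g x.
Proof.
move=> fg x x0; apply: eq_bigr => i _.
by apply: derive_off0 x0; exact: derive_off0.
Qed.

Lemma lapD_off0 N d f g c : sym N.+2 d (fun _ : unit => f) ->
  sym N.+2 d (fun _ : unit => g) ->
  forall x, x != 0 -> lap (fun x => f x + c * g x) x = lap f x + c * lap g x.
Proof.
move=> sf sg x x0.
have D1 i y : y != 0 ->
    'D_(ei i) (fun x => f x + c * g x) y = 'D_(ei i) f y + c * 'D_(ei i) g y.
  move=> y0; have df := sym_derivable i tt sf y0; have dg := sym_derivable i tt sg y0.
  rewrite (deriveD df (derivableM (derivable_cst c _ _) dg)).
  by rewrite (deriveM (derivable_cst c _ _) dg) derive_cst scaler0 addr0.
rewrite /lap mulr_sumr -big_split/=; apply: eq_bigr => i _.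
rewrite (derive_off0 i (D1 i) x0).
have df := sym_derivable i tt (sym_derive _ i sf) x0.
have dg := sym_derivable i tt (sym_derive _ i sg) x0.
rewrite (deriveD df (derivableM (derivable_cst c _ _) dg)).
by rewrite (deriveM (derivable_cst c _ _) dg) derive_cst scaler0 addr0.
Qed.

Lemma iter_lapD_off0 N l d f g c : sym (N + 2 * l) d (fun _ : unit => f) ->
  sym (N + 2 * l) d (fun _ : unit => g) ->
  forall x, x != 0 ->
  iter l lap (fun x => f x + c * g x) x = iter l lap f x + c * iter l lap g x.
Proof.
elim: l N => [//|l IH] N sf sg x x0.
have E : (N + 2 * l.+1 = N.+2 + 2 * l)%N by lia.
rewrite E in sf sg; rewrite !iterS (lap_off0 (IH N.+2 sf sg) x0).
exact: lapD_off0 (iter_lap_sym sf) (iter_lap_sym sg) x x0.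
Qed.

Lemma derive_supp_in (K : set 'rV[R]_n) g i : closed K -> (forall x, ~ K x -> g x = 0) ->
  forall x, ~ K x -> 'D_(ei i) g x = 0.
Proof.
move=> cK g0 x Kx; suff /near_eq_derive -> : \forall y \near x, g y = cst 0 y.
  by rewrite derive_cst.
suff : \forall y \near x, (~` K) y by apply: filterS => y; exact: g0.
by apply: open_nbhs_nbhs; split=> //; exact: closed_openC.
Qed.

Lemma lap_supp_in (K : set 'rV[R]_n) g : closed K -> (forall x, ~ K x -> g x = 0) ->
  forall x, ~ K x -> lap g x = 0.
Proof.
move=> cK g0 x Kx; rewrite /lap big1// => i _.
exact: (derive_supp_in i cK (derive_supp_in i cK g0) Kx).
Qed.

Lemma iter_lap_supp_in (K : set 'rV[R]_n) l g : closed K -> (forall x, ~ K x -> g x = 0) ->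
  forall x, ~ K x -> iter l lap g x = 0.
Proof. by move=> cK g0; elim: l => [//|l IH]; exact: lap_supp_in. Qed.

Variable (K : set 'rV[R]_n).
Hypotheses (cK : closed K) (KB : K `<=` B).

Lemma Rintegral_sum (I : Type) (s : seq I) (F : I -> 'rV[R]_n -> R) :
  (forall i, mu.-integrable B (EFin \o F i)) ->
  \int[mu]_(x in B) (\sum_(i <- s) F i x) = \sum_(i <- s) \int[mu]_(x in B) F i x.
Proof.
move=> iF; have mB : measurable B := @measurable_eball R n.
elim: s => [|i s IH].
  by under eq_Rintegral do rewrite big_nil; rewrite big_nil Rintegral_cst// mul0r.
under eq_Rintegral do rewrite big_cons.
rewrite big_cons RintegralD// ?IH//.
rewrite (_ : _ \o _ = (fun x => \sum_(i <- s) (F i x)%:E)%E).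
  by apply: integrable_sum => // j _; exact: iF.
by apply/funext => x; rewrite /= sumEFin.
Qed.

Lemma integral_lapl f g N M d e (m : nat) : sym N.+2 d (fun _ : unit => f) ->
  sym M.+1 e (fun _ : unit => g) -> d + e + 2 <= m%:Z -> (m < n)%N ->
  (forall x, ~ K x -> g x = 0) ->
  \int[mu]_(x in B) (lap f x * g x) =
  - \sum_i \int[mu]_(x in B) ('D_(ei i) f x * 'D_(ei i) g x).
Proof.
move=> sf sg dm mn g0.
have sDf i := sym_derive _ i sf.
rewrite (eq_bigr (fun i => - \int[mu]_(x in B) ('D_(ei i) ('D_(ei i) f) x * g x))); last first.
  move=> i _; apply: (integral_by_parts i (sDf i) sg _ mn cK KB g0); lia.
rewrite sumrN opprK -Rintegral_sum.
  by apply: eq_Rintegral => x _; rewrite /lap mulr_suml.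
move=> i.
apply: (@sym_integrable _ _ unit 0 (d + e + 2) m (fun _ x => 'D_(ei i) ('D_(ei i) f) x * g x)) => //.
have := symM (symW (leq0n _) (sym_derive _ i (sDf i))) (symW (leq0n _) sg).
rewrite (_ : d + 1 + 1 + e = d + e + 2)//; lia.
Qed.

Lemma integral_lapr f g N M d e (m : nat) : sym N.+1 d (fun _ : unit => f) ->
  sym M.+2 e (fun _ : unit => g) -> d + e + 2 <= m%:Z -> (m < n)%N ->
  (forall x, ~ K x -> g x = 0) ->
  \int[mu]_(x in B) (f x * lap g x) =
  - \sum_i \int[mu]_(x in B) ('D_(ei i) f x * 'D_(ei i) g x).
Proof.
move=> sf sg dm mn g0.
have sDg i := sym_derive _ i sg.
rewrite -sumrN (eq_bigr (fun i => \int[mu]_(x in B) (f x * 'D_(ei i) ('D_(ei i) g) x))); last first.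
  move=> i _; apply/esym; apply: (integral_by_parts i sf (sDg i) _ mn cK KB); first lia.
  exact: derive_supp_in.
rewrite -Rintegral_sum.
  by apply: eq_Rintegral => x _; rewrite /lap mulr_sumr.
move=> i.
apply: (@sym_integrable _ _ unit 0 (d + e + 2) m (fun _ x => f x * 'D_(ei i) ('D_(ei i) g) x)) => //.
have := symM (symW (leq0n _) sf) (symW (leq0n _) (sym_derive _ i (sDg i))).
rewrite (_ : d + (e + 1 + 1) = d + e + 2)//; lia.
Qed.

(** One Laplacian at a time passes from [g] to [f] through the common value
    [- sum_i int D_i f * D_i g] of the two Green formulas; [K] contains the support of [g] and of
    its iterated Laplacians. *)
Lemma integral_iter_lap f g l N M d e (m : nat) : sym (N + 2 * l) d (fun _ : unit => f) ->
  sym (M + 2 * l) e (fun _ : unit => g) -> d + e + (2 * l)%:Z <= m%:Z -> (m < n)%N ->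
  (forall x, ~ K x -> g x = 0) ->
  \int[mu]_(x in B) (f x * iter l lap g x) = \int[mu]_(x in B) (iter l lap f x * g x).
Proof.
elim: l N M d f => [//|l IH] N M d f sf sg dm mn g0.
have sf' : sym (N.+2 + 2 * l) d (fun _ : unit => f) by rewrite (_ : N.+2 + _ = N + 2 * l.+1)%N//; lia.
have sg' : sym (M.+2 + 2 * l) e (fun _ : unit => g) by rewrite (_ : M.+2 + _ = M + 2 * l.+1)%N//; lia.
have sfl : sym (N + 2 * l).+2 d (fun _ : unit => f) by rewrite (_ : (N + 2 * l).+2 = N + 2 * l.+1)%N//; lia.
have slg := iter_lap_sym sg'.
have sfl1 := symW (leqnSn _) sfl; have slg1 := symW (leqnSn _) slg.
have dm' : d + (e + (2 * l)%:Z) + 2 <= m%:Z by lia.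
have gl0 := iter_lap_supp_in l cK g0.
apply: eq_trans (integral_lapr sfl1 slg dm' mn gl0) _.
rewrite -(integral_lapl sfl slg1 dm' mn gl0).
by rewrite (IH N M.+2 _ _ (sym_lap sfl) sg' _ mn g0) ?iterSr//; lia.
Qed.

End green.

(** * The equator map and its iterated Laplacians *)

Section equator_map.
Context {R : realType} {n : nat}.
Local Notation ei i := (delta_mx ord0 i : 'rV[R]_n).

Lemma coord_equatorl i :
  Defs.coord (@equator R n) (lshift 1 i) = fun x => x ord0 i * (enorm x)^-1.
Proof.
by apply/funext => x; rewrite /Defs.coord /equator row_mxEl mxE mulrC.
Qed.

Lemma coord_equatorr (i : 'I_1) : Defs.coord (@equator R n) (rshift n i) = fun=> 0.
Proof. by apply/funext => x; rewrite /Defs.coord /equator row_mxEr mxE. Qed.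

Lemma sym_equator T N j : sym N 0 (fun _ : T => Defs.coord (@equator R n) j).
Proof.
have [i ->|i ->] := split_ordP j; last by rewrite coord_equatorr; exact: sym0.
by rewrite coord_equatorl; have := symM (sym_coor N i) (sym_enormV N); rewrite addNr.
Qed.

Lemma sum_equator_sqr x : x != 0 -> \sum_j Defs.coord (@equator R n) j x ^+ 2 = 1.
Proof.
move=> x0; rewrite big_split_ord/= [X in _ + X]big1 ?addr0; last first.
  by move=> i _; rewrite coord_equatorr expr0n.
rewrite (eq_bigr (fun i => x ord0 i ^+ 2 * (enorm x) ^- 2)); last first.
  by move=> i _; rewrite coord_equatorl exprMn exprVn.
by rewrite -mulr_suml -enorm_sqr divff// expf_neq0// enorm_eq0.
Qed.

Lemma enorm_equator x : x != 0 -> enorm (@equator R n x) = 1.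
Proof.
move=> x0; rewrite /enorm -[RHS]sqrtr1; congr Num.sqrt.
by rewrite -(sum_equator_sqr x0).
Qed.

Lemma is_derive_enormVX m a (x : 'rV[R]_n) : x != 0 ->
  is_derive x (ei a) (fun y => (enorm y)^-1 ^+ m)
    (- (m%:R * (x ord0 a * (enorm x)^-1 ^+ m.+2))).
Proof.
move=> x0.
rewrite (_ : (fun y => _) = (fun y : 'rV[R]_n => (enorm y)^-1) ^+ m); last first.
  by apply/funext => y; rewrite exprfctE.
apply: (is_derive_eq (is_deriveX m (is_derive_enormV a x0))).
case: m => [|m]; first by rewrite !mul0r scale0r oppr0.
by rewrite /GRing.scale/= mulrN -mulrA !exprS; congr (- (_ * _)); ring.
Qed.

Lemma is_derive_coor_enormV m i a (x : 'rV[R]_n) : x != 0 ->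
  is_derive x (ei a) (fun y => y ord0 i * (enorm y)^-1 ^+ m)
    ((i == a)%:R * (enorm x)^-1 ^+ m - m%:R * (x ord0 i * x ord0 a * (enorm x)^-1 ^+ m.+2)).
Proof.
move=> x0; apply: (is_derive_eq (is_deriveM (is_derive_coor x (ei a) i)
  (is_derive_enormVX m a x0))).
by rewrite mxE eqxx/= /GRing.scale/=; ring.
Qed.

(** Each Laplacian multiplies [x_i |x|^-m] by [m (m - n) |x|^-2]; starting from m = 1 the exponent
    runs through the odd numbers 2q + 1. *)
Definition lap_coef l : R := \prod_(0 <= q < l) ((2 * q + 1)%:R * ((2 * q + 1)%:R - n%:R)).

End equator_map.

Section equator_laplacian.
Context {R : realType} {p : nat}.
Local Notation n := p.+2.
Local Notation ei i := (delta_mx ord0 i : 'rV[R]_n).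

Lemma lap_coor_enormV m i (x : 'rV[R]_n) : x != 0 ->
  lap (fun y => y ord0 i * (enorm y)^-1 ^+ m) x =
  m%:R * (m%:R - n%:R) * (x ord0 i * (enorm x)^-1 ^+ m.+2).
Proof.
move=> x0; rewrite /lap.
set r := (enorm x)^-1.
have H a : 'D_(ei a) ('D_(ei a) (fun y : 'rV[R]_n => y ord0 i * (enorm y)^-1 ^+ m)) x =
    - (2 * m%:R) * ((i == a)%:R * x ord0 a) * r ^+ m.+2 - m%:R * x ord0 i * r ^+ m.+2 +
    m%:R * (m.+2)%:R * x ord0 i * (x ord0 a ^+ 2) * r ^+ m.+4.
  (* The Kronecker symbol becomes an opaque scalar subject only to [b x_i = b x_a], a relation that
     [ring] can use. *)
  have [b bE] : exists b : R, b = (i == a)%:R by exists (i == a)%:R.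
  have bx : b * x ord0 i = b * x ord0 a.
    by rewrite bE; case: eqVneq => [->//|_]; rewrite !mul0r.
  rewrite -bE (@derive_off0 _ _ _ (fun y => b * (enorm y)^-1 ^+ m -
    m%:R * (y ord0 i * (y ord0 a * (enorm y)^-1 ^+ m.+2))) _ _ _ x0); last first.
    by move=> y y0; have [_ ->] := is_derive_coor_enormV m i a y0; rewrite -!mulrA bE.
  have [d1 e1] := is_derive_enormVX m a x0.
  have [d2 e2] := is_derive_coor_enormV m.+2 a a x0.
  have [d3 e3] := is_derive_coor x (ei a) i.
  have e3' : 'D_(ei a) (fun y : 'rV[R]_n => y ord0 i) x = b by rewrite e3 mxE eqxx bE.
  have dc (c : R) := derivable_cst c x (ei a).
  have d23 := derivableM d3 d2.
  rewrite (deriveB (derivableM (dc b) d1) (derivableM (dc m%:R) d23)).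
  rewrite (deriveM (dc b) d1) (deriveM (dc m%:R) d23) (deriveM d3 d2) /cst.
  rewrite !derive_cst !scaler0 e1 e2 e3' eqxx mulr1n -/r !exprS expr0 -[m.+2]addn2 natrD.
  move: (r ^+ m) (m%:R : R) => rm M.
  rewrite /GRing.scale/=; ring: bx.
rewrite (eq_bigr _ (fun a _ => H a)) !big_split/= sumr_const card_ord.
rewrite -!mulr_suml -!mulr_sumr (bigD1 i)//= big1 ?addr0; last first.
  by move=> a /negPf; rewrite eq_sym => ->; rewrite mul0r.
rewrite eqxx mul1r -enorm_sqr.
have -> : enorm x ^+ 2 = r ^- 2 by rewrite /r exprVn invrK.
have E : r ^- 2 * r ^+ m.+4 = r ^+ m.+2.
  by rewrite !exprS; field; rewrite /r invr_eq0 enorm_eq0.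
rewrite -[X in _ + X = _]mulrA E -[_ *+ n]mulr_natr; move: (r ^+ m.+2) (n%:R : R) => rm N.
rewrite -[m.+2]addn2 natrD; move: (m%:R : R) => M.
ring.
Qed.

Lemma iter_lap_equator l i (x : 'rV[R]_n) : x != 0 ->
  iter l lap (fun y => y ord0 i * (enorm y)^-1) x =
  @lap_coef R n l * (x ord0 i * (enorm x)^-1 ^+ (2 * l + 1)).
Proof.
elim: l x => [|l IH] x x0; first by rewrite /lap_coef big_nil mul1r.
rewrite iterS (lap_off0 (g := fun x => @lap_coef R n l * (x ord0 i * (enorm x)^-1 ^+ (2 * l + 1))) IH x0).
have sg : sym 2 (- 1 + (2 * l + 1)%:Z)
    (fun (_ : unit) (y : 'rV[R]_n) => y ord0 i * (enorm y)^-1 ^+ (2 * l + 1)).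
  apply: symM; first exact: sym_coor.
  elim: (2 * l + 1)%N => [|q IHq].
    by apply: sym_ext (sym_cst _ 1) => t y _; rewrite expr0.
  have := symM IHq (sym_enormV 2); rewrite -PoszD addn1; apply: sym_ext => t y _.
  by rewrite exprSr.
(* Compatibility of [lap] with scalars is read off from its additivity, with the zero function as
   first summand. *)
have := lapD_off0 (@lap_coef R n l) (sym0 2 _) sg x0.
rewrite (_ : (fun x : 'rV[R]_n => 0 + _) =
    (fun x : 'rV[R]_n => @lap_coef R n l * (x ord0 i * (enorm x)^-1 ^+ (2 * l + 1)))); last first.
  by apply/funext => y; rewrite add0r.
move=> ->; rewrite lap_coor_enormV//.
have -> : lap (fun=> 0 : R) x = 0.
  apply: big1 => a _; rewrite (_ : 'D_(ei a) (fun=> 0) = cst 0); first exact: derive_cst.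
  by apply/funext => y; exact: derive_cst.
rewrite add0r.
rewrite [in RHS]/lap_coef big_nat_recr//= -/(lap_coef l).
rewrite (_ : (2 * l + 1).+2 = 2 * l.+1 + 1)%N; last by lia.
by rewrite !mulrA.
Qed.

End equator_laplacian.

(** * The variations as [u + t w] *)

Section variation_expansion.
Context {R : realType} {n : nat}.
Variable phi : 'rV[R]_n -> 'rV[R]_(n + 1).
Hypothesis tphi : forall j, test_fun (Defs.coord phi j).
Local Notation u := (Defs.coord (@equator R n)).
Local Notation P := (Defs.coord phi).

Lemma symM0 T N (f g : T -> 'rV[R]_n -> R) :
  sym N 0 f -> sym N 0 g -> sym N 0 (fun t x => f t x * g t x).
Proof. by move=> sf sg; have := symM sf sg; rewrite addr0. Qed.

(* With [q = |u + t phi|^2 = 1 + t p] one has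
   [1/sqrt q - 1 = - t p / (sqrt q (1 + sqrt q))], so that the quotient [w] has no
   singularity at [t = 0]. *)
Lemma variation_expansion : exists (delta : R) (K : set 'rV[R]_n)
    (w : 'I_(n + 1) -> {t : R | `|t| < delta} -> 'rV[R]_n -> R),
  [/\ 0 < delta, closed K /\ K `<=` @eball R n,
      forall N j, sym N 0 (w j),
      forall j t x, ~ K x -> w j t x = 0 &
      forall t x, x != 0 ->
        enorm (Defs.variation (@equator R n) phi (val t) x) = 1 /\
        forall j, Defs.coord (Defs.variation (@equator R n) phi (val t)) j x =
          u j x + val t * w j t x].
Proof.
have /choice[M M0] : forall j, exists M, 0 <= M /\ forall x, `|P j x| <= M.
  by move=> j; have [M M0 PM] := test_fun_bounded (tphi j); exists M.
(* [C0] bounds |p| for |t| <= 1, since |u_j| <= 1. The radius [delta = 1 / (2 C0 + 2)] gives both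
   |t| <= 1 and |t p| <= 1/2, which keeps [q] between 1/2 and 3/2 and hence away from the
   singularity of the square root. *)
pose C0 := \sum_j (2 * M j + M j ^+ 2).
have C00 : 0 <= C0.
  by apply: sumr_ge0 => j _; have [Mj _] := M0 j; rewrite addr_ge0 ?mulr_ge0 ?sqr_ge0.
pose delta := (2 * C0 + 2)^-1.
have d0 : 0 < delta by rewrite invr_gt0; lra.
pose T := {t : R | `|t| < delta}.
pose pt (t : T) x := \sum_j (2 * u j x * P j x + val t * P j x ^+ 2).
pose q (t : T) x := 1 + val t * pt t x.
have t1 (t : T) : `|val t| <= 1.
  have /ltW /le_trans := valP t; apply; rewrite /delta invf_le1; lra.
have u1 j x : `|u j x| <= 1.
  have [->|x0] := eqVneq x 0.
    have [i ->|i ->] := split_ordP j; last by rewrite coord_equatorr normr0.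
    by rewrite coord_equatorl mxE mul0r normr0.
  rewrite -(@ler_pXn2r _ 2)// ?nnegrE// expr1n real_normK ?num_real//.
  rewrite -(sum_equator_sqr x0) (bigD1 j)//= lerDl sumr_ge0// => i _; exact: sqr_ge0.
have ptC t x : `|pt t x| <= C0.
  rewrite (le_trans (ler_norm_sum _ _ _))// ler_sum// => j _.
  have [Mj PM] := M0 j; rewrite (le_trans (ler_normD _ _))// lerD//.
    rewrite !normrM ger0_norm// -mulrA ler_pM2l//.
    by rewrite -[leRHS]mul1r ler_pM.
  rewrite normrM normrX -[leRHS]mul1r ler_pM// lerXn2r// nnegrE.
have tptC t x : `|val t * pt t x| <= 2^-1.
  rewrite normrM (@le_trans _ _ (delta * C0))//.
    by rewrite ler_pM// ltW// (valP t).
  rewrite /delta mulrC ler_pdivrMr; lra.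
have q12 t x : 2^-1 <= q t x <= 3 / 2.
  by have := tptC t x; rewrite ler_norml /q => /andP[h1 h2]; lra.
have sU N j : sym N 0 (fun _ : T => u j) by exact: sym_equator.
have sP N j : sym N 0 (fun _ : T => P j) by apply: test_fun_sym => //; left.
have st N : sym N 0 (fun (t : T) (_ : 'rV[R]_n) => val t) by exact: sym_tcst t1.
have spt N : sym N 0 pt.
  apply: sym_sum => j; apply: symD.
    by apply: symM0 => //; exact: symZ.
  by apply: symM0 => //; have := symM0 (sP N j) (sP N j).
have sq N : sym N 0 q.
  by apply: symD; [exact: sym_cst|exact: symM0].
have q0 t x : 0 < q t x by have /andP[h _] := q12 t x; lra.
have ss N : sym N 0 (fun t x => Num.sqrt (q t x)).
  have := sym_powR 2^-1 _ (fun t x _ => q12 t x) (sq N); move=> /(_ ltac:(lra)).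
  by apply: sym_ext => t x _; rewrite powR12_sqrt// ltW.
have srho N : sym N 0 (fun t x => (Num.sqrt (q t x))^-1).
  have := sym_powR (- 2^-1) _ (fun t x _ => q12 t x) (sq N); move=> /(_ ltac:(lra)).
  by apply: sym_ext => t x _; rewrite powRN powR12_sqrt// ltW.
have s2 t x : 0 <= Num.sqrt (q t x) <= 2.
  rewrite sqrtr_ge0/= -[2]ger0_norm// -sqrtr_sqr ler_sqrt//.
  have /andP[_ h] := q12 t x; lra.
have ssig N : sym N 0 (fun t x => (1 + Num.sqrt (q t x))^-1).
  have s13 t x : x != 0 -> 1 <= 1 + Num.sqrt (q t x) <= 3.
    by move=> _; have /andP[h1 h2] := s2 t x; lra.
  have := sym_powR (-1) ltr01 s13 (symD (sym_cst N 1) (ss N)).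
  by apply: sym_ext => t x x0; rewrite powR_inv1//; have /andP[] := s13 t x x0; lra.
pose w j (t : T) x := P j x * (Num.sqrt (q t x))^-1 -
  u j x * (pt t x * ((Num.sqrt (q t x))^-1 * (1 + Num.sqrt (q t x))^-1)).
pose K := \bigcup_(j in [set: 'I_(n + 1)]) closure [set x | P j x != 0].
have PK j x : ~ K x -> P j x = 0.
  move=> Kx; apply/eqP/negPn/negP => Px; apply: Kx; exists j => //.
  exact: subset_closure.
exists delta, K, w; split=> //.
- split; first by apply: closed_bigcup => [|j _]; [exact: finite_finset|exact: closed_closure].
  by apply: bigcup_sub => j _; have [_ _] := tphi j.
- by move=> N j; apply: symB; apply: symM0 => //; apply: symM0 => //; exact: symM0.
- move=> j t x Kx; rewrite /w PK// (_ : pt t x = 0) ?mul0r ?mulr0 ?subr0//.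
  by apply: big1 => i _; rewrite PK// mulr0 expr0n mulr0 addr0.
move=> t x x0.
have E2 : \sum_j (u j x + val t * P j x) ^+ 2 = q t x.
  rewrite /q /pt mulr_sumr -[X in _ = X + _](sum_equator_sqr x0) -big_split/=.
  by apply: eq_bigr => j _; ring.
have mE j : (@equator R n x + val t *: phi x) ord0 j = u j x + val t * P j x.
  by rewrite /Defs.coord mxE [X in _ + X]mxE.
have E : enorm (@equator R n x + val t *: phi x) = Num.sqrt (q t x).
  by rewrite -E2; congr Num.sqrt; apply: eq_bigr => j _; rewrite mE.
have s0 : 0 < Num.sqrt (q t x) by rewrite sqrtr_gt0.
split.
  rewrite /Defs.variation /sphere_proj enormZ E ger0_norm ?invr_ge0 ?sqrtr_ge0//.
  by rewrite mulVf// gt_eqF.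
move=> j; rewrite {1}/Defs.coord /Defs.variation /sphere_proj mxE E mE /w.
have qE : Num.sqrt (q t x) ^+ 2 = 1 + val t * pt t x by rewrite sqr_sqrtr// ltW.
move: s0 qE; move: (Num.sqrt (q t x)) => s s0 qE.
have tp : val t * pt t x = s ^+ 2 - 1 by rewrite qE; ring.
transitivity (s^-1 * u j x + val t * (P j x * s^-1)); first by ring.
transitivity (u j x + val t * (P j x * s^-1) - (val t * pt t x) * u j x * (s^-1 * (1 + s)^-1)); last by ring.
by rewrite tp; field; rewrite !gt_eqF// ltr_wpDl.
Qed.

End variation_expansion.

(** * The second-order estimate for the energy *)

Section energy_variation.
Context {R : realType} {p : nat}.
Local Notation n := p.+2.
Local Notation ei i := (delta_mx ord0 i : 'rV[R]_n).
Local Notation mu := (lebesgue_rV n : {measure set 'rV[R]_n -> \bar R}).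
Local Notation B := (@eball R n).

(* The components of the differential operator of order [k] whose squared norm
   is the energy density; in the even case there is only one of them. *)
Definition kgrad k (i : 'I_n) (f : 'rV[R]_n -> R) : 'rV[R]_n -> R :=
  if odd k then 'D_(ei i) (iter k./2 lap f)
  else if i == ord0 then iter k./2 lap f else fun=> 0.

Lemma energy_densityE q k (u : 'rV[R]_n -> 'rV[R]_q) x :
  energy_density k u x = \sum_j \sum_i kgrad k i (Defs.coord u j) x ^+ 2.
Proof.
rewrite /energy_density /kgrad; case: ifPn => // _; apply: eq_bigr => j _.
rewrite (bigD1 ord0)//= big1 ?addr0// => i /negPf ->.
by rewrite expr0n.
Qed.

Lemma sym_kgrad T N k d i (f : T -> 'rV[R]_n -> R) :
  sym (N + k) d f -> sym N (d + k%:Z) (fun t => kgrad k i (f t)).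
Proof.
have kE := odd_double_half k; rewrite -mul2n in kE; rewrite /kgrad.
move: (k./2) kE => s; case: (odd k) => kE sf.
  have : sym (N.+1 + 2 * s) d f by rewrite (_ : N.+1 + _ = N + k)%N//; lia.
  move=> /iter_lap_sym /(sym_derive _ i).
  by rewrite (_ : d + (2 * s)%:Z + 1 = d + k%:Z)//; lia.
case: (i == ord0); last exact: sym0.
by rewrite -kE in sf *; exact: iter_lap_sym.
Qed.

Lemma iter_lap_off0 l (f g : 'rV[R]_n -> R) : (forall x, x != 0 -> f x = g x) ->
  forall x, x != 0 -> iter l lap f x = iter l lap g x.
Proof. by move=> fg; elim: l => [//|l IH]; exact: lap_off0. Qed.

Lemma kgrad_off0 k i (f g : 'rV[R]_n -> R) : (forall x, x != 0 -> f x = g x) ->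
  forall x, x != 0 -> kgrad k i f x = kgrad k i g x.
Proof.
move=> fg x x0; have H := iter_lap_off0 k./2 fg.
rewrite /kgrad; case: ifP => _; first exact: derive_off0 x0.
by case: ifP => _ //; exact: H.
Qed.

Lemma kgradD_off0 k i d c (f g : 'rV[R]_n -> R) :
  sym k d (fun _ : unit => f) -> sym k d (fun _ : unit => g) ->
  forall x, x != 0 ->
  kgrad k i (fun x => f x + c * g x) x = kgrad k i f x + c * kgrad k i g x.
Proof.
have kE := odd_double_half k; rewrite -mul2n in kE; rewrite /kgrad.
move: (k./2) kE => s; case: (odd k) => <- sf sg x x0; last first.
  by case: ifP => _; [exact: (iter_lapD_off0 c sf sg x0)|rewrite mulr0 addr0].
rewrite (derive_off0 i (iter_lapD_off0 c sf sg) x0).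
have df := sym_derivable i tt (iter_lap_sym sf) x0.
have dg := sym_derivable i tt (iter_lap_sym sg) x0.
rewrite (deriveD df (derivableM (derivable_cst c _ _) dg)).
by rewrite (deriveM (derivable_cst c _ _) dg) derive_cst scaler0 addr0.
Qed.

(** Only [g] has support in [K], so all derivatives move onto [f], which therefore needs 2k of them.
    In the even case k = 2s the operator Laplacian^s moves without sign; in the odd case one Green
    formula contributes the factor -1. *)
Lemma integral_kgrad (K : set 'rV[R]_n) k (f g : 'rV[R]_n -> R) :
  closed K -> K `<=` B -> (2 * k < n)%N ->
  sym (2 * k) 0 (fun _ : unit => f) -> sym k 0 (fun _ : unit => g) ->
  (forall x, ~ K x -> g x = 0) ->
  \sum_i \int[mu]_(x in B) (kgrad k i f x * kgrad k i g x) =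
  (-1) ^+ k * \int[mu]_(x in B) (iter k lap f x * g x).
Proof.
move=> cK KB kn sf sg g0; have kE := odd_double_half k; rewrite -mul2n in kE.
rewrite -signr_odd /kgrad; move: (k./2) kE => s; case: (odd k) => /= kE; last first.
  rewrite mul1r (bigD1 ord0)//= big1 ?addr0; last first.
    move=> i /negPf ->; transitivity (\int[mu]_(x in B) (0 : R)).
      by apply: eq_Rintegral => x _; rewrite mulr0.
    by rewrite Rintegral_cst ?mul0r//; exact: measurable_eball.
  have sf1 : sym (0 + 2 * s + 2 * s) 0 (fun _ : unit => f) by apply: symW sf; lia.
  have sg1 : sym (0 + 2 * s) 0 (fun _ : unit => g) by apply: symW sg; lia.
  rewrite (integral_iter_lap cK KB (iter_lap_sym sf1) sg1 _ kn g0); last by lia.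
  by rewrite -iterD (_ : s + s = k)%N//; lia.
have sf1 : sym (2 * s + 2 + 2 * s) 0 (fun _ : unit => f) by apply: symW sf; lia.
have sg1 : sym (1 + 2 * s) 0 (fun _ : unit => g) by apply: symW sg; lia.
have sg2 : sym (0 + 2 * s) 0 (fun _ : unit => g) by apply: symW sg; lia.
have sF := iter_lap_sym sf1; rewrite addn2 in sF.
have sF2 : sym (0 + 2 * s) (0 + (2 * s)%:Z + 2) (fun _ : unit => lap (iter s lap f)).
  exact: sym_lap sF.
have gl0 := iter_lap_supp_in s cK g0.
rewrite expr1 mulN1r; apply/eqP; rewrite -eqr_oppLR; apply/eqP.
rewrite -(integral_lapl cK KB sF (iter_lap_sym sg1) _ kn gl0); last by lia.
rewrite (integral_iter_lap cK KB sF2 sg2 _ kn g0); last by lia.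
rewrite -iterS -iterD (_ : s + s.+1 = k)%N//; lia.
Qed.

Lemma Rintegral_off0 N d (f g : 'rV[R]_n -> R) :
  sym N d (fun _ : unit => f) -> (forall x, x != 0 -> f x = g x) ->
  \int[mu]_(x in B) f x = \int[mu]_(x in B) g x.
Proof.
move=> sf fg; have sg : sym N d (fun _ : unit => g) by apply: sym_ext sf => t x; exact: fg.
apply: ae_eq_Rintegral.
- by apply: measurable_funTS; exact: (sym_measurable tt sf).
- by apply: measurable_funTS; exact: (sym_measurable tt sg).
exists [set 0]; split; [exact: measurable_rV_set1|exact: lebesgue_rV_0|].
by move=> x /= h; apply: contrapT => /eqP x0; apply: h => _; exact: fg.
Qed.

Lemma ext_energy_kgrad q k (u : 'rV[R]_n -> 'rV[R]_q) : (2 * k < n)%N ->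
  (forall j, sym k 0 (fun _ : unit => Defs.coord u j)) ->
  ext_energy k u = \sum_j \sum_i \int[mu]_(x in B) kgrad k i (Defs.coord u j) x ^+ 2.
Proof.
move=> kn su; rewrite ext_energy_sym//.
have I j i : mu.-integrable B (EFin \o (fun x => kgrad k i (Defs.coord u j) x ^+ 2)).
  have sk := @sym_kgrad unit 0 k 0 i _ (su j).
  by apply: (sym_integrable tt (m := 2 * k) _ kn (symM sk sk)); lia.
under eq_Rintegral do rewrite energy_densityE.
rewrite Rintegral_sum; last first.
  move=> j; rewrite (_ : _ \o _ = (fun x => \sum_i (kgrad k i (Defs.coord u j) x ^+ 2)%:E)%E).
    by apply: integrable_sum => [|i _]; [exact: measurable_eball|exact: I].
  by apply/funext => x; rewrite /= sumEFin.
by apply: eq_bigr => j _; rewrite Rintegral_sum.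
Qed.

Lemma integral_kgradD_sqr k i (f g : 'rV[R]_n -> R) c : (2 * k < n)%N ->
  sym k 0 (fun _ : unit => f) -> sym k 0 (fun _ : unit => g) ->
  \int[mu]_(x in B) kgrad k i (fun x => f x + c * g x) x ^+ 2 =
  \int[mu]_(x in B) kgrad k i f x ^+ 2 +
  2 * c * \int[mu]_(x in B) (kgrad k i f x * kgrad k i g x) +
  c ^+ 2 * \int[mu]_(x in B) kgrad k i g x ^+ 2.
Proof.
move=> kn sf sg; have mB : measurable B := @measurable_eball R n.
have sF := @sym_kgrad unit 0 k 0 i _ sf; have sG := @sym_kgrad unit 0 k 0 i _ sg.
have sH := @sym_kgrad unit 0 k 0 i _ (symD sf (symZ c sg)).
have d2 : 0 + k%:Z + (0 + k%:Z) <= (2 * k)%:Z by lia.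
have iFF := sym_integrable tt d2 kn (symM sF sF).
have iFG := sym_integrable tt d2 kn (symM sF sG).
have iGG := sym_integrable tt d2 kn (symM sG sG).
rewrite (Rintegral_off0 (symM sH sH) (g := fun x => kgrad k i f x * kgrad k i f x +
  2 * c * (kgrad k i f x * kgrad k i g x) + c ^+ 2 * (kgrad k i g x * kgrad k i g x))).
  rewrite RintegralD// ?RintegralD// ?RintegralZl//.
  - exact: (integrableZl mB (2 * c) iFG).
  - exact: (integrableD mB iFF (integrableZl mB (2 * c) iFG)).
  - exact: (integrableZl mB (c ^+ 2) iGG).
by move=> x x0; rewrite (kgradD_off0 i c sf sg x0); ring.
Qed.

Lemma iter_lap_coord_equator l j (x : 'rV[R]_n) : x != 0 ->
  iter l lap (Defs.coord (@equator R n) j) x =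
  @lap_coef R n l * (Defs.coord (@equator R n) j x * (enorm x)^-1 ^+ (2 * l)).
Proof.
move=> x0; have [i ->|i ->] := split_ordP j; last first.
  rewrite coord_equatorr mul0r mulr0.
  by rewrite (@iter_lap_supp_in _ _ set0 l (fun=> 0))//; exact: closed0.
rewrite coord_equatorl iter_lap_equator// addn1 exprS; ring.
Qed.

Lemma sym_enormVX T N m : sym N m%:Z (fun (_ : T) (x : 'rV[R]_n) => (enorm x)^-1 ^+ m).
Proof.
elim: m => [|m IH]; first by apply: sym_ext (sym_cst _ 1) => t x _; rewrite expr0.
have := symM (sym_enormV N) IH; rewrite -PoszD add1n.
by apply: sym_ext => t x _; rewrite exprS.
Qed.

Lemma ae_off0 (P : set 'rV[R]_n) : (forall x, x != 0 -> P x) -> {ae mu, forall x, P x}.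
Proof.
move=> P0; exists [set 0]; split; [exact: measurable_rV_set1|exact: lebesgue_rV_0|].
by move=> x /= h; apply: contrapT => /eqP x0; apply: h; exact: P0.
Qed.

Lemma is_derive_quadratic (f : R -> R) (delta C : R) : 0 < delta ->
  (forall t, `|t| < delta -> `|f t - f 0| <= C * t ^+ 2) -> is_derive (0 : R) 1 f 0.
Proof.
move=> d0 fC.
have L : h^-1 *: (f (h *: 1 + 0) - f 0) @[h --> (0:R)^'] --> (0 : R).
  apply/cvgr0Pnorm_le => e e0; near=> h.
  have h0 : h != 0 by near: h; exact: nbhs_dnbhs_neq.
  have hd : `|h| < delta by near: h; apply: dnbhs0_lt.
  have he : `|h| <= e / (`|C| + 1) by near: h; apply: dnbhs0_le; rewrite divr_gt0// ltr_wpDl.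
  rewrite /GRing.scale/= mulr1 addr0 normrM normfV.
  rewrite mulrC ler_pdivrMr ?normr_gt0//; apply: (le_trans (fC _ hd)).
  rewrite -(real_normK (num_real h)) expr2 mulrA ler_wpM2r//.
  move: he; rewrite ler_pdivlMr ?ltr_wpDl//; apply: le_trans.
  by rewrite mulrC ler_wpM2l// (le_trans (ler_norm C))// lerDl.
apply: DeriveDef; first by apply/cvg_ex; exists 0.
exact: cvg_lim L.
Unshelve. all: by end_near. Qed.

Lemma equator_sobolev_sphere k : (2 * k < n)%N -> sobolev_sphere k (@equator R n).
Proof.
move=> kn; split; first by apply: sym_sobolev kn _ => j; exact: sym_equator.
by apply: ae_off0 => x x0 _; exact: enorm_equator.
Qed.

Lemma equator_ext_harmonic k : (2 * k < n)%N -> ext_harmonic k (@equator R n).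
Proof.
move=> kn; split; first exact: equator_sobolev_sphere.
move=> phi tphi; have [delta [K [w [d0 [cK KB] sw w0 V]]]] := variation_expansion tphi.
pose T := {t : R | `|t| < delta}; pose u := Defs.coord (@equator R n).
pose v t := Defs.variation (@equator R n) phi t.
have su N j : sym N 0 (fun _ : unit => u j) by exact: sym_equator.
have sw1 (t : T) N j : sym N 0 (fun _ : unit => w j t).
  exact: (@sym_at R n T unit (fun=> t) _ _ _ (sw N j)).
have sv (t : T) N j : sym N 0 (fun _ : unit => Defs.coord (v (val t)) j).
  apply: sym_ext (symD (su N j) (symZ (val t) (sw1 t N j))) => _ x x0.
  by have [_ ->] := V t x x0.
split.
  near=> t; have td : `|t| < delta.
    near: t; apply/nbhs_ballP; exists delta => // s.
    by rewrite /ball/= sub0r normrN.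
  split; first by apply: sym_sobolev kn _ => j; exact: (sv (exist _ t td)).
  by apply: ae_off0 => x x0 _; have [] := V (exist _ t td) x x0.
have mB : measurable B := @measurable_eball R n.
pose rho (x : 'rV[R]_n) := (enorm x)^-1 ^+ (2 * k).
pose Y (t : T) := \sum_j \sum_i \int[mu]_(x in B) kgrad k i (w j t) x ^+ 2.
pose Z (t : T) := \int[mu]_(x in B) (\sum_j w j t x * w j t x * rho x).
pose c := (-1) ^+ k * @lap_coef R n k.
have srho U : sym 0 (2 * k)%:Z (fun (_ : U) => rho) by exact: sym_enormVX.
(* The reparametrization [h] gives two readings: a constant [h] for integrability at a fixed [t],
   and the identity for bounds uniform in [t]. *)
have sQ U (h : U -> T) : sym 0 (2 * k)%:Z
    (fun t x => \sum_j w j (h t) x * w j (h t) x * rho x).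
  have sw' j := sym_at h (sw 0 j).
  by apply: sym_sum => j; have := symM (symM0 (sw' j) (sw' j)) (srho U); rewrite add0r.
(* [Y t] comes from the square of the added part. The term [- c * Z t] is the cross term, after all
   derivatives have been moved onto [u] and the unit length of [u] and [u + t w] has been used. *)
have E (t : T) : ext_energy k (v (val t)) =
    ext_energy k (@equator R n) + val t ^+ 2 * (Y t - c * Z t).
  rewrite (ext_energy_kgrad kn (sv t k)) (ext_energy_kgrad kn (su k)).
  have H j i : \int[mu]_(x in B) kgrad k i (Defs.coord (v (val t)) j) x ^+ 2 =
      \int[mu]_(x in B) kgrad k i (u j) x ^+ 2 +
      2 * val t * \int[mu]_(x in B) (kgrad k i (u j) x * kgrad k i (w j t) x) +
      val t ^+ 2 * \int[mu]_(x in B) kgrad k i (w j t) x ^+ 2.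
    rewrite -(integral_kgradD_sqr i (val t) kn (su k j) (sw1 t k j)).
    have sk := @sym_kgrad unit 0 k 0 i _ (sv t k j).
    apply: (Rintegral_off0 (symM sk sk)) => x x0; rewrite -expr2.
    by rewrite (kgrad_off0 k i (g := fun x => u j x + val t * w j t x))// => y y0; have [_ ->] := V t y y0.
  under eq_bigr do under eq_bigr do rewrite H.
  have -> : \sum_j \sum_i (\int[mu]_(x in B) kgrad k i (u j) x ^+ 2 +
      2 * val t * \int[mu]_(x in B) (kgrad k i (u j) x * kgrad k i (w j t) x) +
      val t ^+ 2 * \int[mu]_(x in B) kgrad k i (w j t) x ^+ 2) =
    \sum_j \sum_i \int[mu]_(x in B) kgrad k i (u j) x ^+ 2 +
    2 * val t * (\sum_j \sum_i \int[mu]_(x in B) (kgrad k i (u j) x * kgrad k i (w j t) x)) +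
    val t ^+ 2 * Y t.
    rewrite !mulr_sumr -!big_split/=; apply: eq_bigr => j _.
    by rewrite !mulr_sumr -!big_split.
  rewrite -addrA; congr (_ + _); rewrite addrC mulrBr; congr (_ + _).
  pose S (x : 'rV[R]_n) := \sum_j u j x * w j t x * rho x.
  have sj j : sym 0 (2 * k)%:Z (fun _ : unit => fun x => u j x * w j t x * rho x).
    by have := symM (symM0 (su 0 j) (sw1 t 0 j)) (srho unit); rewrite add0r.
  have sS : sym 0 (2 * k)%:Z (fun _ : unit => S).
    by apply: sym_sum => j; exact: sj.
  have -> : \sum_j \sum_i \int[mu]_(x in B) (kgrad k i (u j) x * kgrad k i (w j t) x) =
      c * \int[mu]_(x in B) S x.
    rewrite Rintegral_sum; last first.
      by move=> j; exact: (sym_integrable tt (lexx _) kn (sj j)).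
    rewrite mulr_sumr; apply: eq_bigr => j _.
    rewrite (integral_kgrad cK KB kn (su _ j) (sw1 t _ j) (w0 j t)) /c -mulrA; congr (_ * _).
    rewrite -RintegralZl//; last exact: (sym_integrable tt (lexx _) kn (sj j)).
    apply/esym; apply: (Rintegral_off0 (symZ (lap_coef k) (sj j))) => x x0.
    by rewrite iter_lap_coord_equator// -/(u j) /rho; ring.
  have SQ : 2 * val t * \int[mu]_(x in B) S x = - (val t ^+ 2 * Z t).
    rewrite -mulNr -!RintegralZl//; last 2 first.
    - exact: (sym_integrable tt (lexx _) kn (sQ unit (fun=> t))).
    - exact: (sym_integrable tt (lexx _) kn sS).
    apply: (Rintegral_off0 (symZ (2 * val t) sS)) => x x0.
    have [/(congr1 (fun y => y ^+ 2))] := V t x x0.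
    rewrite expr1n enorm_sqr => V1 V2.
    have : \sum_j (u j x + val t * w j t x) ^+ 2 = \sum_j u j x ^+ 2.
      by rewrite sum_equator_sqr// -V1; apply: eq_bigr => j _; rewrite -V2.
    move=> /eqP; rewrite -subr_eq0 -sumrB => /eqP h.
    apply/eqP; rewrite mulNr -subr_eq0 opprK /S !mulr_sumr -big_split/=; apply/eqP.
    transitivity ((\sum_j ((u j x + val t * w j t x) ^+ 2 - u j x ^+ 2)) * rho x).
      by rewrite mulr_suml; apply: eq_bigr => j _ /=; ring.
    by rewrite h mul0r.
  by rewrite mulrCA SQ; ring.
have [M1 Z1] := sym_Rintegral_bd (lexx _) kn (sQ T id).
have /choice[M2 Y2] : forall ji : 'I_(n + 1) * 'I_n, exists M, forall t : T,
    `|\int[mu]_(x in B) kgrad k ji.2 (w ji.1 t) x ^+ 2| <= M.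
  move=> ji; have sk := @sym_kgrad T 0 k 0 ji.2 _ (sw k ji.1).
  by apply: (sym_Rintegral_bd (m := 2 * k) _ kn (symM sk sk)); lia.
apply: (@is_derive_quadratic _ delta (\sum_j \sum_i M2 (j, i) + `|c| * M1) d0) => t td.
(* The base value of the difference quotient is the energy of the variation at [t = 0]; [E]
   identifies it with the energy of the equator map. *)
have td0 : `|0 : R| < delta by rewrite normr0.
have := E (exist _ t td); have := E (exist _ 0 td0); rewrite /= => -> ->.
rewrite expr0n mul0r addr0 addrAC subrr add0r normrM ger0_norm ?sqr_ge0// mulrC.
rewrite ler_wpM2r ?sqr_ge0// (le_trans (ler_normB _ _))// lerD//.
  rewrite (le_trans (ler_norm_sum _ _ _))// ler_sum// => j _.
  by rewrite (le_trans (ler_norm_sum _ _ _))// ler_sum// => i _; exact: (Y2 (j, i)).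
by rewrite normrM ler_wpM2l//; exact: (Z1 (exist _ t td)).
Unshelve. all: by end_near. Qed.

End energy_variation.

(** * Low dimensions *)

Section dilations.
Context {R : realType} {n : nat}.
Local Notation ei i := (delta_mx ord0 i : 'rV[R]_n).
Local Notation mu := (lebesgue_rV n : {measure set 'rV[R]_n -> \bar R}).
Local Notation B := (@eball R n).

Local Opaque lebesgue_rV.

Lemma is_derive_dilation (f : 'rV[R]_n -> R) c (v x : 'rV[R]_n) : c != 0 ->
  derivable f (c *: x) v ->
  is_derive x v (fun y => f (c *: y)) (c * 'D_v f (c *: x)).
Proof.
move=> c0 df.
have cc : c * h @[h --> (0:R)^'] --> (0:R)^'.
  move=> P /nbhs_ballP[e e0 eP]; apply/nbhs_ballP.
  exists (e / `|c|); first by rewrite /= divr_gt0 ?normr_gt0.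
  move=> h; rewrite /ball/= !sub0r !normrN ltr_pdivlMr ?normr_gt0// => he h0.
  apply: eP; last by rewrite mulf_neq0.
  by rewrite /ball/= sub0r normrN normrM mulrC.
have L : h^-1 *: (f (c *: (h *: v + x)) - f (c *: x)) @[h --> (0:R)^'] -->
    c * 'D_v f (c *: x).
  have L0 := cvg_comp _ _ cc df.
  have L1 : c * ((c * h)^-1 *: (f ((c * h) *: v + c *: x) - f (c *: x))) @[h --> (0:R)^'] -->
      c * 'D_v f (c *: x).
    by apply: cvgM; [exact: cvg_cst|exact: L0].
  apply: cvg_trans L1.
  apply: near_eq_cvg; near=> h.
  rewrite (_ : c *: (h *: v + x) = (c * h) *: v + c *: x); last by rewrite scalerDr scalerA.
  have h0 : h != 0 by near: h; exact: nbhs_dnbhs_neq.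
  by rewrite /GRing.scale/=; field; rewrite h0.
apply: DeriveDef; first by apply/cvg_ex; exists (c * 'D_v f (c *: x)).
exact: cvg_lim L.
Unshelve. all: by end_near. Qed.

(** The open set is left free because the formula serves test functions on the whole space and
    homogeneous functions on the punctured space. *)
Lemma pderivs_dilation (U : set 'rV[R]_n) c (f : 'rV[R]_n -> R) : c != 0 -> open U ->
  (forall x, U x -> U (c *: x)) ->
  (forall s i x, U x -> derivable (pderivs s f) x (ei i)) ->
  forall s x, U x -> pderivs s (fun y => f (c *: y)) x = c ^+ size s * pderivs s f (c *: x).
Proof.
move=> c0 oU cU df; elim=> [|i s IH] x Ux; first by rewrite mul1r.
rewrite /= (@near_eq_derive _ _ _ _ (fun x => c ^+ size s * pderivs s f (c *: x)) x); last first.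
  exact: (near_eq_in oU IH Ux).
have [d1 d2] := is_derive_dilation c0 (df s i _ (cU _ Ux)).
by rewrite (deriveM (derivable_cst _ _ _) d1) derive_cst scaler0 addr0 d2 exprSr -mulrA.
Qed.

Lemma test_fun_dilation c phi : 1 <= c -> test_fun phi ->
  test_fun (fun x : 'rV[R]_n => phi (c *: x)) /\
  forall s x, pderivs s (fun y => phi (c *: y)) x = c ^+ size s * pderivs s phi (c *: x).
Proof.
move=> c1 [sp cp pB]; have c0 : c != 0 by rewrite gt_eqF// (lt_le_trans _ c1).
have cc : continuous (fun x : 'rV[R]_n => c *: x) by exact: scaler_continuous.
have E s x : pderivs s (fun y => phi (c *: y)) x = c ^+ size s * pderivs s phi (c *: x).
  apply: (@pderivs_dilation setT) => //; first exact: openT.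
  by move=> s' i y _; have [_ h] := sp s'; exact: h.
split=> //.
apply: (@test_fun_intro _ _ ((fun x => c *: x) @^-1` closure [set x | phi x != 0])).
- move=> s; rewrite (_ : pderivs s _ = fun x => c ^+ size s * pderivs s phi (c *: x)); last exact/funext.
  have [cs ds] := sp s; split=> [x|i x].
    apply: (@continuous_comp _ _ _ (fun y : 'rV[R]_n => pderivs s phi (c *: y))
      (fun t : R => c ^+ size s * t)).
      exact: (continuous_comp (cc x) (cs _)).
    exact: mulrl_continuous.
  apply: derivableM; first exact: derivable_cst.
  by case: (is_derive_dilation c0 (ds i (c *: x))).
- apply: preimage_closed => [x _|]; [exact: cc|exact: closed_closure].
- move=> x /pB; rewrite /eball/= enormZ ger0_norm ?(le_trans ler01)//.
  by apply: le_lt_trans; rewrite ler_peMl// enorm_ge0.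
- by move=> x cx; apply/eqP/negPn/negP => h; apply: cx; exact: subset_closure.
Qed.

(** As [h] vanishes off the ball and [c >= 1], both integrals extend to the whole space, where the
    change of variables holds for the positive and negative parts. *)
Lemma integral_dilation (c : R) (h : 'rV[R]_n -> R) : 1 <= c ->
  measurable_fun setT h -> mu.-integrable B (EFin \o h) -> (forall x, ~ B x -> h x = 0) ->
  \int[mu]_(x in B) h (c *: x) = c ^- n * \int[mu]_(x in B) h x.
Proof.
move=> c1 mh hi h0; have c0 : 0 < c by rewrite (lt_le_trans _ c1).
have patchB (g : 'rV[R]_n -> R) : (forall x, ~ B x -> g x = 0) -> (EFin \o g) \_ B = EFin \o g.
  move=> g0; apply/funext => x; rewrite patchE; case: ifPn => //; rewrite notin_setE => Bx.
  by rewrite /= g0.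
have hc0 x : ~ B x -> h (c *: x) = 0.
  move=> Bx; apply: h0 => Bcx; apply: Bx; move: Bcx; rewrite /eball/= enormZ gtr0_norm//.
  by apply: le_lt_trans; rewrite ler_peMl// enorm_ge0.
have hi' : mu.-integrable setT (EFin \o h).
  have := (integrable_mkcond (EFin \o h) (@measurable_eball R n)).1 hi.
  by rewrite patchB.
have mE : measurable_fun setT (EFin \o h) by apply/measurable_EFinP.
have mp : measurable_fun setT ((EFin \o h)^\+)%E by exact: measurable_funepos.
have mn : measurable_fun setT ((EFin \o h)^\-)%E by exact: measurable_funeneg.
have IB (g : 'rV[R]_n -> R) : (forall x, ~ B x -> g x = 0) ->
    \int[mu]_(x in B) g x = fine (\int[mu]_x (EFin \o g) x)%E.
  by move=> g0; rewrite -(patchB g g0) -integral_mkcond.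
rewrite (IB h h0) (IB (fun x => h (c *: x)) hc0).
have fp : (\int[mu]_x ((EFin \o h)^\+ x) \is a fin_num)%E.
  by apply: integrable_fin_num => //; exact: integrable_funepos.
have fn : (\int[mu]_x ((EFin \o h)^\- x) \is a fin_num)%E.
  by apply: integrable_fin_num => //; exact: integrable_funeneg.
have -> : (\int[mu]_x (EFin \o (fun x => h (c *: x))) x =
    (c ^- n)%:E * \int[mu]_x (EFin \o h) x)%E.
  rewrite [LHS]integralE [in RHS]integralE muleBr ?fin_num_adde_defl ?fin_numN//.
  rewrite -(ge0_integral_rV_scale c0 mp (funepos_ge0 _)).
  rewrite -(ge0_integral_rV_scale c0 mn (funeneg_ge0 _)).
  by congr (_ - _)%E; apply: eq_integral => x _; rewrite ?funeposE ?funenegE.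
by rewrite fineM//; exact: integrable_fin_num.
Qed.

(** Dominated convergence: the balls of radius 1/(m+1) shrink to the origin, a null set. This
    supplies the small factor that decides the borderline case n = 2k. *)
Lemma cvg_integral_shrinking (h : 'rV[R]_n -> R) : (0 < n)%N -> mu.-integrable B (EFin \o h) ->
  \int[mu]_(x in B) (h x * \1_B (m.+1%:R *: x)) @[m --> \oo] --> 0.
Proof.
move=> n0 hi; have mB : measurable B := @measurable_eball R n.
have mh : measurable_fun B h by apply/measurable_EFinP; exact: measurable_int hi.
have m1 m : measurable_fun B (fun x : 'rV[R]_n => (\1_B (m.+1%:R *: x) : R)).
  apply: measurable_funTS; apply: (measurableT_comp (measurable_indic mB)).
  apply: measurable_coorP => i; under eq_fun do rewrite mxE.
  by apply: measurable_funM => //; exact: measurable_coor.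
have mf m : measurable_fun B (fun x => (h x * \1_B (m.+1%:R *: x))%:E).
  by apply/measurable_EFinP; apply: measurable_funM.
pose H0 x : R := `|h x|.
have hi' : mu.-integrable B (EFin \o H0) by exact: integrable_norm hi.
have le m x : `|h x * \1_B (m.+1%:R *: x)| <= `|h x|.
  by rewrite normrM ler_piMr// indicE; case: (_ \in _); rewrite ?normr1 ?normr0.
have cv : {ae mu, forall x, B x ->
    (fun m => (h x * \1_B (m.+1%:R *: x))%:E) @ \oo --> (cst 0%E x : \bar R)}.
  exists [set 0]; split; [exact: measurable_rV_set1|exact: lebesgue_rV_0|].
  move=> x /= nx; apply: contrapT => /eqP x0; apply: nx => _.
  apply: cvg_near_cst; near=> m; rewrite indicE memNset ?mulr0// /eball/=.
  apply/negP; rewrite -leNgt enormZ ger0_norm// -ler_pdivrMr ?enorm_gt0// mul1r.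
  apply: (@le_trans _ _ m%:R); last by rewrite ler_nat.
  near: m; exact: nbhs_infty_ger.
have dom : {ae mu, forall x m, B x ->
    (`|(h x * \1_B (m.+1%:R *: x))%:E| <= (EFin \o H0) x)%E}.
  by apply: aeW => x m _; rewrite lee_fin.
have [_ _] := dominated_convergence mB mf (measurable_cst _) cv hi' dom.
by rewrite integral0 => /fine_cvg.
Unshelve. all: by end_near. Qed.

(* Testing with phi(c x) gives c^(r-n) I(phi) = +- int g phi(c x), whose right side
   is o(c^(-n/2)) as c -> oo since g is square integrable. *)
Lemma weak_deriv_dilation_eq0 s (f g phi : 'rV[R]_n -> R) : (0 < n <= 2 * size s)%N ->
  measurable_fun setT f -> mu.-integrable B (EFin \o f) ->
  (forall c x, 0 < c -> f (c *: x) = f x) ->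
  L2_ball g -> weak_deriv s f g -> test_fun phi ->
  \int[mu]_(x in B) (f x * pderivs s phi x) = 0.
Proof.
move=> /andP[n0 ns] mf fi fc g2 wg tp; set I := LHS.
have mB : measurable B := @measurable_eball R n.
have tsp := test_fun_pderivs s tp.
have mT psi : test_fun psi -> measurable_fun setT (psi : 'rV[R]_n -> R).
  by move=> tpsi; apply: continuous_off0_measurable => x _; exact: test_fun_continuous.
have gi : mu.-integrable B (EFin \o (fun x => g x ^+ 2)).
  have [mg gfin] := g2; apply/integrableP; split.
    by apply/measurable_EFinP; exact: measurable_funX.
  move: gfin; apply: le_lt_trans; rewrite le_eqVlt; apply/orP; left; apply/eqP.
  by apply: eq_integral => x _; rewrite /= ger0_norm ?sqr_ge0.
have mgB := measurable_int _ gi.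
pose P := \int[mu]_(x in B) (phi x * phi x).
have pi psi : test_fun psi -> mu.-integrable B (EFin \o (fun x => psi x * psi x)).
  move=> tpsi; apply: integrable_test => //.
  have := integrable_test (f := fun=> 1) (integrable_ball_cst (1 : R) n0) tpsi.
  by apply: eq_integrable => // x _; rewrite /= mul1r.
have P0 : 0 <= P by apply: Rintegral_ge0 => x _; rewrite -expr2 sqr_ge0.
pose G m := \int[mu]_(x in B) (g x ^+ 2 * \1_B (m.+1%:R *: x)).
(* A weighted Young inequality replaces Cauchy-Schwarz: [m] goes to infinity first, which removes
   [G m], and then the free weight [L] does. *)
have key m (L : R) : 0 < L -> `|I| <= L / 2 * G m + P / (2 * L).
  move=> L0; pose c : R := m.+1%:R.
  have c1 : 1 <= c by rewrite ler1n.
  have c0 : 0 < c by rewrite (lt_le_trans _ c1).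
  have [tpc pcE] := test_fun_dilation c1 tp.
  pose phic (x : 'rV[R]_n) := phi (c *: x); have tpc' : test_fun phic := tpc.
  set r := size s in ns.
  have fpi : mu.-integrable B (EFin \o (fun x => f x * pderivs s phi x)) by exact: integrable_test.
  have wE : c ^+ r * (c ^- n * I) = (-1) ^+ r * \int[mu]_(x in B) (g x * phic x).
    rewrite -(wg _ tpc) -/r.
    transitivity (\int[mu]_(x in B) (c ^+ r * (f (c *: x) * pderivs s phi (c *: x)))).
      rewrite (integral_dilation (h := fun x => c ^+ r * (f x * pderivs s phi x)) c1).
      - by rewrite RintegralZl// mulrCA.
      - by apply: measurable_funM => //; apply: measurable_funM => //; exact: mT.
      - exact: (integrableZl mB (c ^+ r) fpi).
      - by move=> x Bx; rewrite (test_fun_out tsp Bx) !mulr0.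
    by apply: eq_Rintegral => x _; rewrite pcE fc// mulrCA.
  (* With this weight, division by [c^(r-n)] turns the term in [g^2] into [L / 2 * G m], and the
     other term into [P / (2 L)] times [c^(n-2r)], which is at most 1 because n <= 2r. *)
  pose la := L * (c ^+ r / c ^+ n).
  have la0 : 0 < la by rewrite mulr_gt0// divr_gt0// exprn_gt0.
  have gpi : mu.-integrable B (EFin \o (fun x => g x * phic x)).
    by apply: integrable_test => //; exact: L2_ball_integrable.
  have ppi := pi _ tpc'.
  have Ggi : mu.-integrable B (EFin \o (fun x => g x ^+ 2 * \1_B (c *: x))).
    apply: le_integrable gi => //.
      apply/measurable_EFinP; apply: measurable_funM; first exact/measurable_EFinP.
      apply: measurable_funTS; apply: (measurableT_comp (measurable_indic mB)).
      apply: measurable_coorP => i; under eq_fun do rewrite mxE.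
      by apply: measurable_funM => //; exact: measurable_coor.
    move=> x _; rewrite !abse_EFin lee_fin normrM ler_piMr// indicE.
    by case: (_ \in _); rewrite ?normr1 ?normr0.
  have pE : \int[mu]_(x in B) (phic x * phic x) = c ^- n * P.
    apply: (integral_dilation (h := fun x => phi x * phi x) c1).
    - by apply: measurable_funM; exact: mT.
    - exact: pi.
    - by move=> x Bx; rewrite (test_fun_out tp Bx) mul0r.
  have JE : `|\int[mu]_(x in B) (g x * phic x)| <= la / 2 * G m + (2 * la)^-1 * (c ^- n * P).
    rewrite (le_trans (le_normr_Rintegral mB gpi))// -pE /G -!RintegralZl// -RintegralD//; last 2 first.
    - exact: (integrableZl mB (la / 2) Ggi).
    - exact: (integrableZl mB (2 * la)^-1 ppi).
    apply: le_Rintegral => //.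
    - exact: (integrable_norm gpi).
    - exact: (integrableD mB (integrableZl mB (la / 2) Ggi) (integrableZl mB (2 * la)^-1 ppi)).
    move=> x Bx; rewrite indicE; have [Bcx|Bcx] := boolP (c *: x \in B); last first.
      rewrite notin_setE in Bcx.
      by rewrite /phic (test_fun_out tp Bcx) !mulr0 normr0 addr0.
    rewrite mulr1 normrM -(real_normK (num_real (g x))) -[phic x * phic x](real_normK (num_real (phic x))).
    move: (`|g x|) (`|phic x|) => a b; rewrite -subr_ge0.
    rewrite (_ : _ - _ = (la * a - b) ^+ 2 / (2 * la)); last by field; rewrite gt_eqF.
    by rewrite divr_ge0 ?sqr_ge0// mulr_ge0// ltW.
  have cn0 : 0 < c ^+ n by rewrite exprn_gt0.
  have cr0 : 0 < c ^+ r by rewrite exprn_gt0.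
  have : c ^+ r / c ^+ n * `|I| <= la / 2 * G m + (2 * la)^-1 * (c ^- n * P).
    apply: le_trans JE; rewrite -[leRHS]mul1r -(normr_sign _ (odd r)) signr_odd -normrM -wE.
    by rewrite mulrA normrM (ger0_norm (ltW (divr_gt0 cr0 cn0))).
  rewrite -ler_pdivlMl; last by rewrite divr_gt0.
  move=> /le_trans; apply; rewrite mulrDr lerD//.
    by rewrite /la le_eqVlt; apply/orP; left; apply/eqP; field; rewrite !gt_eqF.
  have -> : (c ^+ r / c ^+ n)^-1 * ((2 * la)^-1 * (c ^- n * P)) =
      P / (2 * L) * (c ^+ n / (c ^+ r * c ^+ r)).
    by rewrite /la; field; rewrite !gt_eqF.
  rewrite ler_piMr//; first by rewrite divr_ge0// mulr_ge0// ltW.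
  by rewrite ler_pdivrMr ?mulr_gt0// mul1r -exprD ler_weXn2l// addnn -mul2n.
have IL L : 0 < L -> `|I| <= P / (2 * L).
  move=> L0; rewrite -[leRHS]add0r.
  have cG : L / 2 * G m + P / (2 * L) @[m --> \oo] --> 0 + P / (2 * L).
    apply: cvgD; last exact: cvg_cst.
    rewrite -[X in _ --> X](mulr0 (L / 2)); apply: cvgM; first exact: cvg_cst.
    exact: cvg_integral_shrinking.
  rewrite -(cvg_lim _ cG)//; apply: limr_ge; first by apply: cvgP cG.
  by apply: nearW => m; exact: key.
apply/eqP; rewrite -normr_le0; apply/ler_addgt0Pr => e e0.
(* With L = P/e + 1 one has 2 L e = 2P + 2e >= P, hence P / (2 L) <= e; the summand 1 keeps L
   positive when P = 0. *)
rewrite add0r (le_trans (IL (P / e + 1) _))//; first by rewrite ltr_wpDl// divr_ge0// ltW.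
rewrite ler_pdivrMr; last by rewrite mulr_gt0// ltr_wpDl// divr_ge0// ltW.
rewrite (_ : e * _ = P + (P + 2 * e)); last by field; rewrite gt_eqF.
by rewrite lerDl addr_ge0// mulr_ge0// ltW.
Qed.

End dilations.

Section off_origin.
Context {R : realType}.

Lemma lebesgue_rV_ball_gt0 n (x : 'rV[R]_n) (e : R) : 0 < e -> (0 < lebesgue_rV n (ball x e))%E.
Proof.
move=> e0; elim: n x => [|n IH] x.
  rewrite /= /dirac indicE mem_set ?lte_fin//.
  by rewrite [x]thinmx0; exact: ballxx.
pose y : 'rV[R]_n := \row_j x ord0 (lift ord0 j).
rewrite lebesgue_rVS; apply: (@lt_le_trans _ _
  ((lebesgue_measure \x lebesgue_rV n) (ball (x ord0 ord0) e `*` ball y e))%E).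
  rewrite product_measure1E//; [|exact: measurable_ball|exact: measurable_mxball].
  apply: mule_gt0 => //.
  by rewrite [X in (_ < X)%E](@lebesgue_measure_ball R (x ord0 ord0) e (ltW e0)) lte_fin mulrn_wgt0.
apply: le_measure; rewrite ?inE.
- by apply: measurableX; [exact: measurable_ball|exact: measurable_mxball].
- rewrite -[X in measurable X]setTI; apply: (@measurable_rV_cons R n) => //.
  exact: measurable_mxball.
move=> [t z]/= [xt yz]; split=> // i j.
rewrite (_ : i = ord0); last by apply/val_inj; case: i => -[].
case: (unliftP ord0 j) => [k|] ->; last by rewrite rV_cons0.
by rewrite rV_consS; have [_ /(_ ord0 k)] := yz; rewrite mxE.
Qed.

Local Opaque lebesgue_rV.

Lemma ae_eq0_continuous n (U : set 'rV[R]_n) (F : 'rV[R]_n -> R) : open U ->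
  (forall x, U x -> {for x, continuous F}) ->
  {ae lebesgue_rV n, forall x, U x -> F x = 0} -> forall x, U x -> F x = 0.
Proof.
move=> oU cF [N [mN N0 sN]] x Ux; apply: contrapT => /eqP Fx.
have : \forall y \near x, U y /\ F y != 0.
  apply: filterI; first exact: near_in.
  by apply: (@cvgr_neq0 R R^o _ (nbhs x) _ F (F x)) => //; exact: cF.
move=> /nbhs_ballP[e /= e0 xe].
have := lebesgue_rV_ball_gt0 x e0; rewrite ltNge => /negP; apply.
rewrite -N0; apply: le_measure; rewrite ?inE//; first exact: measurable_mxball.
move=> y /xe[Uy Fy]; apply: sN => /= /(_ Uy) h.
by rewrite h eqxx in Fy.
Qed.

End off_origin.

(** * Localization of weak derivatives away from the origin *)

Section weak_derivatives_off0.
Context {R : realType} {p : nat}.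
Local Notation n := p.+2.
Local Notation ei i := (delta_mx ord0 i : 'rV[R]_n).
Local Notation mu := (lebesgue_rV n : {measure set 'rV[R]_n -> \bar R}).
Local Notation B := (@eball R n).
Local Opaque lebesgue_rV.

Lemma pderivs_near0 r s (phi : 'rV[R]_n -> R) : (forall x, enorm x < r -> phi x = 0) ->
  forall x, enorm x < r -> pderivs s phi x = 0.
Proof.
pose K := [set x : 'rV[R]_n | r <= enorm x].
have cK : closed K.
  apply: (@preimage_closed _ _ (@enorm R n) [set t | r <= t]) => [x _|]; last exact: closed_ge.
  exact: continuous_enorm.
have KE x : ~ K x <-> enorm x < r by rewrite /K/= ltNge; split => /negP.
move=> p0 x /KE; elim: s x => [|i s IH] x; first by move=> /KE /p0.
by move=> Kx; exact: (derive_supp_in i cK IH Kx).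
Qed.

(** A test function that vanishes near the origin may be given any order. The order [- d] cancels
    that of [f], so each integration by parts has total order 1, below the dimension, however
    singular the derivatives of [f] become. *)
Lemma test_fun_off0_weak_deriv s d r (f phi : 'rV[R]_n -> R) :
  (forall N, sym N d (fun _ : unit => f)) -> 0 < r ->
  (forall x, enorm x < r -> phi x = 0) -> test_fun phi ->
  \int[mu]_(x in B) (f x * pderivs s phi x) =
  (-1) ^+ size s * \int[mu]_(x in B) (pderivs (rev s) f x * phi x).
Proof.
move=> sf r0 p0 tp; elim: s d f sf => [|i s IH] d f sf /=; first by rewrite expr0 mul1r.
have tsp := test_fun_pderivs s tp.
rewrite -/(pderivs s phi) (@integral_by_parts _ _ (closure [set x | pderivs s phi x != 0])
  f (pderivs s phi) 0 0 d (- d) 1 i (sf _)).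
- by rewrite (IH _ _ (fun N => sym_derive _ i (sf N.+1))) pderivs_rev_cons exprS mulN1r mulNr.
- by apply: test_fun_sym => //; right; exists r => //; exact: pderivs_near0.
- by rewrite subrr add0r.
- by [].
- exact: closed_closure.
- by have [_ _] := tsp.
- by move=> x h; apply/eqP/negPn/negP => fx; apply: h; exact: subset_closure.
Qed.

(** A smooth [chi] that vanishes for |y| < |x|/2 and is positive at [x] makes the product with the
    derivative bounded, hence integrable. As [chi * phi] is a test function vanishing near the
    origin, integration by parts applies to it; the fundamental lemma gives zero a.e., and
    continuity gives it at [x]. *)
Lemma pderivs_eq0_off0 s (f : 'rV[R]_n -> R) : (forall N, sym N 0 (fun _ : unit => f)) ->
  (forall phi, test_fun phi -> \int[mu]_(x in B) (f x * pderivs s phi x) = 0) ->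
  forall x, B x -> x != 0 -> pderivs (rev s) f x = 0.
Proof.
move=> sf I0 x Bx x0.
have sF N : sym N (size s)%:Z (fun _ : unit => pderivs (rev s) f).
  by have := sym_pderivs (sf (N + size s)%N); rewrite add0r.
pose F := pderivs (rev s) f.
pose r := enorm x / 2; have ex0 : 0 < enorm x by rewrite enorm_gt0.
have r0 : 0 < r by rewrite divr_gt0.
pose q (y : 'rV[R]_n) := \sum_j y ord0 j * y ord0 j + - r ^+ 2.
have qE y : q y = enorm y ^+ 2 - r ^+ 2.
  by rewrite enorm_sqr /q; congr (_ - _); apply: eq_bigr => j _; rewrite expr2.
pose chi y := bump1 (q y).
have rchi : regs chi.
  apply: regs_bump1; apply: regsD; last exact: regs_cst.
  by apply: regs_sum => j; apply: regsM; exact: regs_coor.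
have chi0 y : enorm y < r -> chi y = 0.
  move=> yr; apply: bump1_eq0; rewrite qE subr_le0 lerXn2r// ?nnegrE ?enorm_ge0 ?ltW//.
have chix : 0 < chi x.
  rewrite /chi bump1_gt0// qE subr_gt0 ltrXn2r// ?nnegrE ?enorm_ge0 ?(ltW r0)//.
  by rewrite /r ltr_pdivrMr// ltr_pMr// ltr1n.
have cchi : continuous chi by have [] := regs_smooth rchi [::].
have ch y : y != 0 -> {for y, continuous (fun y => F y * chi y)}.
  by move=> y0; apply: continuousM; [exact: (sym_continuous tt (sF 0%N) y0)|exact: cchi].
have hi : mu.-integrable B (EFin \o (fun y => F y * chi y)).
  apply: (@enorm_bd_integrable _ _ unit 0 0 (fun _ y => F y * chi y) tt) => //.
    exact: continuous_off0_measurable.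
  have [C C0 FC] := reg_bd (sF 0%N); exists (C * r ^- size s).
    by rewrite mulr_ge0// invr_ge0 exprn_ge0// ltW.
  move=> t y y0; rewrite oppr0 expr0z mulr1.
  have [yr|yr] := ltP (enorm y) r.
    by rewrite chi0// mulr0 normr0 mulr_ge0// invr_ge0 exprn_ge0// ltW.
  rewrite normrM -[leRHS]mulr1 ler_pM//; last by rewrite ger0_norm ?bump1_ge0// bump1_le1.
  rewrite (le_trans (FC tt y y0))// ler_wpM2l// -exprnN lef_pV2 ?posrE ?exprn_gt0 ?enorm_gt0//.
  by rewrite lerXn2r// ?nnegrE ?enorm_ge0// ltW.
have := fundamental_lemma hi.
case.
  move=> phi tp; have [sp _ pB] := tp.
  have tcp : test_fun (fun y => chi y * phi y).
    apply: (test_fun_intro (K := closure [set y | phi y != 0])).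
    - by apply: regs_smooth; apply: regsM => //; exact: smooth_regs.
    - exact: closed_closure.
    - exact: pB.
    - move=> y cy; rewrite (_ : phi y = 0) ?mulr0//.
      by apply/eqP/negPn/negP => h; apply: cy; exact: subset_closure.
  have := I0 _ tcp; rewrite (test_fun_off0_weak_deriv s sf r0 _ tcp); last first.
    by move=> y yr; rewrite chi0// mul0r.
  move=> /eqP; rewrite mulf_eq0 signr_eq0/= => /eqP <-.
  by apply: eq_Rintegral => y _; rewrite mulrA.
move=> N [mN N0 sN].
have : F x * chi x = 0.
  apply: (@ae_eq0_continuous _ _ (B `&` [set y | y != 0]) (fun y => F y * chi y)) => //.
  - by apply: openI; [exact: open_eball|exact: open_neq0].
  - by move=> y [_ y0]; exact: ch.
  - exists N; split=> // y /= h; apply: sN => /= h'; apply: h => -[By _]; exact: h'.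
by move=> /eqP; rewrite mulf_eq0 (gt_eqF chix) orbF => /eqP.
Qed.

End weak_derivatives_off0.

(** * The contradiction along lines, in dimension at least two *)

Section lines.
Context {R : realType} {p : nat}.
Local Notation n := p.+2.
Local Notation mu := (lebesgue_rV n : {measure set 'rV[R]_n -> \bar R}).
Local Notation B := (@eball R n).
Local Notation d0 r := (pderivs (nseq r (ord0 : 'I_n))).

Lemma sym_pderivs_nseq d r (f : 'rV[R]_n -> R) : (forall N, sym N d (fun _ : unit => f)) ->
  forall N, sym N (d + r%:Z) (fun _ : unit => d0 r f).
Proof.
move=> sf N; have := @sym_pderivs _ _ unit N d (nseq r ord0) _ (sf _).
by rewrite rev_nseq size_nseq.
Qed.

(* Off the origin the derivatives of order r >= 1 decay along the lines parallel
   to the first axis, so none of them can be a nonzero constant there. *)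
Lemma line_constant r (f : 'rV[R]_n -> R) : (forall N, sym N 0 (fun _ : unit => f)) ->
  (forall x, x != 0 -> d0 r.+1 f x = 0) ->
  forall s t (y : 'rV[R]_p.+1), y != 0 -> f (rV_ins ord0 s y) = f (rV_ins ord0 t y).
Proof.
move=> sf fr s t y y0.
have cst j : (forall t, d0 j.+1 f (rV_ins ord0 t y) = 0) ->
    forall s t, d0 j f (rV_ins ord0 s y) = d0 j f (rV_ins ord0 t y).
  move=> h s' t'; apply: (@is_derive_0_is_cst _ (fun t => d0 j f (rV_ins ord0 t y))) => z.
  have := is_derive_rV_ins (sym_derivable ord0 tt (sym_pderivs_nseq j sf 1) (rV_ins_neq0 ord0 z y0)).
  by rewrite -[X in is_derive _ _ _ X]/(d0 j.+1 f (rV_ins ord0 z y)) h.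
apply: (cst 0%N); have {fr} : forall t, d0 r.+1 f (rV_ins ord0 t y) = 0.
  by move=> z; apply: fr; exact: rV_ins_neq0.
elim: r => [//|r IH] fr; apply: IH => z; apply: contrapT => /eqP v0.
have [C C0 FC] := reg_bd (sym_pderivs_nseq r.+1 sf 0).
(* [T] is chosen so that [C / T < |v|]. As [T >= 1], the derivative of order r + 1 at the point with
   first coordinate [T] is at most [C / T], whereas constancy along the line makes it equal to
   [v]. *)
set v := d0 r.+1 f _ in v0; pose T := C / `|v| + 1.
have nv : 0 < `|v| by rewrite normr_gt0.
have T1 : 1 <= T by rewrite lerDr divr_ge0.
have := FC tt _ (rV_ins_neq0 ord0 T y0).
rewrite (cst r.+1 fr T z) -/v add0r leNgt => /negP; apply.
have eT : T <= enorm (rV_ins ord0 T y).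
  have := ler_coor_enorm (rV_ins ord0 T y) ord0; rewrite rV_ins_coor.
  exact/le_trans/ler_norm.
have T0 : 0 < T by rewrite (lt_le_trans _ T1).
have E0 : 0 < enorm (rV_ins ord0 T y) by rewrite (lt_le_trans T0).
apply: (@le_lt_trans _ _ (C / T)); last first.
  by rewrite ltr_pdivrMr// /T mulrDr mulr1 mulrCA divff ?gt_eqF// mulr1 ltrDl.
rewrite ler_wpM2l// -exprnN lef_pV2 ?posrE ?exprn_gt0//.
apply: (le_trans eT); rewrite exprS ler_peMr ?enorm_ge0// exprn_ege1//.
exact: le_trans T1 eT.
Qed.

Lemma sobolev_equator_ge2 k : (0 < k)%N -> sobolev k (@equator R n) -> (2 * k < n)%N.
Proof.
case: k => // k _ /(_ (lshift 1 ord0)) [_] /(_ (nseq k.+1 ord0)).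
rewrite size_nseq => /(_ (leqnn _)) [g g2 wg]; rewrite ltnNge; apply/negP => nk.
set f := Defs.coord _ _ in wg.
have sf N : sym N 0 (fun _ : unit => f) by exact: sym_equator.
have fE x : f x = x ord0 ord0 * (enorm x)^-1 by rewrite /f coord_equatorl.
have fc c x : 0 < c -> f (c *: x) = f x.
  move=> c0; rewrite !fE enormZ gtr0_norm// mxE invfM mulrACA divff ?mul1r// gt_eqF//.
have I0 phi : test_fun phi -> \int[mu]_(x in B) (f x * d0 k.+1 phi x) = 0.
  apply: (weak_deriv_dilation_eq0 _ _ _ fc g2 wg); rewrite ?size_nseq//.
    exact: (sym_measurable tt (sf 0%N)).
  exact: (sym_integrable tt (m := 0) _ _ (sf 0%N)).
have F0 x : x != 0 -> d0 k.+1 f x = 0.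
  move=> x0; have ex0 : 0 < enorm x by rewrite enorm_gt0.
  (* Vanishing is known inside the ball only; homogeneity carries it to [x] from the point [c x] of
     norm 1/2. *)
  pose c := (2 * enorm x)^-1; have c0 : 0 < c by rewrite invr_gt0 mulr_gt0.
  have := @pderivs_dilation R n [set x | x != 0] c f _ (@open_neq0 R n) _ _ (nseq k.+1 ord0) x x0.
  rewrite (_ : (fun y => f (c *: y)) = f); last by apply/funext => y; exact: fc.
  move=> ->; rewrite ?gt_eqF//.
  - have := pderivs_eq0_off0 sf I0; rewrite rev_nseq => ->; first by rewrite mulr0.
    + rewrite /eball/= enormZ gtr0_norm// /c invfM -mulrA mulVf ?gt_eqF// mulr1.
      by rewrite invf_lt1 ?ltr1n.
    + by rewrite scaler_eq0 (gt_eqF c0).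
  - by move=> y /= y0; rewrite scaler_eq0 (gt_eqF c0).
  - move=> s i y y0; have := @sym_pderivs _ _ unit 1 0 (rev s) _ (sf _).
    by rewrite revK => /(sym_derivable i tt)/(_ y0).
(* On the line over this [y] the component u_0 is 0 where the first coordinate is 0 and positive
   where it is 1. *)
pose y : 'rV[R]_p.+1 := const_mx 1.
have y0 : y != 0.
  by apply/eqP => /rowP /(_ ord0); rewrite !mxE => /eqP; rewrite oner_eq0.
have := line_constant sf F0 0 1 y0; rewrite !fE !rV_ins_coor mul0r mul1r => /eqP.
by rewrite eq_sym invr_eq0 enorm_eq0 (negPf (rV_ins_neq0 _ _ y0)).
Qed.

End lines.

(** * Dimension one *)

Section dimension_one.
Context {R : realType}.
Local Notation mu := (lebesgue_rV 1 : {measure set 'rV[R]_1 -> \bar R}).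
Local Notation B := (@eball R 1).
Local Opaque lebesgue_rV.

(** Off the origin the sign function has zero derivative, so vanishing there is no contradiction.
    The jump is detected by the integral of [u_0 * phi'] itself: for [phi] radially decreasing the
    integrand has constant sign, and a zero integral would make it vanish a.e. *)
Lemma not_sobolev_equator_1 k : (0 < k)%N -> ~ sobolev k (@equator R 1).
Proof.
move=> k0 /(_ (lshift 1 ord0)) [_] /(_ [:: ord0] k0) [g g2 wg].
set f := Defs.coord _ _ in wg.
have sf N : sym N 0 (fun _ : unit => f) by exact: sym_equator.
have fE x : f x = x ord0 ord0 * (enorm x)^-1 by rewrite /f coord_equatorl.
have fc c x : 0 < c -> f (c *: x) = f x.
  move=> c0; rewrite !fE enormZ gtr0_norm// mxE invfM mulrACA divff ?mul1r// gt_eqF//.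
pose q (x : 'rV[R]_1) := 2 * (1 - \sum_j x ord0 j ^+ 2) - 1.
pose phi : 'rV[R]_1 -> R := cutoff [::] 1.
have phiE x : phi x = bump1 (q x) by rewrite /phi /cutoff big_nil mulr1.
have tp : test_fun phi by exact: cutoff_test_fun.
pose e0 : 'rV[R]_1 := delta_mx ord0 ord0.
(* [F] is [- u_0 * phi']: the inner derivative [- 4 x] of [q] meets the factor [x / |x|], and the
   product [4 x^2 / |x|] shows the sign. *)
pose F (x : 'rV[R]_1) := 4 * x ord0 ord0 ^+ 2 * (enorm x)^-1 * flat ('X^2 * (1 - 1^`())) (q x).
have FE x : f x * 'D_e0 phi x = - F x.
  have [d1 d2] := is_derive_enorm_sqr x e0.
  have dM := derivableM (derivable_cst (-2 : R) x e0) d1.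
  have [dq1 dq2] : is_derive x e0 q (- 4 * x ord0 ord0).
    rewrite (_ : q = fun y : 'rV[R]_1 => 1 + (-2) * (\sum_j y ord0 j ^+ 2)); last first.
      by apply/funext => y; rewrite /q; move: (\sum_j _) => S; ring.
    apply: DeriveDef; first exact: (derivableD (derivable_cst (1 : R) x e0) dM).
    rewrite (deriveD (derivable_cst (1 : R) x e0) dM) (deriveM (derivable_cst _ _ _) d1) d2 !derive_cst.
    by rewrite big_ord1 mxE eqxx /GRing.scale/=; ring.
  have [_] := is_derive_line dq1 (is_derive_flat 1 (q x)).
  rewrite (_ : phi = fun x => bump1 (q x)); last exact/funext.
  move=> ->; rewrite dq2 fE /F; ring.
have flatE t : flat ('X^2 * (1 - 1^`()) : {poly R}) t = t ^- 2 * bump1 t.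
  rewrite /bump1 /flat; case: ifPn => _; last by rewrite mulr0.
  by rewrite -polyC1 derivC subr0 hornerM hornerXn hornerC mulr1 mul1r exprVn.
have F0 x : 0 <= F x.
  rewrite /F flatE -exprVn; apply: mulr_ge0; last by rewrite mulr_ge0 ?sqr_ge0 ?bump1_ge0.
  apply: mulr_ge0; last by rewrite invr_ge0 enorm_ge0.
  by rewrite mulr_ge0 ?sqr_ge0.
have mB : measurable B := @measurable_eball R 1.
have fi : mu.-integrable B (EFin \o f) := sym_integrable tt (m := 0) (lexx _) (ltn0Sn _) (sf 0%N).
have tD : test_fun ('D_e0 phi) by exact: test_fun_derive.
have Fi : mu.-integrable B (EFin \o F).
  have := integrable_test fi tD; move=> /(integrableN).
  by apply: eq_integrable => // x _; rewrite /= FE opprK.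
have : \int[mu]_(x in B) F x = 0.
  apply/eqP; rewrite -oppr_eq0 -mulN1r -RintegralZl//.
  have := @weak_deriv_dilation_eq0 R 1 [:: ord0] f g phi isT (sym_measurable tt (sf 0%N)) fi fc g2 wg tp.
  by move=> <-; apply/eqP; apply: eq_Rintegral => x _; rewrite mulN1r -FE.
move=> IF0; have : (\int[mu]_(x in B) `|(F x)%:E| = 0)%E.
  rewrite -[RHS]/(0%:E) -IF0 fineK; last exact: integrable_fin_num.
  by apply: eq_integral => x _; rewrite /= ger0_norm.
move=> /(ae_eq_integral_abs mu mB (measurable_int _ Fi)).1 [N [mN N0 sN]].
have cF x : x != 0 -> {for x, continuous F}.
  move=> x0; rewrite (_ : F = fun x => - (f x * 'D_e0 phi x)); last first.
    by apply/funext => y; rewrite FE opprK.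
  apply: continuousN; apply: continuousM; first exact: (sym_continuous tt (sf 0%N) x0).
  exact: test_fun_continuous.
(* At |x| = 1/2 the bump has argument 2 (1 - 1/4) - 1 = 1/2 > 0, so [F] is positive there, although
   continuity and vanishing a.e. force it to be 0. *)
pose a : 'rV[R]_1 := const_mx 2^-1.
have a0 : a != 0 by apply/eqP => /rowP /(_ ord0); rewrite !mxE => /eqP; rewrite invr_eq0 pnatr_eq0.
have aE : enorm a ^+ 2 = 4^-1 by rewrite enorm_sqr big_ord1 mxE; field.
have : F a = 0.
  apply: (@ae_eq0_continuous _ _ (B `&` [set y | y != 0]) F) => //.
  - by apply: openI; [exact: open_eball|exact: open_neq0].
  - by move=> y [_ y0]; exact: cF.
  - exists N; split=> // y /= h; apply: sN => /= h'; apply: h => -[By _].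
    by have [] := h' By.
  - split=> //; rewrite /eball/= -(@ltr_pXn2r _ 2)// ?nnegrE ?enorm_ge0// aE expr1n.
    by rewrite invf_lt1// ltr1n.
have qa : q a = 2^-1 by rewrite /q -enorm_sqr aE; field.
have b0 : 0 < bump1 (2^-1 : R) by rewrite bump1_gt0// invr_gt0.
rewrite /F flatE qa mxE; apply/eqP; rewrite !mulf_neq0 ?invr_eq0 ?enorm_eq0 ?expf_neq0 ?gt_eqF//.
Qed.

End dimension_one.

Theorem proposition1p1 (R : realType) (k n : nat)
    (hk : (0 < k)%N) (hn : (0 < n)%N) :
  (sobolev_sphere k (@equator R n) <-> (2 * k + 1 <= n)%N) /\
  ((2 * k + 1 <= n)%N -> ext_harmonic k (@equator R n)).
Proof.
rewrite addn1; case: n hn => [//|[|p]] _.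
  (* For n = 1 the dimension condition fails since k > 0, so what remains is that the equator map is
     not a Sobolev map. *)
  rewrite (_ : (2 * k < 1)%N = false); last by lia.
  by split=> //; split=> // -[/(not_sobolev_equator_1 hk)].
split; last exact: equator_ext_harmonic.
split=> [[sk _]|]; first exact: sobolev_equator_ge2 sk.
exact: equator_sobolev_sphere.
Qed.
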